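(* Assume that $u_0\in X$, $E(u_0)<d$ and $D(u_0)>0$, and let $\delta_1<\delta_2$ be the two roots of the equation $d(\delta)=E(u_0)$. Then the weak solution $u$ of the problem $$\partial_t (u^{p})=\Delta u+u^{p}\ \text{ in }\Omega\times(0,T),\qquad u(x,0)=u_0(x)\ \text{ in }\Omega,\qquad u=0\ \text{ on }\partial\Omega\times(0,T)$$ undergoes finite-time extinction, that is, $$\|u(t)\|_{p+1}^{p+1}\le\begin{cases}\big(B_0^{1-\gamma}-C(1-\gamma)t\big)^{\frac1{1-\gamma}},&0\le t<t^*,\\ 0,&t\ge t^*,\end{cases}$$ where $\gamma=\frac2{p+1}$, $B_0=\|u(0)\|_{p+1}^{p+1}$, $C=S(1-\delta_1)\frac{p+1}{p}$, and $t^*=\frac{B_0^{1-\gamma}}{C(1-\gamma)}$.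
   Context: $\Omega\subset\mathbb{R}^N$, $N\ge 3$, is a smooth bounded domain, $p=\frac{N+2}{N-2}$, $\|\cdot\|_q$ is the norm of $L^q(\Omega)$, and $X=H_0^1(\Omega)$ with norm $\|\nabla u\|_2$. For $u\in X$ put $A(u)=\int_\Omega|\nabla u|^2dx$, $B(u)=\int_\Omega|u|^{p+1}dx$, $E(u)=\frac12A(u)-\frac1{p+1}B(u)$, $D(u)=A(u)-B(u)$. Let $\mathcal N=\{u\in X: D(u)=0,\ u\ne0\}$ and $d=\inf_{v\in\mathcal N}E(v)$. For $\delta>0$ put $D_\delta(u)=\delta A(u)-B(u)$, $\mathcal N_\delta=\{u\in X: D_\delta(u)=0,\ \|\nabla u\|_2\ne0\}$, $d(\delta)=\inf_{u\in\mathcal N_\delta}E(u)$. The Sobolev constant is $S=\inf\{A(u)/\|u\|_{p+1}^2: u\in X\setminus\{0\}\}$. Weak solution on $\Omega\times(0,T)$: $u\in L^\infty(0,T;X)$, $\frac{\partial}{\partial t}\big(u^{\frac{p+1}{2}}\big)\in L^2(0,T;L^2(\Omega))$, and $((u^p)_t,w)+(\nabla u,\nabla w)=(|u|^p,w)$ for all $w\in X$, $t\in(0,T)$ (in the distribution sense), with $u(x,0)=u_0(x)\in X$; $(\cdot,\cdot)$ is the $L^2(\Omega)$ pairing. *)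

(* Defs.v *)
(* MathComp-Analysis, over an arbitrary [R : realType]. *)
From HB Require Import structures.
From mathcomp Require Import all_boot all_order all_algebra.
From mathcomp Require Import all_classical all_reals all_analysis.

Set Implicit Arguments.
Unset Strict Implicit.
Unset Printing Implicit Defensive.

Import Order.TTheory GRing.Theory Num.Theory.
Import numFieldNormedType.Exports.

Local Open Scope classical_set_scope.
Local Open Scope ring_scope.

(* ['rV[R]_n] carries the sigma-algebra generated by its coordinates, which is
   the Borel sigma-algebra of R^n. *)
Definition rV_display : measure_display. Proof. exact. Qed.

Section rV_measurable.
Variables (R : realType) (n : nat).

Definition rV_coord (i : 'I_n) (x : 'rV[R]_n) : measurableTypeR R := x 0 i.

Let rV_set0 : g_sigma_preimage rV_coord set0.
Proof. exact: sigma_algebra0. Qed.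

Let rV_setC A : g_sigma_preimage rV_coord A -> g_sigma_preimage rV_coord (~` A).
Proof. exact: sigma_algebraC. Qed.

Let rV_bigcup (F : _^nat) : (forall i, g_sigma_preimage rV_coord (F i)) ->
  g_sigma_preimage rV_coord (\bigcup_i (F i)).
Proof. exact: sigma_algebra_bigcup. Qed.

HB.instance Definition _ := @isMeasurable.Build rV_display
  'rV[R]_n (g_sigma_preimage rV_coord) rV_set0 rV_setC rV_bigcup.

Lemma measurable_rV_coord (i : 'I_n) : measurable_fun setT (rV_coord i).
Proof.
move=> _ Y mY; rewrite setTI; apply: sub_sigma_algebra => /=.
rewrite -bigcup_seq/=; exists i => /=; first by rewrite mem_index_enum.
by exists Y => //; rewrite setTI.
Qed.

Lemma measurable_fun_rVP d (T : measurableType d) (f : T -> 'rV[R]_n) :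
  (forall i, measurable_fun setT (rV_coord i \o f)) -> measurable_fun setT f.
Proof.
move=> mf _ A mA; rewrite setTI.
have sA : sigma_algebra setT [set B : set 'rV[R]_n | measurable (f @^-1` B)].
  split => /=.
  - by rewrite preimage_set0.
  - by move=> B mB; rewrite setTD preimage_setC; exact: measurableC.
  - by move=> F mF; rewrite preimage_bigcup; exact: bigcup_measurable.
apply: (smallest_sub sA _ mA) => B.
rewrite -bigcup_seq => -[i _] [C mC <-] /=.
by rewrite setTI -comp_preimage -[X in measurable X]setTI; exact: mf.
Qed.

End rV_measurable.

(* Lebesgue measure on R^n: on R^(n+1) it is the image of the product of
   Lebesgue measures on R and on R^n under (a, x) |-> row_mx a x. *)
Section lebesgue_rV.
Variable R : realType.

Let cons_rV n (z : measurableTypeR R * 'rV[R]_n) : 'rV[R]_n.+1 :=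
  row_mx (z.1)%:M z.2.

Let uncons_rV n (x : 'rV[R]_n.+1) : measurableTypeR R * 'rV[R]_n :=
  (x 0 0, @rsubmx R 1 1 n x).

Let cons_rVK n : cancel (@cons_rV n) (@uncons_rV n).
Proof.
move=> [a x]; rewrite /uncons_rV /cons_rV /=; congr pair.
  transitivity (row_mx (a%:M : 'M[R]_1) x 0 (lshift n (0 : 'I_1))).
    by congr (fun_of_matrix _ _ _); exact/val_inj.
  by rewrite row_mxEl mxE eqxx mulr1n.
by rewrite row_mxKr.
Qed.

Let measurable_cons_rV n : measurable_fun setT (@cons_rV n).
Proof.
apply: measurable_fun_rVP => i; case: (@split_ordP 1 n i) => j ->.
  rewrite (_ : _ \o _ = fst); first exact: measurable_fst.
  apply/funext => z; apply: etrans (row_mxEl _ _ _ _) _.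
  by rewrite mxE (ord1 j) eqxx mulr1n.
rewrite (_ : _ \o _ = rV_coord j \o snd).
  by apply: measurableT_comp; [exact: measurable_rV_coord|exact: measurable_snd].
by apply/funext => z; exact: row_mxEr.
Qed.

Let measurable_uncons_rV n : measurable_fun setT (@uncons_rV n).
Proof.
apply/measurable_fun_pairP; split; first exact: (measurable_rV_coord ord0).
apply: measurable_fun_rVP => i.
rewrite (_ : _ \o _ = rV_coord (rshift 1 i)); first exact: measurable_rV_coord.
by apply/funext => x /=; rewrite /rV_coord !mxE.
Qed.

Let sigma_finite_prod d1 d2 (T1 : measurableType d1) (T2 : measurableType d2)
    (m1 : {sigma_finite_measure set T1 -> \bar R})
    (m2 : {sigma_finite_measure set T2 -> \bar R}) :
  sigma_finite setT (m1 \x m2)%E.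
Proof.
have /sigma_finiteP[F [TF ndF Foo]] := sigma_finiteT m1.
have /sigma_finiteP[G [TG ndG Goo]] := sigma_finiteT m2.
exists (fun k => F k `*` G k).
  rewrite -setXTT TF TG predeqE => -[x y]; split.
    move=> [/= [i _ Fix] [k _ Gky]]; exists (maxn i k) => //; split.
    - by move: x Fix; exact/subsetPset/ndF/leq_maxl.
    - by move: y Gky; exact/subsetPset/ndG/leq_maxr.
  by move=> [k _ []/= ? ?]; split; exists k.
move=> k; have [? ?] := Foo k; have [? ?] := Goo k.
split; first exact: measurableX.
by rewrite product_measure1E// lte_mul_pinfty// ge0_fin_numE.
Qed.

Section step.
Variables (n : nat) (m : {sigma_finite_measure set 'rV[R]_n -> \bar R}).

Definition lebesgue_rVS : set 'rV[R]_n.+1 -> \bar R :=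
  pushforward (@lebesgue_measure R \x m)%E (@cons_rV n).

Let lebesgue_rVS0 : lebesgue_rVS set0 = 0%E.
Proof. by rewrite /lebesgue_rVS /pushforward preimage_set0 measure0. Qed.

Let lebesgue_rVS_ge0 A : (0 <= lebesgue_rVS A)%E.
Proof. exact: (measure_ge0 (@lebesgue_measure R \x m)%E). Qed.

Let lebesgue_rVS_sigma_additive : semi_sigma_additive lebesgue_rVS.
Proof.
move=> F mF tF mUF; rewrite /lebesgue_rVS /pushforward preimage_bigcup.
apply: measure_semi_sigma_additive.
- by move=> k; rewrite -[X in measurable X]setTI; exact: measurable_cons_rV.
- apply/trivIsetP => /= i j _ _ ij; rewrite -preimage_setI.
  by move/trivIsetP : tF => /(_ _ _ _ _ ij) ->//; rewrite preimage_set0.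
- rewrite -preimage_bigcup -[X in measurable X]setTI.
  exact: measurable_cons_rV.
Qed.

HB.instance Definition _ := isMeasure.Build _ _ _ lebesgue_rVS
  lebesgue_rVS0 lebesgue_rVS_ge0 lebesgue_rVS_sigma_additive.

Let sigma_finite_lebesgue_rVS : sigma_finite setT lebesgue_rVS.
Proof.
have [F TF Foo] := sigma_finite_prod (@lebesgue_measure R) m.
exists (fun k => @uncons_rV n @^-1` F k).
  by rewrite -preimage_bigcup -TF preimage_setT.
move=> k; have [mF Fk] := Foo k; split.
  by rewrite -[X in measurable X]setTI; exact: measurable_uncons_rV.
rewrite /lebesgue_rVS /pushforward -comp_preimage.
by rewrite (_ : _ \o _ = id) ?preimage_id//; apply/funext => z /=; rewrite cons_rVK.
Qed.

HB.instance Definition _ := Measure_isSigmaFinite.Build _ _ _ lebesgue_rVS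
  sigma_finite_lebesgue_rVS.

End step.

Fixpoint lebesgue_rV (n : nat) : {sigma_finite_measure set 'rV[R]_n -> \bar R} :=
  match n with
  | 0%N => \d_(0 : 'rV[R]_0)
  | k.+1 => lebesgue_rVS (lebesgue_rV k)
  end.

End lebesgue_rV.

(* The power x^q with a real exponent, extended to x < 0 as the odd function
   |x|^(q-1) x; on x >= 0 it is the usual power. *)
Definition spow {R : realType} (x q : R) : R := Num.sg x * `|x| `^ q.

Section calculus.
Variables (R : realType) (N : nat).
Implicit Types (Omega : set 'rV[R]_N) (f phi : 'rV[R]_N -> R).

Definition partial (i : 'I_N) f : 'rV[R]_N -> R :=
  fun x => 'D_(delta_mx 0 i : 'rV[R]_N) f x.

Definition partials (s : seq 'I_N) f : 'rV[R]_N -> R := foldr partial f s.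

(* C^oo: all iterated partial derivatives exist and are continuous. *)
Definition smooth f : Prop := forall s : seq 'I_N,
  continuous (partials s f) /\
  forall (i : 'I_N) x, derivable (partials s f) x (delta_mx 0 i : 'rV[R]_N).

(* C_c^oo(Omega), each function being extended by 0 to R^N. *)
Definition test_function Omega phi : Prop :=
  smooth phi /\
  exists K, [/\ compact K, K `<=` Omega & forall x, ~ K x -> phi x = 0].

(* Near each boundary point, [Omega] is the sublevel set {rho < 0} of a smooth
   function with nonvanishing gradient at this point. *)
Definition smooth_boundary Omega : Prop :=
  forall x, (closure Omega `\` Omega) x ->
  exists rho, [/\ smooth rho,
    exists i, partial i rho x != 0 &
    \forall y \near x, Omega y <-> rho y < 0].

Definition smooth_bounded_domain Omega : Prop :=
  [/\ open Omega, Omega !=set0, connected Omega, bounded_set Omega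
    & smooth_boundary Omega].

End calculus.

Section sobolev_space.
Variables (R : realType) (N : nat) (Omega : set 'rV[R]_N).
Implicit Types (u f : 'rV[R]_N -> R) (g : 'I_N -> 'rV[R]_N -> R).

Local Notation mu := (lebesgue_rV R N).

Definition normL (q : R) u : \bar R := 'N[mu]_(q%:E)[EFin \o (u \_ Omega)].

Definition inL2 f : Prop :=
  measurable_fun Omega f /\ (\int[mu]_(x in Omega) ((f x) ^+ 2)%:E < +oo)%E.

(* g is the weak gradient of u on Omega and is square-integrable. *)
Definition is_weak_gradient u g : Prop := forall i : 'I_N,
  inL2 (g i) /\
  forall phi, test_function Omega phi ->
    \int[mu]_(x in Omega) (u x * partial i phi x) =
    - (\int[mu]_(x in Omega) (g i x * phi x)).

(* A choice of the weak gradient, which is unique up to null sets. *)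
Definition grad u : 'I_N -> 'rV[R]_N -> R :=
  xget (fun _ _ => 0) [set g | is_weak_gradient u g].

(* The space X = H_0^1(Omega), closure of C_c^oo(Omega) in H^1(Omega). *)
Definition H10 u : Prop :=
  [/\ inL2 u,
      exists g, is_weak_gradient u g
    & forall e : R, 0 < e -> exists2 phi, test_function Omega phi &
        (\int[mu]_(x in Omega) ((u x - phi x) ^+ 2)%:E +
         \sum_(i < N) \int[mu]_(x in Omega)
            ((grad u i x - partial i phi x) ^+ 2)%:E < e%:E)%E].

Definition ae_zero u : Prop := {ae mu, forall x, Omega x -> u x = 0}.

End sobolev_space.

(* p = (N + 2) / (N - 2) *)
Definition critical_exponent (R : realType) (N : nat) : R :=
  (N%:R + 2) / (N%:R - 2).

Section functionals.
Variables (R : realType) (N : nat) (Omega : set 'rV[R]_N).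
Implicit Types (u : 'rV[R]_N -> R) (delta : R).

Local Notation mu := (lebesgue_rV R N).
Local Notation p := (critical_exponent R N).
Local Notation X := (H10 Omega).

Definition funA u : \bar R :=
  \int[mu]_(x in Omega) (\sum_(i < N) (grad Omega u i x) ^+ 2)%:E.

Definition funB u : \bar R := \int[mu]_(x in Omega) (`|u x| `^ (p + 1))%:E.

Definition funE u : \bar R := ((2^-1)%:E * funA u - ((p + 1)^-1)%:E * funB u)%E.

Definition funD u : \bar R := (funA u - funB u)%E.

Definition funDd delta u : \bar R := (delta%:E * funA u - funB u)%E.

Definition nehari : set ('rV[R]_N -> R) :=
  [set u | [/\ X u, funD u = 0%E & ~ ae_zero Omega u]].

Definition depth : \bar R := ereal_inf [set funE u | u in nehari].

(* [funA u] is the square of the norm of u in X. *)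
Definition neharid delta : set ('rV[R]_N -> R) :=
  [set u | [/\ X u, funDd delta u = 0%E & funA u != 0%E]].

Definition depthd delta : \bar R := ereal_inf [set funE u | u in neharid delta].

Definition sobolev : R :=
  inf [set fine (funA u) / fine (normL Omega (p + 1) u) ^+ 2
      | u in [set u | X u /\ ~ ae_zero Omega u]].

End functionals.

Section weak_solution.
Variables (R : realType) (N : nat) (Omega : set 'rV[R]_N) (T : \bar R).
Implicit Types (u : R -> 'rV[R]_N -> R) (eta : R -> R).

Local Notation mu := (lebesgue_rV R N).
Local Notation leb := (@lebesgue_measure R).
Local Notation p := (critical_exponent R N).
Local Notation X := (H10 Omega).

Let I : set R := [set t | 0 < t /\ (t%:E < T)%E].
Let I0 : set R := [set t | 0 <= t /\ (t%:E < T)%E].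

(* C_c^oo(0, T), each function being extended by 0 to R. *)
Definition time_test_function eta : Prop :=
  (forall n t, derivable (derive1n n eta) t 1) /\
  exists a b, [/\ 0 < a, (b%:E < T)%E
                & forall t, ~ (a <= t <= b) -> eta t = 0].

(* u belongs to L^oo(0, T; X).  Functions of time with values in a space of
   functions on [Omega] are represented by jointly measurable functions of time
   and space; since X is separable, this yields strong measurability. *)
Definition LooX u : Prop :=
  measurable_fun ((I : set (measurableTypeR R)) `*` Omega) (fun z => u z.1 z.2) /\
  exists M : R, {ae leb, forall t, I t -> X (u t) /\ (funA Omega (u t) <= M%:E)%E}.

(* The time derivative of v, in the sense of L^2(Omega)-valued distributions on
   (0, T), is g, and it belongs to L^2(0, T; L^2(Omega)). *)
Definition time_derivative_L2 (v g : R -> 'rV[R]_N -> R) : Prop :=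
  [/\ measurable_fun ((I : set (measurableTypeR R)) `*` Omega) (fun z => g z.1 z.2),
      (\int[leb]_(t in I) \int[mu]_(x in Omega) ((g t x) ^+ 2)%:E < +oo)%E
    & forall eta w, time_test_function eta -> inL2 Omega w ->
      \int[leb]_(t in I) (derive1 eta t * \int[mu]_(x in Omega) (v t x * w x)) =
      - (\int[leb]_(t in I) (eta t * \int[mu]_(x in Omega) (g t x * w x)))].

(* ((u^p)_t, w) + (grad u, grad w) = (|u|^p, w) for all w in X, in the sense of
   distributions on (0, T). *)
Definition weak_equation u : Prop :=
  forall w eta, X w -> time_test_function eta ->
    - (\int[leb]_(t in I)
         (derive1 eta t * \int[mu]_(x in Omega) (spow (u t x) p * w x)))
    + \int[leb]_(t in I)
        (eta t * \int[mu]_(x in Omega)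
           (\sum_(i < N) grad Omega (u t) i x * grad Omega w i x)) =
    \int[leb]_(t in I)
        (eta t * \int[mu]_(x in Omega) (`|u t x| `^ p * w x)).

(* A function with a time derivative in L^2(0, T; L^2(Omega)) has exactly one
   representative that is continuous from [0, T) to L^2(Omega); the value of u
   at each individual time, including u(0), refers to this representative of
   u^((p+1)/2). *)
Definition weak_solution (u0 : 'rV[R]_N -> R) u : Prop :=
  let v t x := spow (u t x) ((p + 1) / 2) in
  [/\ LooX u,
      exists g, time_derivative_L2 v g,
      weak_equation u,
      (forall t, I0 t -> measurable_fun Omega (u t)) /\
      (forall t0, I0 t0 ->
        (\int[mu]_(x in Omega) ((v t x - v t0 x) ^+ 2)%:E)%E
          @[t --> within I0 (nbhs t0)] --> 0%E)
    & {ae mu, forall x, Omega x -> u 0 x = u0 x}].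

End weak_solution.

(* Main.v *)
Require Import Defs.
From HB Require Import structures.
From mathcomp Require Import all_boot all_order all_algebra.
From mathcomp Require Import all_classical all_reals all_analysis.
From mathcomp Require Import measurable_realfun ring lra.
Import Order.TTheory GRing.Theory Num.Theory.
Import numFieldNormedType.Exports.
Local Open Scope classical_set_scope.
Local Open Scope ring_scope.
Set Implicit Arguments.
Unset Strict Implicit.
Unset Printing Implicit Defensive.

(** Write A(w) for the Dirichlet integral of w, B(w) for the integral of
    |w|^(p+1), m = 2/(p+1) = gamma and th = 2/(p-1), so that (1+th)(1-m) = 1.

    The stationary part is an analysis of the potential well.  Scaling moves any
    w in X with A(w), B(w) > 0 onto the Nehari set N_delta, and there
        E = well_height p delta * (A(w) / B(w)^m)^(1+th),
        well_height p delta = (1/2 - delta/(p+1)) delta^th.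
    With delta = 1 the hypothesis E(u0) < d, together with E(u0) > 0 (which follows
    from D(u0) > 0), therefore gives kappa B(w)^m <= A(w) with some kappa > 0: the
    Sobolev inequality, whose best constant is S.  It is obtained first where B is
    known to be finite; density of test functions and Fatou's lemma then show that B
    is finite on all of X (H10_funB_fin, sobolev_ineq).  Taking infima,
    d(delta) = S^(1+th) well_height p delta as long as this height is nonnegative.
    The height increases up to delta = 1 and decreases afterwards, and it is also the
    value at x = (S delta)^(1+th) of the function x |-> S x^m/2 - x/(p+1) that bounds
    E from below when B = x.  This yields delta1 < 1 and B(u0)^(1-m) <= S delta1
    (initial_well).

    The evolution part works with B(t) = B(u(t)).  The weak equation is tested with
    the fixed function w = u(t), for one good time t, and with a smooth trapezoid in
    time that approximates the indicator of [s, t].  Near s, Young's inequality bounds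
    the pairing of u(tau)^p with u(t) by p/(p+1) B(s) + B(t)/(p+1); near t the pairing
    is close to B(t).  So
        p/(p+1) (B(t) - B(s)) <= int_s^t (B(t) - A(u(t)) + o(1)),
    because tau |-> (grad u(tau), grad u(t)) is continuous at t along good times
    (dirichlet_near).  Together with the Sobolev inequality this is a bound, at almost
    every t, of the left Dini derivative of B by (p+1)/p (B - S B^m); the same argument
    with crude bounds makes B one-sided Lipschitz (mass_dini, mass_lipschitz).

    A one-sided Lipschitz function whose left Dini derivative is at most c almost
    everywhere grows at most at rate c: the exceptional null set is absorbed by a
    staircase of small total height (dini_comparison).  As B(0)^(1-m) <= S delta1 < S,
    a continuity argument keeps B below B(0), hence B(t)^(1-m) <= S delta1 for all t
    and B has Dini derivative at most -C B^m.  By concavity of x |-> x^(1-m), the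
    function B^(1-m) decreases at least at rate C (1-m) as long as B is positive,
    which is the stated bound. *)

(** * Smooth functions of one real variable and smooth steps *)

Section smooth_line.
Context {R : realType}.
Implicit Types (f g : R -> R) (P : {poly R}) (x t : R) (n : nat).

Definition smooth1 f : Prop := forall n t, derivable (derive1n n f) t 1.

Lemma smooth1_derivable f x : smooth1 f -> derivable f x 1.
Proof. by move=> /(_ 0%N x). Qed.

Lemma smooth1_derive1 f : smooth1 f -> smooth1 (derive1 f).
Proof. by move=> sf n t; rewrite /derive1n -iterSr; exact: (sf n.+1 t). Qed.

(** Coinduction: a class of differentiable functions that is stable under
    differentiation consists of smooth functions. *)
Lemma smooth1_coind (C : set (R -> R)) :
  (forall f, C f -> (forall x, derivable f x 1) /\ C (derive1 f)) ->
  forall f, C f -> smooth1 f.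
Proof.
move=> CP f Cf n t; suff /CP[] : C (derive1n n f) by [].
by elim: n => //= n /CP[].
Qed.

(** The algebra generated by the smooth functions is stable under differentiation,
    since the derivative of each constructor is again such an expression; all closure
    properties of smoothness follow at once by coinduction. *)
Inductive smooth_alg : (R -> R) -> Prop :=
| smooth_alg_base f : smooth1 f -> smooth_alg f
| smooth_alg_add f g : smooth_alg f -> smooth_alg g -> smooth_alg (f \+ g)
| smooth_alg_mul f g : smooth_alg f -> smooth_alg g -> smooth_alg (f \* g)
| smooth_alg_aff f (a b : R) : smooth_alg f ->
    smooth_alg (fun x => f (a * x + b))
| smooth_alg_inv f : (forall x, f x != 0) -> smooth_alg f ->
    smooth_alg (fun x => (f x)^-1).

Lemma smooth1_cst (a : R) : smooth1 (cst a).
Proof.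
apply: (@smooth1_coind [set f | exists c, f = cst c]) => [f [c ->]|].
  split=> [x|]; first exact: derivable_cst.
  by exists 0; apply/funext => x; rewrite derive1_cst.
by exists a.
Qed.

Lemma derive1P f (df : R -> R) : (forall x, is_derive x 1 f (df x)) ->
  (forall x, derivable f x 1) /\ derive1 f = df.
Proof.
move=> fdf; split=> [x|]; first by have [] := fdf x.
by apply/funext => x; rewrite derive1E; have [_ ->] := fdf x.
Qed.

Lemma derivable_is_derive1 f x : derivable f x 1 -> is_derive x 1 f (derive1 f x).
Proof. by move=> fx; rewrite derive1E; exact/derivableP. Qed.

Lemma is_derive_affine (a b x : R) : is_derive x 1 (fun x => a * x + b) a.
Proof.
rewrite (_ : (fun x => _) = (a \*: id) \+ cst b) //.
have := is_deriveD (is_deriveZ a (is_derive_id x 1)) (is_derive_cst b x 1).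
by rewrite addr0 /GRing.scale/= mulr1.
Qed.

Lemma smooth_algP f : smooth_alg f ->
  exists df, (forall x, is_derive x 1 f (df x)) /\ smooth_alg df.
Proof.
elim=> {f} [f sf|f g _ [df [fdf sdf]] _ [dg [gdg sdg]]
  |f g sf [df [fdf sdf]] sg [dg [gdg sdg]]|f a b _ [df [fdf sdf]]
  |f f0 sf [df [fdf sdf]]].
- exists (derive1 f); split=> [x|]; last exact/smooth_alg_base/smooth1_derive1.
  exact/derivable_is_derive1/smooth1_derivable.
- exists (df \+ dg); split; last exact: smooth_alg_add.
  by move=> x; exact: is_deriveD.
- exists ((f \* dg) \+ (g \* df)); split; last first.
    by apply: smooth_alg_add; apply: smooth_alg_mul.
  by move=> x; exact: is_deriveM.
- exists (fun x => df (a * x + b) * a); split=> [x|].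
    exact: (is_derive1_comp (fdf _) (is_derive_affine a b x)).
  apply: (@smooth_alg_mul (fun x => df (a * x + b)) (cst a)).
    exact: smooth_alg_aff.
  exact/smooth_alg_base/smooth1_cst.
- exists (fun x => (- (f x)^-1 * (f x)^-1) * df x); split=> [x|].
    apply: is_derive_eq (is_deriveV (f0 x) (fdf x)) _.
    by rewrite /GRing.scale/= expr2 invfM !mulNr.
  apply: (@smooth_alg_mul (fun x => - (f x)^-1 * (f x)^-1)) => //.
  apply: (@smooth_alg_mul (fun x => - (f x)^-1)); last exact: smooth_alg_inv.
  rewrite (_ : (fun x => _) = (cst (-1) \* (fun x => (f x)^-1))); last first.
    by apply/funext => x /=; rewrite mulN1r.
  by apply: smooth_alg_mul; [exact/smooth_alg_base/smooth1_cst
                            |exact: smooth_alg_inv].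
Qed.

Lemma smooth_alg_smooth1 f : smooth_alg f -> smooth1 f.
Proof.
move: f; apply: smooth1_coind => f /smooth_algP[df [fdf sdf]].
by have [? ->] := derive1P fdf.
Qed.

Lemma smooth1D f g : smooth1 f -> smooth1 g -> smooth1 (f \+ g).
Proof.
by move=> sf sg; apply/smooth_alg_smooth1/smooth_alg_add; exact: smooth_alg_base.
Qed.

Lemma smooth1M f g : smooth1 f -> smooth1 g -> smooth1 (f \* g).
Proof.
by move=> sf sg; apply/smooth_alg_smooth1/smooth_alg_mul; exact: smooth_alg_base.
Qed.

Lemma smooth1_affine f (a b : R) : smooth1 f -> smooth1 (fun x => f (a * x + b)).
Proof.
by move=> sf; apply/smooth_alg_smooth1/smooth_alg_aff; exact: smooth_alg_base.
Qed.

Lemma smooth1_inv f : (forall x, f x != 0) -> smooth1 f ->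
  smooth1 (fun x => (f x)^-1).
Proof.
by move=> f0 sf; apply/smooth_alg_smooth1/smooth_alg_inv => //; exact: smooth_alg_base.
Qed.

Lemma smooth1_continuous f : smooth1 f -> continuous f.
Proof.
move=> sf x; apply/differentiable_continuous/derivable1_diffP.
exact: smooth1_derivable.
Qed.

(** These functions form a class that is stable under differentiation, which is why
    a polynomial factor is included. *)
Definition flat_exp P x := if 0 < x then P.[x^-1] * expR (- x^-1) else 0.

(** Each monomial y^i is at most i! exp y, by the exponential series. *)
Lemma poly_expRN_bound P : exists C : R, forall y : R, 0 < y -> `|P.[y] * expR (- y)| <= C.
Proof.
elim/poly_ind: P => [|P c _].
  by exists 0 => y y0; rewrite horner0 mul0r normr0.
move: (P * 'X + c%:P) => {P c} Q.
exists (\sum_(i < size Q) `|Q`_i| * i`!%:R) => y y0.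
rewrite normrM (ger0_norm (expR_ge0 _)) horner_coef expRN.
rewrite ler_pdivrMr ?expR_gt0// mulr_suml.
apply: le_trans (ler_norm_sum _ _ _) _; apply: ler_sum => i _.
rewrite normrM normrX (gtr0_norm y0) -mulrA ler_wpM2l//.
case: (nat_of_ord i) => [|n].
  by rewrite expr0 fact0 mul1r -expR0 ler_expR ltW.
rewrite mulrC -ler_pdivrMr ?ltr0n ?fact_gt0//.
by apply: le_trans (expR_ge1Dxn n (ltW y0)); rewrite lerDr.
Qed.

(** Away from 0 this is the chain rule with d(1/x) = - dx/x^2.  At 0 the difference
    quotient is again a flat exponential, with P multiplied by 'X, and it tends to 0
    because y P(y) exp (- y) is O(1/y) at infinity. *)
Lemma is_derive_flat_exp P x :
  is_derive x 1 (flat_exp P) (flat_exp ('X ^+ 2 * (P - P^`())) x).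
Proof.
have [x0|x0|x0] := ltgtP x 0.
- apply: (near_eq_is_derive (f := cst 0)).
    near=> y; rewrite /flat_exp ifF//; apply/negbTE; rewrite -leNgt ltW//.
    by near: y; exact: lt_nbhsl.
  by rewrite /flat_exp (lt_gtF x0); exact: is_derive_cst.
- apply: (near_eq_is_derive (f := (horner P \o GRing.inv) \* (expR \o (-%R \o GRing.inv)))).
    near=> y; rewrite /flat_exp ifT//.
    by near: y; exact: lt_nbhsr.
  have dV : is_derive x 1 GRing.inv (- x ^- 2).
    have := is_deriveV (lt0r_neq0 x0) (is_derive_id x 1).
    by rewrite /GRing.scale/= mulr1.
  have dN : is_derive x 1 (-%R \o GRing.inv) (- - x ^- 2) by exact: is_deriveN.
  have H := is_deriveM (is_derive1_comp (is_derive_poly P _) dV)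
    (is_derive1_comp (is_derive_expR _) dN).
  rewrite /flat_exp x0; apply: is_derive_eq H _.
  rewrite /= !hornerE /GRing.scale/= exprVn.
  by ring.
- rewrite x0 {2}/flat_exp ltxx; apply/is_derive1_caratheodory.
  exists (flat_exp ('X * P)); split; last by rewrite /flat_exp ltxx.
    move=> z; rewrite {2}/flat_exp ltxx !subr0 /flat_exp.
    case: ifPn => [z0|]; last by rewrite mul0r.
    by rewrite hornerM hornerX; field; exact: lt0r_neq0.
  have [C CP] := poly_expRN_bound ('X * ('X * P)).
  have F0 : flat_exp ('X * P) 0 = 0 by rewrite /flat_exp ltxx.
  suff : flat_exp ('X * P) z @[z --> (0 : R)] --> (0 : R).
    by rewrite -[X in _ --> X -> _]F0.
  apply/(@cvgr0Pnorm_lt _ R^o _ (nbhs (0 : R))) => e e0.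
  have C0 : 0 <= C by apply: le_trans (CP 1 ltr01).
  have eC : 0 < e / (C + 1) by rewrite divr_gt0// ltr_wpDl.
  apply: filterS (nbhs0_lt eC) => z ze.
  rewrite /flat_exp; case: ifPn => [z0|]; last by rewrite normr0.
  have := CP z^-1; rewrite invr_gt0 => /(_ z0); rewrite hornerM hornerX -mulrA normrM.
  rewrite gtr0_norm ?invr_gt0// mulrC ler_pdivrMr// => /le_lt_trans; apply.
  apply: (@le_lt_trans _ _ ((C + 1) * z)).
    by rewrite ler_wpM2r ?lerDl// ltW.
  by rewrite mulrC -ltr_pdivlMr ?ltr_wpDl//; apply: le_lt_trans (ler_norm _) ze.
Unshelve. all: by end_near. Qed.

Lemma smooth1_flat_exp P : smooth1 (flat_exp P).
Proof.
apply: (@smooth1_coind [set f | exists P, f = flat_exp P]) => [f [{}P ->]|].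
  have [? ->] := derive1P (is_derive_flat_exp P).
  by split => //; eexists.
by exists P.
Qed.

Definition smooth_step x : R :=
  flat_exp 1 x / (flat_exp 1 x + flat_exp 1 (1 - x)).

Lemma flat_exp1_ge0 x : 0 <= flat_exp 1 x.
Proof. by rewrite /flat_exp; case: ifP => // _; rewrite hornerC mul1r expR_ge0. Qed.

Lemma flat_exp1_gt0 x : 0 < x -> 0 < flat_exp 1 x.
Proof. by move=> x0; rewrite /flat_exp x0 hornerC mul1r expR_gt0. Qed.

Lemma flat_exp1_le0 x : x <= 0 -> flat_exp 1 x = 0.
Proof. by move=> x0; rewrite /flat_exp ltNge x0. Qed.

Lemma flat_exp1_denom_gt0 x : 0 < flat_exp 1 x + flat_exp 1 (1 - x).
Proof.
have [x0|x0] := ltP 0 x; first by rewrite ltr_wpDr ?flat_exp1_ge0 ?flat_exp1_gt0.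
by rewrite ltr_wpDl ?flat_exp1_ge0// flat_exp1_gt0// subr_gt0 (le_lt_trans x0).
Qed.

Lemma smooth_step_le0 x : x <= 0 -> smooth_step x = 0.
Proof. by move=> x0; rewrite /smooth_step flat_exp1_le0// mul0r. Qed.

Lemma smooth_step_ge1 x : 1 <= x -> smooth_step x = 1.
Proof.
move=> x1; rewrite /smooth_step (@flat_exp1_le0 (1 - x)) ?subr_le0// addr0 divff//.
by rewrite gt_eqF// flat_exp1_gt0// (lt_le_trans ltr01).
Qed.

Lemma smooth1_step : smooth1 smooth_step.
Proof.
have sr : smooth1 (fun x => flat_exp 1 (1 - x)).
  rewrite (_ : (fun x => _) = fun x => flat_exp 1 (-1 * x + 1)).
    exact/smooth1_affine/smooth1_flat_exp.
  by apply/funext => x; rewrite mulN1r addrC.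
apply: smooth1M; first exact: smooth1_flat_exp.
apply: (@smooth1_inv (flat_exp 1 \+ (fun x => flat_exp 1 (1 - x)))).
  by move=> x; rewrite gt_eqF// flat_exp1_denom_gt0.
by apply: smooth1D => //; exact: smooth1_flat_exp.
Qed.

Lemma smooth_step_homo : {homo smooth_step : x y / x <= y}.
Proof.
have fle x y : x <= y -> flat_exp 1 x <= flat_exp 1 y.
  move=> xy; have [x0|x0] := leP x 0.
    by rewrite flat_exp1_le0// flat_exp1_ge0.
  rewrite /flat_exp x0 (lt_le_trans x0 xy) !hornerC !mul1r ler_expR lerN2.
  by rewrite lef_pV2 ?posrE// (lt_le_trans x0 xy).
move=> x y xy; rewrite /smooth_step.
rewrite ler_pdivrMr ?flat_exp1_denom_gt0// mulrAC ler_pdivlMr ?flat_exp1_denom_gt0//.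
rewrite !mulrDr mulrC lerD2l ler_pM ?flat_exp1_ge0 ?fle//.
by rewrite lerB.
Qed.

Lemma smooth_step_ge0 x : 0 <= smooth_step x.
Proof. by rewrite divr_ge0 ?flat_exp1_ge0// ltW// flat_exp1_denom_gt0. Qed.

Lemma smooth_step_le1 x : smooth_step x <= 1.
Proof. by rewrite ler_pdivrMr ?flat_exp1_denom_gt0// mul1r lerDl flat_exp1_ge0. Qed.

Lemma nondecreasing_derive1_ge0 f x : {homo f : x y / x <= y} -> derivable f x 1 ->
  0 <= derive1 f x.
Proof.
move=> fle fx; apply: limr_ge.
  under eq_fun; first (move=> h; rewrite -{2}(scaler1 h); over).
  exact: fx.
near=> h.
have h0 : h != 0%R by near: h; exact: nbhs_dnbhs_neq.
move: h0; rewrite neq_lt => /orP[h0|h0].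
- by rewrite nmulr_rge0 ?invr_lt0// subr_le0 fle// gerDr ltW.
- by rewrite pmulr_rge0 ?invr_gt0// subr_ge0 fle// lerDr ltW.
Unshelve. all: by end_near. Qed.

End smooth_line.

(** * Boxes, measurability and slicing in R^n *)

Section rV_topology_measure.
Context {R : realType}.

Lemma rV_norm_lt n (x : 'rV[R]_n) (r : R) : 0 < r ->
  (`|x| < r) <-> (forall i, `|x 0 i| < r).
Proof.
move=> r0; rewrite (_ : `|x| = mx_norm x)// mx_normrE; split=> [/bigmax_ltP[_ H] i|H].
  exact: (H (0, i)).
by apply/bigmax_ltP; split => // -[j i] _; rewrite (ord1 j).
Qed.

Lemma rV_norm_le n (x : 'rV[R]_n) (r : R) : 0 <= r ->
  (`|x| <= r) <-> (forall i, `|x 0 i| <= r).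
Proof.
move=> r0; rewrite (_ : `|x| = mx_norm x)// mx_normrE; split=> [/bigmax_leP[_ H] i|H].
  exact: (H (0, i)).
by apply/bigmax_leP; split => // -[j i] _; rewrite (ord1 j).
Qed.

Lemma rV_coord_norm n (x : 'rV[R]_n) i : `|x 0 i| <= `|x|.
Proof. by apply: (proj1 (@rV_norm_le _ _ _ (normr_ge0 x))). Qed.

Definition rV_box n (a b : 'I_n -> R) : set 'rV[R]_n :=
  [set x | forall i, a i < x 0 i < b i].

Definition rV_cbox n (a b : 'I_n -> R) : set 'rV[R]_n :=
  [set x | forall i, a i <= x 0 i <= b i].

Lemma measurable_coord_preimage n (i : 'I_n) (Y : set R) :
  measurable (Y : set (measurableTypeR R)) ->
  measurable [set x : 'rV[R]_n | Y (x 0 i)].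
Proof.
move=> mY; have := @measurable_rV_coord R n i measurableT _ mY.
by rewrite setTI.
Qed.

Lemma measurable_rV_box n (a b : 'I_n -> R) : measurable (rV_box a b).
Proof.
rewrite (_ : rV_box a b =
  \bigcap_(i in setT) [set x : 'rV[R]_n | `]a i, b i[%classic (x 0 i)]).
  apply: fin_bigcap_measurable => // i _; apply: measurable_coord_preimage.
  exact: measurable_itv.
apply/seteqP; split=> x H i.
  by move=> _ /=; rewrite in_itv/=; exact: H.
by have := H i Logic.I; rewrite /= in_itv.
Qed.

Lemma measurable_rV_cbox n (a b : 'I_n -> R) : measurable (rV_cbox a b).
Proof.
rewrite (_ : rV_cbox a b =
  \bigcap_(i in setT) [set x : 'rV[R]_n | `[a i, b i]%classic (x 0 i)]).
  apply: fin_bigcap_measurable => // i _; apply: measurable_coord_preimage.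
  exact: measurable_itv.
apply/seteqP; split=> x H i.
  by move=> _ /=; rewrite in_itv/=; exact: H.
by have := H i Logic.I; rewrite /= in_itv.
Qed.

Lemma compact_rV_cbox n (a b : 'I_n -> R) : compact (rV_cbox a b).
Proof.
have := @rV_compact R n (fun i => `[a i, b i]%classic).
rewrite (_ : [set _ | _] = rV_cbox a b); first by apply => i; exact: segment_compact.
by apply/seteqP; split => x H i; have := H i; rewrite /= in_itv.
Qed.

Lemma rV_box_sub_cbox n (a b : 'I_n -> R) : rV_box a b `<=` rV_cbox a b.
Proof. by move=> x + i => /(_ i)/andP[/ltW -> /ltW ->]. Qed.

(** Boxes with rational endpoints; requiring the closed box to lie in U leaves room
    for bump functions supported in U. *)
Lemma open_rV_cover n (U : set 'rV[R]_n) : open U ->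
  exists (D : set nat) (a b : nat -> 'I_n -> R),
    (forall k, D k -> rV_cbox (a k) (b k) `<=` U) /\
    U = \bigcup_(k in D) rV_box (a k) (b k).
Proof.
move=> oU.
pose A (q : 'rV[rat]_n * 'rV[rat]_n) i : R := ratr (q.1 0 i).
pose B (q : 'rV[rat]_n * 'rV[rat]_n) i : R := ratr (q.2 0 i).
pose dq : 'rV[rat]_n * 'rV[rat]_n := (0, 0).
pose q k := odflt dq (unpickle k).
exists [set k | rV_cbox (A (q k)) (B (q k)) `<=` U].
exists (A \o q), (B \o q); split => //.
apply/seteqP; split => [x Ux|x [k /= kU xk]]; last exact/kU/rV_box_sub_cbox.
move: oU; rewrite openE => /(_ _ Ux); rewrite /interior => /nbhs_ballP[e /= e0 eU].
have /choice[q1 q1P] : forall i, exists r : rat, x 0 i - e / 2 < ratr r < x 0 i.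
  move=> i; have : x 0 i - e / 2 < x 0 i by rewrite ltrBlDr ltrDl divr_gt0.
  by move=> /rat_in_itvoo[r]; rewrite inE/= => rP; exists r.
have /choice[q2 q2P] : forall i, exists r : rat, x 0 i < ratr r < x 0 i + e / 2.
  move=> i; have : x 0 i < x 0 i + e / 2 by rewrite ltrDl divr_gt0.
  by move=> /rat_in_itvoo[r]; rewrite inE/= => rP; exists r.
pose qq : 'rV[rat]_n * 'rV[rat]_n := (\row_i q1 i, \row_i q2 i).
have qE : q (pickle qq) = qq by rewrite /q pickleK.
exists (pickle qq) => /=; rewrite qE.
  move=> y yq; apply: eU; rewrite -ball_normE /=; apply/rV_norm_lt => // i.
  have := yq i; rewrite /A /B !mxE => /andP[].
  have /andP[] := q1P i; have /andP[] := q2P i.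
  rewrite ltr_norml => *; apply/andP; split; lra.
move=> i; rewrite /A /B !mxE.
by have /andP[_ ->] := q1P i; have /andP[-> _] := q2P i.
Qed.

Lemma open_rV_measurable n (U : set 'rV[R]_n) : open U -> measurable U.
Proof.
move=> /open_rV_cover[D [a [b [_ ->]]]].
by apply: bigcup_measurable => k _; exact: measurable_rV_box.
Qed.

Lemma continuous_rV_measurable n (f : 'rV[R]_n -> R) :
  continuous f -> measurable_fun setT f.
Proof.
move=> /continuousP cf; apply: (measurability _ (RGenOpens.measurableE R)).
move=> _ [_ [a [b ->] <-]].
by rewrite setTI; apply: open_rV_measurable; apply: cf; exact: interval_open.
Qed.

Local Notation mu := (lebesgue_rV R).

(** The map (a, y) |-> row_mx a y of the definition of Lebesgue measure, with the
    dimensions in the form n.+1 and with entries accessed through [lift]. *)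
Definition consR n (a : R) (y : 'rV[R]_n) : 'rV[R]_n.+1 :=
  \row_i oapp (fun j => y 0 j) a (unlift ord0 i).

Lemma consR0 n a (y : 'rV[R]_n) : consR a y 0 ord0 = a.
Proof. by rewrite mxE unlift_none. Qed.

Lemma consRS n a (y : 'rV[R]_n) j : consR a y 0 (lift ord0 j) = y 0 j.
Proof. by rewrite mxE liftK. Qed.

Lemma consRE n (z : measurableTypeR R * 'rV[R]_n) :
  row_mx (z.1)%:M z.2 = consR z.1 z.2.
Proof.
apply/rowP => i; case: (unliftP ord0 i) => [j|] ->.
  rewrite consRS (_ : lift ord0 j = rshift 1 j) ?row_mxEr//; exact/val_inj.
rewrite consR0 (_ : ord0 = lshift n (0 : 'I_1)); last exact/val_inj.
apply: etrans (row_mxEl _ _ _ _) _.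
by rewrite mxE eqxx mulr1n.
Qed.

Lemma measurable_consR n :
  measurable_fun setT (fun z : measurableTypeR R * 'rV[R]_n => consR z.1 z.2).
Proof.
apply: measurable_fun_rVP => i; case: (unliftP ord0 i) => [j|] ->.
  rewrite (_ : _ \o _ = @rV_coord R n j \o snd).
    by apply: measurableT_comp; [exact: measurable_rV_coord|exact: measurable_snd].
  by apply/funext => z /=; rewrite /rV_coord consRS.
rewrite (_ : _ \o _ = fst); first exact: measurable_fst.
by apply/funext => z /=; rewrite /rV_coord consR0.
Qed.

Lemma lebesgue_rVSE n (A : set 'rV[R]_n.+1) : mu n.+1 A =
  pushforward (@lebesgue_measure R \x mu n)%E (fun z => consR z.1 z.2) A.
Proof.
rewrite /= /lebesgue_rVS /pushforward; congr (_ _).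
by apply/seteqP; split => z /=; rewrite -consRE.
Qed.

Lemma integral_lebesgue_rVS n (f : 'rV[R]_n.+1 -> \bar R) :
  (mu n.+1).-integrable setT f ->
  (@lebesgue_measure R \x mu n)%E.-integrable setT (fun z => f (consR z.1 z.2)) /\
  (\int[mu n.+1]_x f x =
   \int[(@lebesgue_measure R \x mu n)%E]_z f (consR z.1 z.2))%E.
Proof.
move=> /[dup] fi /integrableP[mf foo].
have mfc := measurable_consR (n := n).
have ii : (@lebesgue_measure R \x mu n)%E.-integrable setT (fun z => f (consR z.1 z.2)).
  apply/integrableP; split.
    exact: (measurableT_comp mf mfc).
  move: foo; rewrite (eq_measure_integral
    (pushforward (@lebesgue_measure R \x mu n)%E (fun z => consR z.1 z.2))); last first.
    by move=> A _ _; exact: lebesgue_rVSE.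
  rewrite ge0_integral_pushforward//.
  by apply: measurableT_comp => //; exact: mf.
split => //.
rewrite (eq_measure_integral
    (pushforward (@lebesgue_measure R \x mu n)%E (fun z => consR z.1 z.2))); last first.
    by move=> A _ _; exact: lebesgue_rVSE.
by rewrite integral_pushforward.
Qed.

Lemma lebesgue_rV_cbox_fin n (a b : 'I_n -> R) : (mu n (rV_cbox a b) < +oo)%E.
Proof.
elim: n a b => [|n IHn] a b.
  by rewrite /= diracE; case: (_ \in _) => /=; rewrite ltry.
rewrite lebesgue_rVSE /pushforward.
rewrite (_ : _ @^-1` _ = `[a ord0, b ord0]%classic `*`
    rV_cbox (a \o lift ord0) (b \o lift ord0)); last first.
  apply/seteqP; split=> [[s y] /= H|[s y] /= [+ H] i].
    split; first by have := H ord0; rewrite consR0 in_itv.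
    by move=> i; have := H (lift ord0 i); rewrite consRS.
  rewrite in_itv/= => H0; case: (unliftP ord0 i) => [j|] ->.
    by rewrite consRS; exact: H.
  by rewrite consR0.
rewrite product_measure1E//; last exact: measurable_rV_cbox.
by rewrite lte_mul_pinfty// ?IHn//= lebesgue_measure_itv/=; case: ifP.
Qed.

Lemma bounded_rV_sub_cbox n (A : set 'rV[R]_n) : bounded_set A ->
  exists r, A `<=` rV_cbox (fun=> - r) (fun=> r).
Proof.
move=> [M [_ HM]]; exists (M + 1) => x Ax i.
have := HM (M + 1); rewrite ltrDl ltr01 => /(_ isT _ Ax) /= xM.
by rewrite -ler_norml (le_trans (rV_coord_norm _ _)).
Qed.
End rV_topology_measure.

(** * Integrals of partial derivatives *)

Section integration_by_parts_rV.
Context {R : realType}.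
Local Notation mu := (lebesgue_rV R).
Local Notation leb := (@lebesgue_measure R).

Definition bounded_supp n (F : 'rV[R]_n -> R) :=
  exists r : R, forall x, r < `|x| -> F x = 0.

Lemma bounded_suppW n (F : 'rV[R]_n -> R) : bounded_supp F ->
  exists2 r : R, 0 < r & forall x, r < `|x| -> F x = 0.
Proof.
move=> [r rP]; exists (Num.max r 1); first by rewrite lt_max ltr01 orbT.
by move=> x; rewrite gt_max => /andP[/rP].
Qed.

Lemma bounded_supp_bounded n (F : 'rV[R]_n -> R) : continuous F ->
  bounded_supp F -> exists2 M : R, 0 < M & forall x, `|F x| <= M.
Proof.
move=> cF /bounded_suppW[r r0 rP].
have /compact_bounded[M [_ MP]] :
    compact (F @` rV_cbox (fun _ : 'I_n => - r) (fun=> r)).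
  apply: continuous_compact; last exact: compact_rV_cbox.
  exact: continuous_subspaceT.
exists (Num.max (M + 1) 1) => [|x]; first by rewrite lt_max ltr01 orbT.
have [xr|/rP ->] := leP `|x| r; last by rewrite normr0 le_max ler01 orbT.
rewrite le_max; apply/orP; left; apply: MP; first by rewrite ltrDl.
exists x => // i; rewrite -ler_norml; exact: le_trans (rV_coord_norm _ _) xr.
Qed.

Lemma bounded_supp_integrable n (F : 'rV[R]_n -> R) D : measurable D ->
  continuous F -> bounded_supp F -> (mu n).-integrable D (EFin \o F).
Proof.
move=> mD cF sF; have [M M0 MP] := bounded_supp_bounded cF sF.
have [r r0 rP] := bounded_suppW sF.
apply: (integrableS measurableT) => //.
pose K := rV_cbox (fun _ : 'I_n => - r) (fun=> r).
have mK : measurable K by exact: measurable_rV_cbox.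
have : (mu n).-integrable K (EFin \o F).
  apply: measurable_bounded_integrable => //.
  - exact: lebesgue_rV_cbox_fin.
  - by apply: measurable_funTS; exact: continuous_rV_measurable.
  - exists M; split; first exact: num_real.
    by move=> y My x _; exact: le_trans (MP x) (ltW My).
move=> /(integrable_mkcond _ mK); apply: eq_integrable => //.
move=> x _; rewrite patchE; case: ifPn => //; rewrite notin_setE => xK /=.
rewrite rP//; rewrite ltNge; apply: contra_notN xK => xr i.
by rewrite -ler_norml; exact: le_trans (rV_coord_norm _ _) xr.
Qed.

Lemma integral_derive1_bounded_supp (f : R -> R) (r : R) :
  (forall x, derivable f x 1) -> continuous (derive1 f) ->
  (forall x, r < `|x| -> f x = 0) ->
  (\int[leb]_x (derive1 f x)%:E = 0)%E.
Proof.
move=> df cf' fr; pose s := Num.max r 0 + 1.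
have rs : r < s by rewrite ltr_pwDr// le_max lexx.
have s0 : 0 < s by rewrite ltr_wpDl// le_max lexx orbT.
have cf (x : R) : {for x, continuous f}.
  by apply/differentiable_continuous/derivable1_diffP; exact: df.
have f's (x : R) : ~ (- s <= x <= s) -> derive1 f x = 0.
  move=> /negP; rewrite -ler_norml -ltNge => sx.
  rewrite derive1E (near_eq_derive (g := cst 0)) ?derive_cst//.
  have : r < `|x| by apply: lt_trans sx.
  move=> rx.
  have H : \forall y \near x, r < `|y| by exact: (@cvgr_norm_gt R R^o R (nbhs x) _ id x cvg_id r rx).
  by apply: (filterS _ H) => y; exact: fr.
transitivity (\int[leb]_(x in `[(- s)%R, s]) (derive1 f x)%:E)%E.
  rewrite [RHS]integral_mkcond; apply: eq_integral => x _.
  rewrite patchE; case: ifPn => //; rewrite notin_setE /= in_itv/= => /f's ->//.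
have -> := @continuous_FTC2 R (derive1 f) f (- s) s.
- rewrite !fr ?subee// ?normrN gtr0_norm//.
- by rewrite (lt_trans _ s0)// oppr_lt0.
- exact: continuous_subspaceT.
- split => //; first by apply: cvg_at_right_filter; exact: cf.
  by apply: cvg_at_left_filter; exact: cf.
- by [].
Qed.

Lemma cvg_rV n T (F : set_system T) {FF : Filter F} (g : T -> 'rV[R]_n) (l : 'rV[R]_n) :
  (forall i, g t 0 i @[t --> F] --> l 0 i) -> g @ F --> l.
Proof.
move=> H; apply/cvgrPdist_lt => e e0.
have : \forall t \near F, forall i, `|l 0 i - g t 0 i| < e.
  by apply: filter_forall => i; move/cvgrPdist_lt : (H i) => /(_ _ e0).
apply: filterS => t tP; apply/rV_norm_lt => // i.
by rewrite !mxE.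
Qed.

Lemma continuous_consRr n (a : R) : continuous (@consR R n a).
Proof.
move=> y; apply: (@cvg_rV _ _ (nbhs y)) => i; case: (unliftP ord0 i) => [j|] ->.
  rewrite consRS; under eq_cvg do rewrite consRS.
  exact: coord_continuous.
by rewrite consR0; under eq_cvg do rewrite consR0; exact: cvg_cst.
Qed.

Lemma continuous_consRl n (y : 'rV[R]_n) : continuous ((@consR R n)^~ y).
Proof.
move=> a; apply: (@cvg_rV _ _ (nbhs a)) => i; case: (unliftP ord0 i) => [j|] ->.
  by rewrite consRS; under eq_cvg do rewrite consRS; exact: cvg_cst.
by rewrite consR0; under eq_cvg do rewrite consR0; exact: cvg_id.
Qed.

Lemma consR_delta0 n h a (y : 'rV[R]_n) :
  h *: delta_mx 0 ord0 + consR a y = consR (h + a) y.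
Proof.
apply/rowP => i; rewrite !mxE eqxx/=; case: unliftP => [j|] -> /=.
  by rewrite mulr0 add0r.
by rewrite mulr1.
Qed.

Lemma consR_deltaS n h a (y : 'rV[R]_n) j :
  h *: delta_mx 0 (lift ord0 j) + consR a y = consR a (h *: delta_mx 0 j + y).
Proof.
apply/rowP => i; rewrite !mxE eqxx/=; case: (unliftP ord0 i) => [k|] -> /=.
  by rewrite !mxE eqxx /= (inj_eq (@lift_inj _ ord0)).
by rewrite mulr0 add0r.
Qed.

Lemma consR_quotientS n (F : 'rV[R]_n.+1 -> R) a (y : 'rV[R]_n) j :
  (fun h : R => h^-1 *: ((F \o shift (consR a y)) (h *: delta_mx 0 (lift ord0 j))
     - F (consR a y))) =
  (fun h => h^-1 *: (((F \o consR a) \o shift y) (h *: delta_mx 0 j)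
     - (F \o consR a) y)).
Proof. by apply/funext => h /=; rewrite consR_deltaS. Qed.

Lemma consR_quotient0 n (F : 'rV[R]_n.+1 -> R) a (y : 'rV[R]_n) :
  (fun h : R => h^-1 *: ((F \o shift (consR a y)) (h *: delta_mx 0 ord0)
     - F (consR a y))) =
  (fun h => h^-1 *: (((F \o (consR (n:=n))^~ y) \o shift a) (h *: 1)
     - (F \o (consR (n:=n))^~ y) a)).
Proof.
by apply/funext => h /=; rewrite consR_delta0 /GRing.scale/= mulr1.
Qed.

(** Fubini: a derivative in the first coordinate integrates to 0 on each line, and
    the other derivatives are handled by induction on each slice. *)
Lemma integral_partial0 n (i : 'I_n) (F : 'rV[R]_n -> R) :
  continuous F -> bounded_supp F ->
  (forall x, derivable F x (delta_mx 0 i)) -> continuous (partial i F) ->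
  (\int[mu n]_x (partial i F x)%:E = 0)%E.
Proof.
elim: n i F => [[]//|n IHn] i F cF [r rP] dF cF'.
have sF' : bounded_supp (partial i F).
  exists r => x rx; rewrite /partial (near_eq_derive (g := cst 0)) ?derive_cst//.
  have H : \forall y \near x, r < `|y| by exact: (@cvgr_norm_gt R _ 'rV[R]_n.+1 (nbhs x) _ id x cvg_id r rx).
  by apply: (filterS _ H) => y; exact: rP.
have norm_consRr a (y : 'rV[R]_n) : `|y| <= `|consR a y|.
  by apply/rV_norm_le => // j; rewrite -(consRS a); exact: rV_coord_norm.
have norm_consRl a (y : 'rV[R]_n) : `|a| <= `|consR a y|.
  by rewrite -{1}(consR0 a y); exact: rV_coord_norm.
have [] := integral_lebesgue_rVS (bounded_supp_integrable measurableT cF' sF').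
move=> iF' ->.
case: (unliftP ord0 i) dF cF' {sF'} iF' => [j|] -> dF cF' iF'.
- have dE a (y : 'rV[R]_n) :
      partial j (F \o consR a) y = partial (lift ord0 j) F (consR a y).
    by rewrite /partial /derive consR_quotientS.
  rewrite -integral12_prod_meas1//; apply: integral0_eq => a _ /=.
  rewrite /fubini_F.
  under eq_integral do rewrite /= -dE.
  apply: IHn.
  + by move=> y; apply: continuous_comp; [exact: continuous_consRr|exact: cF].
  + by exists r => y ry; apply: rP; exact: lt_le_trans (norm_consRr _ _).
  + by move=> y; have := dF (consR a y); rewrite /derivable consR_quotientS.
  + rewrite (_ : partial j _ = partial (lift ord0 j) F \o consR a); last first.
      by apply/funext => y; exact: dE.
    by move=> y; apply: continuous_comp; [exact: continuous_consRr|exact: cF'].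
- have dE (y : 'rV[R]_n) a :
      derive1 (F \o (consR (n:=n))^~ y) a = partial ord0 F (consR a y).
    by rewrite /partial derive1E /derive consR_quotient0.
  rewrite -integral21_prod_meas1//; apply: integral0_eq => y _ /=.
  rewrite /fubini_G.
  under eq_integral do rewrite /= -dE.
  apply: (@integral_derive1_bounded_supp _ r).
  + by move=> a; have := dF (consR a y); rewrite /derivable consR_quotient0.
  + rewrite (_ : derive1 _ = partial ord0 F \o (consR (n:=n))^~ y); last first.
      by apply/funext => a; exact: dE.
    by move=> a; apply: continuous_comp; [exact: continuous_consRl|exact: cF'].
  + by move=> a ra; apply: rP; exact: lt_le_trans (norm_consRl _ _).
Qed.

End integration_by_parts_rV.

(** * Test functions and the fundamental lemma of the calculus of variations *)

Section test_functions.
Context {R : realType}.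
Local Notation mu := (lebesgue_rV R).
Variable n : nat.
Implicit Types (F G f g phi psi : 'rV[R]_n -> R) (Omega : set 'rV[R]_n) (i : 'I_n).

Lemma continuous_rVD F G : continuous F -> continuous G ->
  continuous (fun x => F x + G x).
Proof. by move=> cF cG x; exact: (continuousD (cF x) (cG x)). Qed.

Lemma continuous_rVM F G : continuous F -> continuous G ->
  continuous (fun x => F x * G x).
Proof. by move=> cF cG x; exact: (continuousM (cF x) (cG x)). Qed.

Lemma smooth_continuous F : smooth F -> continuous F.
Proof. by move=> /(_ [::])[]. Qed.

Lemma smooth_derivable F i x : smooth F -> derivable F x (delta_mx 0 i).
Proof. by move=> /(_ [::])[_]; apply. Qed.
Arguments smooth_derivable [F] i x _.

Lemma smooth_partial F i : smooth F -> smooth (partial i F).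
Proof.
move=> sF s; suff -> : partials s (partial i F) = partials (rcons s i) F by exact: sF.
by rewrite /partials foldr_rcons.
Qed.

Lemma smooth_coind (C : set ('rV[R]_n -> R)) :
  (forall F, C F -> [/\ continuous F, forall i x, derivable F x (delta_mx 0 i)
     & forall i, C (partial i F)]) ->
  forall F, C F -> smooth F.
Proof.
move=> CP F CF s; have : C (partials s F).
  by elim: s => //= i s /CP[].
by move=> /CP[].
Qed.

Lemma partial_lin F G (a : R) i x : derivable F x (delta_mx 0 i) ->
  derivable G x (delta_mx 0 i) ->
  derivable (fun x => a * F x + G x) x (delta_mx 0 i) /\
  partial i (fun x => a * F x + G x) x = a * partial i F x + partial i G x.
Proof.
move=> /derivableP dF /derivableP dG.
have [] := is_deriveD (is_deriveZ a dF) dG.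
by rewrite /partial => dFG ->.
Qed.

Lemma smooth_lin F G (a : R) : smooth F -> smooth G ->
  smooth (fun x => a * F x + G x).
Proof.
move=> sF sG.
apply: (@smooth_coind [set H | exists F G, [/\ smooth F, smooth G
  & H = fun x => a * F x + G x]]); last by exists F, G.
move=> _ [{sF sG}F [{}G [sF sG ->]]]; split.
- apply: continuous_rVD; last exact: smooth_continuous.
  by apply: continuous_rVM; [exact: cst_continuous|exact: smooth_continuous].
- by move=> i x; have [] := partial_lin a (smooth_derivable i x sF) (smooth_derivable i x sG).
- move=> i; exists (partial i F), (partial i G).
  split; [exact: smooth_partial|exact: smooth_partial|].
  apply/funext => x.
  by have [] := partial_lin a (smooth_derivable i x sF) (smooth_derivable i x sG).
Qed.

Lemma test_function_lin Omega phi psi (a : R) : test_function Omega phi ->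
  test_function Omega psi -> test_function Omega (fun x => a * phi x + psi x).
Proof.
move=> [sphi [K [cK KO phi0]]] [spsi [L [cL LO psi0]]]; split; first exact: smooth_lin.
exists (K `|` L); split; first exact: compactU.
- by move=> x [/KO|/LO].
- by move=> x /not_orP[/phi0 -> /psi0 ->]; rewrite mulr0 addr0.
Qed.

Lemma test_function_supp Omega phi : test_function Omega phi ->
  forall x, ~ Omega x -> phi x = 0.
Proof. by move=> [_ [K [_ KO phi0]]] x Ox; apply: phi0 => /KO. Qed.

Lemma test_function_bounded_supp Omega phi : test_function Omega phi ->
  bounded_supp phi.
Proof.
move=> [_ [K [/compact_bounded[M [_ KM]] _ phi0]]]; exists (M + 1) => x Mx.
apply: phi0 => Kx; have := KM (M + 1); rewrite ltrDl ltr01 => /(_ isT _ Kx) /=.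
by rewrite leNgt Mx.
Qed.

Lemma test_function_partial Omega phi i : test_function Omega phi ->
  test_function Omega (partial i phi).
Proof.
move=> [sphi [K [cK KO phi0]]]; split; first exact: smooth_partial.
exists K; split => // x Kx; rewrite /partial (near_eq_derive (g := cst 0)) ?derive_cst//.
have clK : closed K by apply: compact_closed cK; exact: (@norm_hausdorff R 'rV[R]_n).
have := closed_openC clK.
by rewrite openE => /(_ _ Kx); apply: filterS => y; exact: phi0.
Qed.

Lemma integral_supp_sub Omega (f : 'rV[R]_n -> \bar R) :
  (forall x, ~ Omega x -> f x = 0%E) ->
  (\int[mu n]_(x in Omega) f x = \int[mu n]_x f x)%E.
Proof.
move=> f0; rewrite integral_mkcond; apply: eq_integral => x _.
by rewrite patchE; case: ifPn => //; rewrite notin_setE => /f0.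
Qed.

(** The product rule and the vanishing of the integral of a partial derivative. *)
Lemma test_function_by_parts Omega phi psi i : measurable Omega ->
  test_function Omega phi -> test_function Omega psi ->
  \int[mu n]_(x in Omega) (phi x * partial i psi x) =
  - \int[mu n]_(x in Omega) (partial i phi x * psi x).
Proof.
move=> mO tphi tpsi.
have cT := fun phi (t : test_function Omega phi) => smooth_continuous t.1.
have dT := fun phi x (t : test_function Omega phi) => smooth_derivable i x t.1.
have partM x : is_derive x (delta_mx 0 i) (phi \* psi)
    (phi x * partial i psi x + psi x * partial i phi x).
  by apply: is_deriveM; apply/derivableP; exact: dT.
have partME : partial i (phi \* psi) =
    fun x => phi x * partial i psi x + psi x * partial i phi x.
  by apply/funext => x; rewrite /partial; have [_ ->] := partM x.
have ii (f g : 'rV[R]_n -> R) : test_function Omega f -> test_function Omega g ->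
    (mu n).-integrable Omega (EFin \o (f \* g)).
  move=> tf tg; apply: bounded_supp_integrable => //.
    by apply: continuous_rVM; exact: cT.
  have [r rP] := test_function_bounded_supp tf; exists r => x /rP /= ->.
  by rewrite mul0r.
have tphi' := test_function_partial i tphi.
have tpsi' := test_function_partial i tpsi.
have i1 := ii _ _ tphi tpsi'; have i2 := ii _ _ tphi' tpsi.
apply/eqP; rewrite -addr_eq0 -RintegralD//; apply/eqP; rewrite /Rintegral.
rewrite integral_supp_sub => [|x Ox]; last first.
  by rewrite (test_function_supp tphi)// (test_function_supp tpsi)// mul0r mulr0 addr0.
rewrite (eq_integral (fun x => (partial i (phi \* psi) x)%:E)); last first.
  by move=> x _; rewrite partME [partial i phi x * _]mulrC.
rewrite integral_partial0//.
- by apply: continuous_rVM; exact: cT.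
- have [r rP] := test_function_bounded_supp tphi; exists r => x /rP /= ->.
  by rewrite mul0r.
- by rewrite partME; apply: continuous_rVD; apply: continuous_rVM; exact: cT.
Qed.

(** Products of functions of one coordinate are stable under partial derivatives,
    which only change one factor, so their smoothness reduces to dimension one. *)
Definition tensor (eta : 'I_n -> R -> R) (x : 'rV[R]_n) : R :=
  \prod_j eta j (x 0 j).

Lemma tensor_derive (eta : 'I_n -> R -> R) i (x : 'rV[R]_n) :
  derivable (eta i) (x 0 i) 1 ->
  is_derive x (delta_mx 0 i) (tensor eta)
    (tensor (fun j => if j == i then derive1 (eta i) else eta j) x).
Proof.
move=> di; pose c := \prod_(j | j != i) eta j (x 0 j).
have qE : (fun h : R => h^-1 *: ((tensor eta \o shift x) (h *: delta_mx 0 i) - tensor eta x))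
   = (fun h => h^-1 *: (((eta i \* cst c) \o shift (x 0 i)) (h *: 1) -
                         (eta i \* cst c) (x 0 i))).
  apply/funext => h; rewrite /= /tensor (bigD1 i)//= [X in _ - X](bigD1 i)//=.
  rewrite !mxE !eqxx; congr (_ *: (_ * _ - _)).
  by apply: eq_bigr => j ji; rewrite !mxE eqxx (negbTE ji)/= mulr0 add0r.
have [dc cE] := is_deriveM (derivable_is_derive1 di) (is_derive_cst c (x 0 i) 1).
apply: DeriveDef; first by rewrite /derivable qE; exact: dc.
rewrite /derive qE; apply: etrans cE _.
rewrite /tensor (bigD1 i)//= eqxx scaler0 add0r mulrC; congr (_ * _).
by apply: eq_bigr => j /negbTE ->.
Qed.

Lemma smooth_tensor (eta : 'I_n -> R -> R) : (forall j, smooth1 (eta j)) ->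
  smooth (tensor eta).
Proof.
move=> seta; apply: (@smooth_coind [set F | exists2 eta, forall j, smooth1 (eta j)
    & F = tensor eta]); last by exists eta.
move=> _ [{seta}eta' seta ->]; split.
- apply: continuous_big => [|j _ x]; first exact: mul_continuous.
  apply: (@continuous_comp _ _ _ (fun x : 'rV[R]_n => x 0 j) (eta' j)).
    exact: coord_continuous.
  exact: smooth1_continuous.
- by move=> i x; have [] := tensor_derive (smooth1_derivable (x := x 0 i) (seta i)).
- move=> i; exists (fun j => if j == i then derive1 (eta' i) else eta' j).
    by move=> j; case: ifP => // _; exact: smooth1_derive1.
  apply/funext => x; rewrite /partial.
  by have [_ ->] := tensor_derive (smooth1_derivable (x := x 0 i) (seta i)).
Qed.

(** The j-th factor rises from 0 to 1 on [a j + 1/(k+1), a j + 2/(k+1)] and falls back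
    on the mirror interval at b j: the bumps tend to the indicator of the open box. *)
Definition box_bump (a b : 'I_n -> R) (k : nat) :=
  tensor (fun j t => smooth_step (k.+1%:R * t + (- (k.+1%:R * a j) - 1)) *
                     smooth_step (- k.+1%:R * t + (k.+1%:R * b j - 1))).

Lemma test_box_bump Omega a b a' b' k : rV_cbox a' b' `<=` Omega ->
  (forall j, a' j <= a j) -> (forall j, b j <= b' j) ->
  test_function Omega (box_bump a b k).
Proof.
move=> abO aa bb; split.
  apply: smooth_tensor => j.
  by apply: smooth1M; apply: smooth1_affine; exact: smooth1_step.
exists (rV_cbox a' b'); split => //; first exact: compact_rV_cbox.
move=> x; apply: contra_notP => /eqP/prodf_neq0 H j.
have := H j isT; rewrite mulf_eq0 => /norP[H1 H2].
have k0 : (0 : R) < k.+1%:R by [].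
rewrite (le_trans (aa j))/=; last first.
  rewrite leNgt; apply: contra H1 => xa; rewrite smooth_step_le0//.
  by have := ltW xa; rewrite -(ler_pM2l k0); lra.
rewrite (le_trans _ (bb j))//.
rewrite leNgt; apply: contra H2 => xa; rewrite smooth_step_le0//.
by have := ltW xa; rewrite -(ler_pM2l k0); lra.
Qed.

Lemma box_bump_ge0 a b k x : 0 <= box_bump a b k x.
Proof. by apply: prodr_ge0 => j _; rewrite mulr_ge0// smooth_step_ge0. Qed.

Lemma box_bump_le1 a b k x : box_bump a b k x <= 1.
Proof.
apply: prodr_ile1 => j _; rewrite mulr_ge0 ?smooth_step_ge0//=.
by rewrite mulr_ile1 ?smooth_step_ge0 ?smooth_step_le1.
Qed.

Lemma box_bump_cvg a b x :
  box_bump a b k x @[k --> \oo] --> (\1_(rV_box a b) x : R).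
Proof.
have [xab|xab] := pselect (rV_box a b x).
- rewrite indicE mem_set//; apply: cvg_near_cst.
  have H j : \forall k \near \oo, smooth_step (k.+1%:R * x 0 j + (- (k.+1%:R * a j) - 1)) *
       smooth_step (- k.+1%:R * x 0 j + (k.+1%:R * b j - 1)) = 1.
    have /andP[aj bj] := xab j.
    near=> k; have k0 : (0 : R) < k.+1%:R by [].
    have ka : 2 / (x 0 j - a j) <= k.+1%:R.
      apply: (@le_trans _ _ k%:R); last by rewrite ler_nat.
      by near: k; exact: nbhs_infty_ger.
    have kb : 2 / (b j - x 0 j) <= k.+1%:R.
      apply: (@le_trans _ _ k%:R); last by rewrite ler_nat.
      by near: k; exact: nbhs_infty_ger.
    move: ka kb; rewrite !ler_pdivrMr ?subr_gt0// => ka kb.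
    rewrite !smooth_step_ge1 ?mulr1//; lra.
  near=> k; rewrite /= /box_bump /tensor big1// => j _.
  by move: j; near: k; exact: filter_forall.
- rewrite indicE memNset//; apply: cvg_near_cst; near=> k.
  move: xab => /existsNP[j /negP]; rewrite negb_and -!leNgt => xab.
  apply/eqP; rewrite prodf_seq_eq0; apply/hasP; exists j; first exact: mem_index_enum.
  rewrite /= mulf_eq0; have k0 : (0 : R) < k.+1%:R by [].
  case/orP : xab; rewrite -(ler_pM2l k0) => xab; apply/orP; [left|right];
    rewrite smooth_step_le0 ?eqxx//; lra.
Unshelve. all: by end_near. Qed.

Definition rV_boxes : set (set 'rV[R]_n) := [set A | exists a b, A = rV_box a b].

Lemma rV_box_setI (a b a' b' : 'I_n -> R) : rV_box a b `&` rV_box a' b' =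
  rV_box (fun i => Num.max (a i) (a' i)) (fun i => Num.min (b i) (b' i)).
Proof.
apply/seteqP; split=> [x [H1 H2] i|x H].
  have /andP[? ?] := H1 i; have /andP[? ?] := H2 i.
  by rewrite gt_max lt_min; apply/andP; split; apply/andP; split.
by split=> i; have := H i; rewrite gt_max lt_min => /andP[/andP[? ?] /andP[? ?]];
  apply/andP.
Qed.

Lemma rV_boxes_setI : setI_closed rV_boxes.
Proof.
move=> _ _ [a [b ->]] [a' [b' ->]]; rewrite rV_box_setI.
by eexists; eexists; reflexivity.
Qed.

(** A half-line in one coordinate is the union of a sequence of boxes, so the open
    boxes generate the sigma-algebra of the coordinates. *)
Lemma rV_measurable_boxes : (measurable : set (set 'rV[R]_n)) `<=` <<s rV_boxes>>.
Proof.
have H i : (measurable : set (set (measurableTypeR R))) `<=`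
    [set Y | <<s rV_boxes >> [set x : 'rV[R]_n | Y (x 0 i)]].
  rewrite -[measurable]/((@ocitv R).-sigma.-measurable) RGenOInfty.measurableE.
  apply: smallest_sub.
    split => /=.
    - exact: sigma_algebra0.
    - move=> A sA; rewrite (_ : [set x | _] = ~` [set x : 'rV[R]_n | A (x 0 i)]).
        exact: (sigma_algebraC sA).
      by apply/seteqP; split => x /=; [case|].
    - by move=> F HF; exact: (sigma_algebra_bigcup HF).
  move=> _ [a ->] /=.
  rewrite (_ : [set x | _] = \bigcup_k rV_box
      (fun j => if j == i then a else - k%:R) (fun=> k%:R)); last first.
    apply/seteqP; split => [x|x [k _ /(_ i)]]; rewrite /= in_itv/= andbT.
      move=> ax; exists (Num.truncn `|x|).+1 => // j.
      have := Num.Theory.truncnS_gt `|x|; move: (Num.truncn `|x|).+1 => k xk.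
      have : - k%:R < x 0 j < k%:R.
        by rewrite -ltr_norml; exact: le_lt_trans (rV_coord_norm _ _) xk.
      by case: eqP => [->|_] /andP[h1 h2]; rewrite ?ax ?h1 h2.
    by rewrite eqxx => /andP[].
  apply: sigma_algebra_bigcup => k; apply: sub_sigma_algebra.
  by exists (fun j => if j == i then a else - k%:R), (fun=> k%:R).
apply: smallest_sub; first exact: smallest_sigma_algebra.
move=> B; rewrite -bigcup_seq => -[i _] [Y mY <-]; rewrite setTI.
exact: (H i _ mY).
Qed.

Lemma dynkin_integral0 Q f : measurable Q -> (mu n).-integrable Q (EFin \o f) ->
  (\int[mu n]_(x in Q) (f x)%:E = 0)%E ->
  dynkin [set E | measurable E /\ (\int[mu n]_(x in E `&` Q) (f x)%:E = 0)%E].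
Proof.
move=> mQ fi f0; split => /=.
- by rewrite setTI.
- move=> E [mE E0]; split; first exact: measurableC.
  have mEQ := measurableI _ _ mE mQ; have mCQ := measurableI _ _ (measurableC mE) mQ.
  have QE : Q = (E `&` Q) `|` (~` E `&` Q) by rewrite -setIUl setUv setTI.
  have := f0; rewrite {1}QE integral_setU//= -?QE.
  + by rewrite E0 add0e.
  + exact: measurable_int fi.
  + rewrite disj_set2E; apply/eqP/seteqP; split => // x [[? _] []] //.
- move=> F tF HF; split; first by apply: bigcup_measurable => k _; have [] := HF k.
  rewrite setI_bigcupl integral_bigcup.
  + by apply: eseries0 => k _ _; have [] := HF k.
  + exact: trivIset_setIr.
  + by move=> k; apply: measurableI => //; have [] := HF k.
  + apply: (integrableS mQ) => //; last by apply: bigcup_sub => k _ x [].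
    by apply: bigcup_measurable => k _; apply: measurableI => //; have [] := HF k.
Qed.

(** Bump functions tending to indicators show that f has integral 0 over every open
    box inside the given one.  Open boxes are a pi-system, so by the pi-lambda theorem
    f has integral 0 over every measurable subset. *)
Lemma fundamental_lemma_box Omega f a b : measurable Omega ->
  (mu n).-integrable Omega (EFin \o f) ->
  (forall phi, test_function Omega phi ->
    \int[mu n]_(x in Omega) (f x * phi x) = 0) ->
  rV_cbox a b `<=` Omega ->
  {ae mu n, forall x, rV_box a b x -> f x = 0}.
Proof.
move=> mO fi f0 abO; set Q := rV_box a b.
have mQ : measurable Q by exact: measurable_rV_box.
have QO : Q `<=` Omega by apply: subset_trans abO; exact: rV_box_sub_cbox.
have fiQ : (mu n).-integrable Q (EFin \o f) by exact: integrableS fi.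
have mf : measurable_fun Omega f by apply/measurable_EFinP; exact: measurable_int fi.
have box0 a' b' : (\int[mu n]_(x in rV_box a' b' `&` Q) (f x)%:E = 0)%E.
  rewrite rV_box_setI; set c := fun i => _; set d := fun i => _.
  have cdQ : rV_box c d `<=` Q by rewrite -rV_box_setI; exact: subIsetr.
  have tphi k : test_function Omega (box_bump c d k).
    apply: (test_box_bump _ abO) => j; first by rewrite le_max lexx orbT.
    by rewrite ge_min lexx orbT.
  have mcd : measurable (rV_box c d) by exact: measurable_rV_box.
  have mphi k : measurable_fun Omega (box_bump c d k).
    apply: measurable_funTS; apply: continuous_rV_measurable.
    exact: smooth_continuous (tphi k).1.
  have mF k : measurable_fun Omega (fun x => (f x * box_bump c d k x)%:E).
    by apply/measurable_EFinP; exact: measurable_funM.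
  have mF' : measurable_fun Omega (fun x => (f x * \1_(rV_box c d) x)%:E).
    by apply/measurable_EFinP; apply: measurable_funM => //; exact: measurable_indic.
  have cF : {ae mu n, forall x, Omega x ->
      (f x * box_bump c d k x)%:E @[k --> \oo] --> (f x * \1_(rV_box c d) x)%:E}.
    apply: aeW => x _; apply: cvg_EFin; first by near=> k.
    by apply: cvgMr; exact: box_bump_cvg.
  have bF : {ae mu n, forall x k, Omega x ->
      (`|(f x * box_bump c d k x)%:E| <= (abse \o (EFin \o f)) x)%E}.
    apply: aeW => x k _; rewrite /= lee_fin normrM ler_piMr//.
    by rewrite ger0_norm ?box_bump_ge0 ?box_bump_le1.
  have [_ _] := dominated_convergence mO mF mF' cF (integrable_abse fi) bF.
  rewrite [X in _ --> X -> _](_ : _ = \int[mu n]_(x in rV_box c d) (f x)%:E)%E; last first.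
    rewrite [RHS]integral_mkcond [LHS]integral_mkcond; apply: eq_integral => x _.
    rewrite !patchE indicE; case: ifPn => xO; case: ifPn => xcd.
    - by rewrite mulr1.
    - by rewrite mulr0.
    - by case/negP : xO; move/set_mem : xcd => /cdQ/QO/mem_set.
    - by [].
  have int0 k : (\int[mu n]_(x in Omega) (f x * box_bump c d k x)%:E = 0)%E.
    have := f0 _ (tphi k); rewrite /Rintegral => /eqP; rewrite fine_eq0 => [/eqP//|].
    apply: integrable_fin_num => //; apply: le_integrable fi => //.
    - move=> x _; rewrite /= lee_fin normrM ler_piMr//.
      by rewrite ger0_norm ?box_bump_ge0 ?box_bump_le1.
  rewrite (_ : [sequence _]_k = cst 0%E); last by apply/funext => k; exact: int0.
  by move=> H; apply: (cvg_unique _ H) => //; exact: cvg_cst.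
have H : <<s rV_boxes>> `<=` [set E | measurable E /\ (\int[mu n]_(x in E `&` Q) (f x)%:E = 0)%E].
  apply: lambda_system_subset.
  - exact: rV_boxes_setI.
  - apply/dynkin_lambda_system; apply: dynkin_integral0 => //.
    by have := box0 a b; rewrite setIid.
  - by move=> _ [a' [b' ->]]; split; [exact: measurable_rV_box|exact: box0].
  - by [].
have := @integral_ae_eq _ _ _ (mu n) Q mQ (cst 0%E) (EFin \o f) fiQ (measurable_cst _).
case.
  move=> E EQ /rV_measurable_boxes/H[_].
  by rewrite (setIidl EQ) integral0.
move=> N [mN N0 NP]; exists N; split => // x /=.
move=> xP; apply: NP => /= xfP; apply: xP => xQ.
by have := xfP xQ => -[].
Unshelve. all: by end_near. Qed.

Lemma fundamental_lemma Omega f : open Omega ->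
  (mu n).-integrable Omega (EFin \o f) ->
  (forall phi, test_function Omega phi ->
    \int[mu n]_(x in Omega) (f x * phi x) = 0) ->
  {ae mu n, forall x, Omega x -> f x = 0}.
Proof.
move=> oO fi f0; have mO := open_rV_measurable oO.
have [D [a [b [abO OE]]]] := open_rV_cover oO.
have : {ae mu n, forall x k, D k -> rV_box (a k) (b k) x -> f x = 0}.
  apply: ae_foralln => k.
  have [Dk|Dk] := pselect (D k); last by apply: aeW => x /Dk.
  have := fundamental_lemma_box mO fi f0 (abO k Dk).
  by apply: filterS => x H _.
apply: filterS => x H; rewrite OE => -[k Dk].
exact: H.
Qed.

End test_functions.
Arguments smooth_derivable {R n} [F] i x _.

(** * The space H_0^1 and its Dirichlet form *)

Section sobolev_structure.
Context {R : realType} {N : nat}.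
Variable Omega : set 'rV[R]_N.
Hypothesis oO : open Omega.
Hypothesis foO : (lebesgue_rV R N Omega < +oo)%E.
Implicit Types (f g h u v w phi : 'rV[R]_N -> R) (a e : R).

Local Notation mu := (lebesgue_rV R N).
Local Notation L2 := (inL2 Omega).
Local Notation X := (H10 Omega).
Local Notation test := (test_function Omega).

Definition ip f g := \int[mu]_(x in Omega) (f x * g x).

Let mO : measurable Omega. Proof. exact: open_rV_measurable. Qed.

Lemma L2_sqr_integrable f : L2 f -> mu.-integrable Omega (EFin \o (fun x => f x ^+ 2)).
Proof.
move=> [mf foo]; apply/integrableP; split.
  by apply/measurable_EFinP; exact: measurable_funX.
apply: le_lt_trans foo; rewrite le_eqVlt; apply/orP; left; apply/eqP.
by apply: eq_integral => x _; rewrite /= ger0_norm// sqr_ge0.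
Qed.

Lemma integrable_L2 f : measurable_fun Omega f ->
  mu.-integrable Omega (EFin \o (fun x => f x ^+ 2)) -> L2 f.
Proof. by move=> mf /(integrable_lty mO) fi; split. Qed.

Lemma L2_mul_integrable f g : L2 f -> L2 g ->
  mu.-integrable Omega (EFin \o (fun x => f x * g x)).
Proof.
move=> /[dup] f2 [mf _] /[dup] g2 [mg _].
have : mu.-integrable Omega (EFin \o (fun x => f x ^+ 2 + g x ^+ 2)).
  have := integrableD mO (L2_sqr_integrable f2) (L2_sqr_integrable g2).
  by apply: eq_integrable.
apply: le_integrable => //; first by apply/measurable_EFinP; exact: measurable_funM.
move=> x _; rewrite /= lee_fin [leRHS]ger0_norm ?addr_ge0 ?sqr_ge0//.
by rewrite ler_norml; apply/andP; split; nra.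
Qed.

Lemma L2_lin a f g : L2 f -> L2 g -> L2 (fun x => a * f x + g x).
Proof.
move=> /[dup] f2 [mf _] /[dup] g2 [mg _].
have mfg : measurable_fun Omega (fun x => a * f x + g x).
  by apply: measurable_funD => //; exact: measurable_funM.
apply: integrable_L2 => //.
have : mu.-integrable Omega (EFin \o (fun x => (2 * a ^+ 2) * f x ^+ 2 + 2 * g x ^+ 2)).
  have := integrableD mO (integrableZl mO (2 * a ^+ 2) (L2_sqr_integrable f2))
    (integrableZl mO 2 (L2_sqr_integrable g2)).
  by apply: eq_integrable.
apply: le_integrable => //.
  by apply/measurable_EFinP; exact: measurable_funX.
move=> x _; rewrite /= lee_fin !ger0_norm ?sqr_ge0//.
  by have := sqr_ge0 (a * f x - g x); nra.
by rewrite addr_ge0// mulr_ge0 ?sqr_ge0// mulr_ge0// sqr_ge0.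
Qed.

Lemma L2_bounded f (M : R) : measurable_fun Omega f ->
  (forall x, Omega x -> `|f x| <= M) -> L2 f.
Proof.
move=> mf fM; apply: integrable_L2 => //; apply: measurable_bounded_integrable => //.
  exact: measurable_funX.
exists (M ^+ 2); split; first exact: num_real.
move=> y My x Ox /=; rewrite ger0_norm ?sqr_ge0// (le_trans _ (ltW My))//.
have fMx := fM x Ox; rewrite -(real_normK (num_real (f x))).
by rewrite lerXn2r// nnegrE; exact: le_trans fMx.
Qed.

Lemma L2_cst a : L2 (cst a).
Proof. by apply: (@L2_bounded _ `|a|) => //; exact: measurable_cst. Qed.

Lemma L2_integrable f : L2 f -> mu.-integrable Omega (EFin \o f).
Proof.
move=> f2; have := L2_mul_integrable f2 (L2_cst 1).
by apply: eq_integrable => // x _ /=; rewrite mulr1.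
Qed.

Lemma test_measurable phi : test phi -> measurable_fun Omega phi.
Proof.
move=> tphi; apply: measurable_funTS; apply: continuous_rV_measurable.
exact: smooth_continuous tphi.1.
Qed.

Lemma test_bounded phi : test phi -> exists2 M : R, 0 < M & forall x, `|phi x| <= M.
Proof.
move=> tphi; apply: bounded_supp_bounded; first exact: smooth_continuous tphi.1.
exact: test_function_bounded_supp tphi.
Qed.

Lemma L2_test phi : test phi -> L2 phi.
Proof.
move=> tphi; have [M _ MP] := test_bounded tphi.
by apply: (@L2_bounded _ M) => //; exact: test_measurable.
Qed.

Lemma ipC f g : ip f g = ip g f.
Proof. by apply: eq_Rintegral => x _; rewrite mulrC. Qed.

Lemma ip_lin a f g h : L2 f -> L2 g -> L2 h ->
  ip (fun x => a * f x + g x) h = a * ip f h + ip g h.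
Proof.
move=> f2 g2 h2; rewrite /ip.
rewrite -RintegralZl//; last exact: L2_mul_integrable.
rewrite -RintegralD//; [|..|exact: L2_mul_integrable]; last first.
  have := integrableZl mO a (L2_mul_integrable f2 h2).
  by apply: eq_integrable.
by apply: eq_Rintegral => x _; rewrite mulrDl mulrA.
Qed.

Lemma ip_ge0 f : 0 <= ip f f.
Proof. by apply: Rintegral_ge0 => x _; rewrite -expr2 sqr_ge0. Qed.

Lemma ip_sqrE f : L2 f -> (\int[mu]_(x in Omega) (f x ^+ 2)%:E = (ip f f)%:E)%E.
Proof.
move=> f2; rewrite /ip /Rintegral fineK; first by apply: eq_integral => x _; rewrite expr2.
by apply: integrable_fin_num => //; exact: L2_mul_integrable.
Qed.

(** Expand the square of s e f + g, for the two signs s. *)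
Lemma ip_young f g e : 0 < e -> L2 f -> L2 g ->
  `|ip f g| <= 2^-1 * (e * ip f f + e^-1 * ip g g).
Proof.
move=> e0 f2 g2; have ie0 : 0 < e^-1 by rewrite invr_gt0.
have key (s : R) : s ^+ 2 = 1 -> 0 <= e * ip f f + e^-1 * ip g g + 2 * s * ip f g.
  move=> s2; have := ip_ge0 (fun x => (s * e) * f x + g x).
  have fg2 := L2_lin (s * e) f2 g2.
  rewrite ip_lin// [ip f _]ipC [ip g _]ipC !ip_lin// [ip g f]ipC.
  move=> H0; have := mulr_ge0 (ltW ie0) H0.
  rewrite [X in 0 <= X -> _](_ : _ = s ^+ 2 * (e^-1 * e * e) * ip f f + e^-1 * ip g g + 2 * s * (e^-1 * e) * ip f g); last by ring.
  by rewrite mulVf ?gt_eqF// s2 !mul1r !mulr1.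
rewrite ler_norml; apply/andP; split.
  by have := key 1 (expr1n _ _); lra.
by have := key (-1); rewrite sqrrN expr1n => /(_ erefl); lra.
Qed.

Lemma ip_linfun_sqr a f g : L2 f -> L2 g ->
  ip (fun x => a * f x + g x) (fun x => a * f x + g x) <= 2 * a ^+ 2 * ip f f + 2 * ip g g.
Proof.
move=> f2 g2; have fg2 := L2_lin a f2 g2.
rewrite ip_lin// [ip f _]ipC [ip g _]ipC !ip_lin// [ip g f]ipC.
have := ip_ge0 (fun x => (- a) * f x + g x).
have fg2' := L2_lin (- a) f2 g2.
rewrite ip_lin// [ip f _]ipC [ip g _]ipC !ip_lin// [ip g f]ipC.
nra.
Qed.

Lemma ip_ae f g h : L2 f -> L2 g -> L2 h ->
  {ae mu, forall x, Omega x -> f x = g x} -> ip f h = ip g h.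
Proof.
move=> f2 g2 h2 fg; rewrite /ip /Rintegral; congr fine.
apply: ae_eq_integral => //.
- exact: measurable_int (L2_mul_integrable f2 h2).
- exact: measurable_int (L2_mul_integrable g2 h2).
- by apply: filterS fg => x H /H ->.
Qed.

Lemma L2_ae_orthogonal f : L2 f -> (forall phi, test phi -> ip f phi = 0) ->
  {ae mu, forall x, Omega x -> f x = 0}.
Proof. by move=> f2; apply: fundamental_lemma => //; exact: L2_integrable. Qed.

Lemma ip_ae0 f : L2 f -> {ae mu, forall x, Omega x -> f x = 0} -> ip f f = 0.
Proof.
move=> f2 f0; rewrite (@ip_ae _ (cst 0) _ f2 (L2_cst 0) f2)//.
rewrite /ip (@eq_Rintegral _ _ _ _ _ (cst 0)) => [|x _]; last by rewrite /= mul0r.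
by rewrite Rintegral_cst// mul0r.
Qed.

Lemma weak_gradient_unique u (g h : 'I_N -> 'rV[R]_N -> R) i : is_weak_gradient Omega u g ->
  is_weak_gradient Omega u h -> {ae mu, forall x, Omega x -> g i x = h i x}.
Proof.
move=> /(_ i)[g2 gP] /(_ i)[h2 hP].
have : {ae mu, forall x, Omega x -> (-1) * h i x + g i x = 0}.
  apply: L2_ae_orthogonal; first exact: L2_lin.
  move=> phi tphi; rewrite ip_lin//; last exact: L2_test.
  by have := gP _ tphi; rewrite hP// => /eqP; rewrite eqr_opp => /eqP; rewrite /ip => ->; lra.
by apply: filterS => x H /H; lra.
Qed.

Lemma weak_gradient_lin a u v (g h : 'I_N -> 'rV[R]_N -> R) : L2 u -> L2 v -> is_weak_gradient Omega u g ->
  is_weak_gradient Omega v h ->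
  is_weak_gradient Omega (fun x => a * u x + v x) (fun i x => a * g i x + h i x).
Proof.
move=> u2 v2 ug vh i; have [g2 gP] := ug i; have [h2 hP] := vh i.
split; first exact: L2_lin.
move=> phi tphi; have p2 := L2_test tphi.
have dp2 := L2_test (test_function_partial i tphi).
have := ip_lin a u2 v2 dp2; rewrite /ip => ->.
have := ip_lin a g2 h2 p2; rewrite /ip => ->.
by rewrite gP// hP// mulrN opprD.
Qed.

Lemma weak_gradient_test phi : test phi ->
  is_weak_gradient Omega phi (fun i => partial i phi).
Proof.
move=> tphi i; split; first exact/L2_test/test_function_partial.
by move=> psi tpsi; exact: test_function_by_parts.
Qed.

Lemma H10_L2 u : X u -> L2 u. Proof. by case. Qed.

Lemma H10_grad u : X u -> is_weak_gradient Omega u (grad Omega u).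
Proof. by move=> [_ [g ug] _]; rewrite /grad; case: xgetP => [h _ //|/(_ g)]. Qed.

Lemma H10_grad_L2 u i : X u -> L2 (grad Omega u i).
Proof. by move=> /H10_grad/(_ i)[]. Qed.

(** The squared H^1-distance from u to phi, when u has the weak gradient g. *)
Definition gdist u (g : 'I_N -> 'rV[R]_N -> R) phi : R :=
  ip (fun x => -1 * phi x + u x) (fun x => -1 * phi x + u x) +
  \sum_(i < N) ip (fun x => -1 * partial i phi x + g i x) (fun x => -1 * partial i phi x + g i x).

Lemma gdistE u (g : 'I_N -> 'rV[R]_N -> R) phi : L2 u -> (forall i, L2 (g i)) -> test phi ->
  (\int[mu]_(x in Omega) ((u x - phi x) ^+ 2)%:E +
         \sum_(i < N) \int[mu]_(x in Omega)
            ((g i x - partial i phi x) ^+ 2)%:E = (gdist u g phi)%:E)%E.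
Proof.
move=> u2 g2 tphi; rewrite /gdist EFinD -ip_sqrE; last exact/L2_lin/u2/L2_test.
congr (_ + _)%E; first by apply: eq_integral => x _; rewrite mulN1r addrC.
rewrite -sumEFin; apply: eq_bigr => i _; rewrite -ip_sqrE; last first.
  exact/L2_lin/g2/L2_test/test_function_partial.
by apply: eq_integral => x _; rewrite mulN1r addrC.
Qed.

Lemma H10_approx u e : X u -> 0 < e ->
  exists2 phi, test phi & gdist u (grad Omega u) phi < e.
Proof.
move=> /[dup] Xu [_ _ H] /H[phi tphi]; exists phi => //.
rewrite -lte_fin -gdistE//; first exact: H10_L2.
by move=> i; exact: H10_grad_L2.
Qed.

(** The chosen gradient may be replaced by any other weak gradient, since they agree
    almost everywhere. *)
Lemma H10_intro u (g : 'I_N -> 'rV[R]_N -> R) : L2 u -> is_weak_gradient Omega u g ->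
  (forall e, 0 < e -> exists2 phi, test phi & gdist u g phi < e) -> X u.
Proof.
move=> u2 ug H; have gu : is_weak_gradient Omega u (grad Omega u).
  by rewrite /grad; case: xgetP => [h _ //|/(_ g)].
split => //; first by exists g.
move=> e /H[phi tphi ge]; exists phi => //.
rewrite gdistE//; last by move=> i; have [] := gu i.
rewrite lte_fin; apply: le_lt_trans ge; rewrite /gdist lerD2l.
apply: ler_sum => i _; have dp2 := L2_test (test_function_partial i tphi).
have g2 := (ug i).1; have gu2 := (gu i).1.
have l1 := L2_lin (-1) dp2 gu2; have l2 := L2_lin (-1) dp2 g2.
have E : {ae mu, forall x, Omega x ->
    -1 * partial i phi x + grad Omega u i x = -1 * partial i phi x + g i x}.
  by apply: filterS (weak_gradient_unique i gu ug) => x H1 /H1 ->.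
by rewrite (ip_ae l1 l2 l1 E) ipC (ip_ae l1 l2 l2 E).
Qed.

Lemma grad_ae u (g : 'I_N -> 'rV[R]_N -> R) i : X u -> is_weak_gradient Omega u g ->
  {ae mu, forall x, Omega x -> grad Omega u i x = g i x}.
Proof. by move=> /H10_grad Xu ug; exact: weak_gradient_unique. Qed.

Lemma H10_test phi : test phi -> X phi.
Proof.
move=> tphi; apply: (H10_intro (L2_test tphi) (weak_gradient_test tphi)) => e e0.
exists phi => //; rewrite /gdist.
have z f : L2 f -> ip (fun x => -1 * f x + f x) (fun x => -1 * f x + f x) = 0.
  move=> f2; apply: ip_ae0; first exact: L2_lin.
  by apply: aeW => x _; rewrite mulN1r addNr.
rewrite z ?add0r; last exact: L2_test.
by rewrite big1// => i _; apply: z; exact/L2_test/test_function_partial.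
Qed.

Lemma H10_lin a u v : X u -> X v -> X (fun x => a * u x + v x).
Proof.
move=> Xu Xv; have u2 := H10_L2 Xu; have v2 := H10_L2 Xv.
apply: (H10_intro (L2_lin a u2 v2) (weak_gradient_lin a u2 v2 (H10_grad Xu) (H10_grad Xv))).
move=> e e0; pose d := e / (4 * (a ^+ 2 + 1)).
have d0 : 0 < d by rewrite divr_gt0// mulr_gt0// ltr_wpDl// sqr_ge0.
have [phi tphi phid] := H10_approx Xu d0.
have [psi tpsi psid] := H10_approx Xv d0.
have tl := test_function_lin a tphi tpsi.
exists (fun x => a * phi x + psi x) => //.
have key f g f' g' : L2 f -> L2 g -> L2 f' -> L2 g' ->
    ip (fun x => -1 * (a * f' x + g' x) + (a * f x + g x))
       (fun x => -1 * (a * f' x + g' x) + (a * f x + g x)) <=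
    2 * a ^+ 2 * ip (fun x => -1 * f' x + f x) (fun x => -1 * f' x + f x) +
    2 * ip (fun x => -1 * g' x + g x) (fun x => -1 * g' x + g x).
  move=> f2 g2 f2' g2'.
  rewrite (_ : (fun x => -1 * (a * f' x + g' x) + _) =
     (fun x => a * (-1 * f' x + f x) + (-1 * g' x + g x))); last first.
    by apply/funext => x; ring.
  by apply: ip_linfun_sqr; exact: L2_lin.
apply: (@le_lt_trans _ _ (2 * a ^+ 2 * gdist u (grad Omega u) phi +
    2 * gdist v (grad Omega v) psi)).
  rewrite /gdist !mulrDr addrACA; apply: lerD; first exact: key (L2_test tphi) (L2_test tpsi).
  rewrite !mulr_sumr -big_split/=; apply: ler_sum => i _.
  have pE : partial i (fun x => a * phi x + psi x) =
      (fun x => a * partial i phi x + partial i psi x).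
    apply/funext => x.
    by have [] := partial_lin a (smooth_derivable i x tphi.1) (smooth_derivable i x tpsi.1).
  rewrite pE; apply: key; try exact: H10_grad_L2.
    exact/L2_test/test_function_partial.
  exact/L2_test/test_function_partial.
have a20 : 0 <= a ^+ 2 by rewrite sqr_ge0.
move: (gdist u _ phi) (gdist v _ psi) phid psid => G1 G2 h1 h2.
have : (2 * a ^+ 2 + 2) * d <= e.
  by rewrite /d mulrA ler_pdivrMr; [nra|rewrite mulr_gt0// ltr_wpDl].
have h3 := ler_wpM2l a20 (ltW h1).
clearbody d; lra.
Qed.

Lemma H10_scale a u : X u -> X (fun x => a * u x).
Proof.
move=> Xu; have := H10_lin (a - 1) Xu Xu.
by rewrite (_ : (fun x => _) = fun x => a * u x)//; apply/funext => x; ring.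
Qed.

Definition dirichlet u v : R := \sum_(i < N) ip (grad Omega u i) (grad Omega v i).

Lemma dirichletC u v : dirichlet u v = dirichlet v u.
Proof. by apply: eq_bigr => i _; exact: ipC. Qed.

Lemma dirichlet_lin a u v w : X u -> X v -> X w ->
  dirichlet (fun x => a * u x + v x) w = a * dirichlet u w + dirichlet v w.
Proof.
move=> Xu Xv Xw; rewrite /dirichlet mulr_sumr -big_split/=; apply: eq_bigr => i _.
have Xl := H10_lin a Xu Xv.
have wl := weak_gradient_lin a (H10_L2 Xu) (H10_L2 Xv) (H10_grad Xu) (H10_grad Xv).
have u2 := H10_grad_L2 i Xu; have v2 := H10_grad_L2 i Xv; have w2 := H10_grad_L2 i Xw.
have l1 := H10_grad_L2 i Xl; have l2 := L2_lin a u2 v2.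
by rewrite -(ip_lin a u2 v2 w2); exact: (ip_ae l1 l2 w2 (grad_ae i Xl wl)).
Qed.

Lemma dirichlet_ge0 u : 0 <= dirichlet u u.
Proof. by apply: sumr_ge0 => i _; exact: ip_ge0. Qed.

Lemma dirichlet_integral u v : X u -> X v ->
  \int[mu]_(x in Omega) (\sum_(i < N) grad Omega u i x * grad Omega v i x) =
  dirichlet u v.
Proof.
move=> Xu Xv; rewrite /dirichlet /ip /Rintegral.
have ii i := L2_mul_integrable (H10_grad_L2 i Xu) (H10_grad_L2 i Xv).
under eq_integral do rewrite -sumEFin.
rewrite integral_sum//= sum_fine// => i _.
exact: (integrable_fin_num mO (ii i)).
Qed.

Lemma funAE u : X u -> funA Omega u = (dirichlet u u)%:E.
Proof.
move=> Xu; rewrite -dirichlet_integral// /Rintegral /funA fineK.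
  by apply: eq_integral => x _; congr EFin; apply: eq_bigr => i _; rewrite expr2.
have ii i := L2_mul_integrable (H10_grad_L2 i Xu) (H10_grad_L2 i Xu).
apply: integrable_fin_num => //.
have := @integrable_sum _ _ _ mu Omega mO _ (index_enum 'I_N) xpredT _ (fun i _ => ii i).
apply: eq_integrable => // x _; rewrite sumEFin//.
Qed.

Lemma dirichlet_young u v e : 0 < e -> X u -> X v ->
  `|dirichlet u v| <= 2^-1 * (e * dirichlet u u + e^-1 * dirichlet v v).
Proof.
move=> e0 Xu Xv; apply: le_trans (ler_norm_sum _ _ _) _.
rewrite /dirichlet !mulr_sumr -big_split/= mulr_sumr; apply: ler_sum => i _.
by apply: ip_young => //; exact: H10_grad_L2.
Qed.

Lemma dirichlet_lin2 a u v : X u -> X v ->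
  dirichlet (fun x => a * u x + v x) (fun x => a * u x + v x) =
  a ^+ 2 * dirichlet u u + 2 * a * dirichlet u v + dirichlet v v.
Proof.
move=> Xu Xv; have Xl := H10_lin a Xu Xv.
rewrite (dirichlet_lin a Xu Xv Xl) (dirichletC u) (dirichletC v).
rewrite (dirichlet_lin a Xu Xv Xu) (dirichlet_lin a Xu Xv Xv) (dirichletC v u).
move: (dirichlet u u) (dirichlet u v) (dirichlet v v) => x y z; ring.
Qed.

Lemma dirichlet_scale a u : X u ->
  dirichlet (fun x => a * u x) (fun x => a * u x) = a ^+ 2 * dirichlet u u.
Proof.
move=> Xu; rewrite (_ : (fun x => _) = fun x => (a - 1) * u x + u x).
  by rewrite (dirichlet_lin2 (a - 1) Xu Xu); move: (dirichlet u u) => x; ring.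
by apply/funext => x; ring.
Qed.

(** Moving the derivative onto phi makes the form continuous in u for
    the topology of L^1 already: on the right u appears without its gradient. *)
Lemma dirichlet_test u phi : X u -> test phi ->
  dirichlet u phi = - \sum_(i < N) ip u (partial i (partial i phi)).
Proof.
move=> Xu tphi; rewrite /dirichlet -sumrN; apply: eq_bigr => i _.
have dp := test_function_partial i tphi.
have := (H10_grad Xu i).2 _ dp; rewrite -/(ip _ _) => ->; rewrite opprK.
rewrite ipC; rewrite -/(ip _ _) [RHS]ipC.
apply: ip_ae; [exact: H10_grad_L2 (H10_test tphi)|exact: L2_test|exact: H10_grad_L2|].
exact: grad_ae (H10_test tphi) (weak_gradient_test tphi).
Qed.

Lemma gdist_dirichlet u phi : X u -> test phi ->
  dirichlet (fun x => -1 * phi x + u x) (fun x => -1 * phi x + u x) <=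
  gdist u (grad Omega u) phi.
Proof.
move=> Xu tphi; have Xp := H10_test tphi; have Xl := H10_lin (-1) Xp Xu.
rewrite /gdist -[leLHS]add0r lerD ?ip_ge0//; apply: ler_sum => i _.
have dp2 := L2_test (test_function_partial i tphi).
have wl := weak_gradient_lin (-1) (H10_L2 Xp) (H10_L2 Xu) (weak_gradient_test tphi) (H10_grad Xu).
have l1 := H10_grad_L2 i Xl; have l2 := L2_lin (-1) dp2 (H10_grad_L2 i Xu).
have E := grad_ae i Xl wl.
by rewrite (ip_ae l1 l2 l1 E) ipC (ip_ae l1 l2 l2 E).
Qed.

Lemma H10_ae0_dirichlet u : X u -> ae_zero Omega u -> dirichlet u u = 0.
Proof.
move=> Xu u0; rewrite /dirichlet big1// => i _; apply: ip_ae0; first exact: H10_grad_L2.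
have [g2 gP] := H10_grad Xu i; apply: L2_ae_orthogonal => // phi tphi.
apply/eqP; rewrite -oppr_eq0; apply/eqP; rewrite /ip -gP//.
have dp2 := L2_test (test_function_partial i tphi).
rewrite -/(ip _ _) (@ip_ae _ (cst 0) _ (H10_L2 Xu) (L2_cst 0) dp2 u0).
rewrite /ip (@eq_Rintegral _ _ _ _ _ (cst 0)) => [|x _]; last by rewrite /= mul0r.
by rewrite Rintegral_cst// mul0r.
Qed.

End sobolev_structure.

(** * Inequalities for real powers *)

Section power_inequalities.
Context {R : realType}.
Implicit Types (a b x y s t r p q : R).

Lemma le_powR r x y : 0 <= r -> 0 <= x -> x <= y -> x `^ r <= y `^ r.
Proof.
by move=> r0 x0 xy; apply: ge0_ler_powR; rewrite ?nnegrE// (le_trans x0).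
Qed.

Lemma lt_powR r x y : 0 < r -> 0 <= x -> x < y -> x `^ r < y `^ r.
Proof.
move=> r0 x0 xy; apply: gt0_ltr_powR; rewrite ?nnegrE//.
by rewrite ltW// (le_lt_trans x0).
Qed.

Lemma powRD_gt0 x r s : 0 < x -> x `^ (r + s) = x `^ r * x `^ s.
Proof. by move=> x0; rewrite powRD// (gt_eqF x0) implybT. Qed.

Lemma powRD_le x y q : 0 <= q -> 0 <= x -> 0 <= y ->
  (x + y) `^ q <= 2 `^ q * (x `^ q + y `^ q).
Proof.
move=> q0; wlog xy : x y / x <= y => [H x0 y0|x0 y0].
  have [xy|/ltW yx] := leP x y; first exact: H.
  by rewrite addrC [_ `^ q + _]addrC; exact: H.
apply: (@le_trans _ _ (2 `^ q * y `^ q)); last first.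
  by rewrite ler_wpM2l ?powR_ge0// lerDr powR_ge0.
by rewrite -powRM//; apply: le_powR; rewrite ?addr_ge0//; lra.
Qed.

Lemma powR_amgm x y r : 0 < r < 1 -> 0 <= x -> 0 <= y ->
  x `^ r * y `^ (1 - r) <= r * x + (1 - r) * y.
Proof.
move=> /andP[r0 r1] x0 y0; have r10 : 0 < 1 - r by rewrite subr_gt0.
have := @conjugate_powR _ (x `^ r) (y `^ (1 - r)) r^-1 (1 - r)^-1.
rewrite -!powRrM !divff ?gt_eqF// !powRr1// !invrK => H.
rewrite [r * x]mulrC [(1 - r) * y]mulrC; apply: H.
- exact: powR_ge0.
- exact: powR_ge0.
- by rewrite invr_gt0.
- by rewrite invr_gt0.
- by rewrite addrC subrK.
Qed.

(** Concavity: the tangent at x lies above the graph. *)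
Lemma powR_tangent x y r : 0 < r < 1 -> 0 < x -> 0 <= y ->
  y `^ r <= x `^ r + r * x `^ (r - 1) * (y - x).
Proof.
move=> r01 x0 y0; have H := powR_amgm r01 y0 (ltW x0).
have xr0 : 0 < x `^ (1 - r) by exact: powR_gt0.
have E : x `^ (r - 1) = (x `^ (1 - r))^-1 by rewrite -powRN opprB.
have E1 : x `^ r = x * (x `^ (1 - r))^-1.
  by rewrite -E -[in LHS](subrK 1 r) (powRD_gt0 (r - 1) 1 x0) powRr1 ?(ltW x0)// mulrC.
rewrite -(ler_pM2r xr0) (le_trans H)// E E1.
move: (x `^ (1 - r)) xr0 => X X0.
have -> : (x * X^-1 + r * X^-1 * (y - x)) * X = x + r * (y - x).
  by field; rewrite gt_eqF.
lra.
Qed.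

Lemma young_powR x y p : 0 < p -> 0 <= x -> 0 <= y ->
  x `^ p * y <= p / (p + 1) * x `^ (p + 1) + (p + 1)^-1 * y `^ (p + 1).
Proof.
move=> p0 x0 y0; have p10 : 0 < p + 1 by rewrite addr_gt0.
have r01 : 0 < p / (p + 1) < 1.
  by rewrite divr_gt0//= ltr_pdivrMr// mul1r ltrDl.
have := powR_amgm r01 (powR_ge0 x (p + 1)) (powR_ge0 y (p + 1)).
have E : 1 - p / (p + 1) = (p + 1)^-1.
  by field; rewrite gt_eqF.
by rewrite E -!powRrM [(p + 1) * (p / _)]mulrCA !divff ?gt_eqF// mulr1 powRr1.
Qed.

(** If y <= e x the first term alone is enough; otherwise x < y / e and the second
    one is. *)
Lemma young_powR_eps x y p (e : R) : 0 < p -> 0 < e -> 0 <= x -> 0 <= y ->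
  x `^ p * y <= e * x `^ (p + 1) + e `^ (- p) * y `^ (p + 1).
Proof.
move=> p0 e0 x0 y0; have p10 : 0 < p + 1 by rewrite addr_gt0.
have [xy|yx] := leP y (e * x).
  apply: (@le_trans _ _ (x `^ p * (e * x))); first by rewrite ler_wpM2l ?powR_ge0.
  rewrite mulrCA; have [->|xn0] := eqVneq x 0.
    by rewrite mulr0 mulr0 addr_ge0// mulr_ge0 ?powR_ge0 ?(ltW e0).
  rewrite powRD_gt0 ?lt0r ?xn0// powRr1// lerDl mulr_ge0 ?powR_ge0//.
apply: (@le_trans _ _ ((y / e) `^ p * y)).
  rewrite ler_wpM2r//; apply: le_powR => //; first exact: ltW.
  by rewrite ler_pdivlMr// mulrC ltW.
have y00 : 0 < y by apply: le_lt_trans yx; rewrite mulr_ge0 ?(ltW e0).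
have -> : (y / e) `^ p = y `^ p * e `^ (- p).
  rewrite powRM ?invr_ge0 ?(ltW e0)// -(powR_inv1 (ltW e0)).
  by rewrite -powRrM mulN1r.
rewrite (powRD_gt0 p 1 y00) powRr1//.
rewrite (_ : y `^ p * e `^ (- p) * y = e `^ (- p) * (y `^ p * y)); last by ring.
by rewrite lerDr mulr_ge0 ?powR_ge0 ?(ltW e0).
Qed.

Lemma norm_spow x r : 0 < r -> `|spow x r| = `|x| `^ r.
Proof.
move=> r0; rewrite /spow normrM (ger0_norm (powR_ge0 _ _)).
have [->|x0] := eqVneq x 0; first by rewrite normr0 powR0 ?gt_eqF// mulr0.
by rewrite normr_sg x0 mul1r.
Qed.

Lemma spow_mul x r : 0 < r -> spow x r * x = `|x| `^ (r + 1).
Proof.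
move=> r0; rewrite /spow mulrAC -normrEsg.
have [->|x0] := eqVneq x 0; first by rewrite normr0 mul0r powR0// gt_eqF// addr_gt0.
by rewrite powRD_gt0 ?normr_gt0// powRr1// mulrC.
Qed.

(** With x = a (x + y) and a in [0, 1], a^r <= a. *)
Lemma powR_superadditive x y r : 1 <= r -> 0 <= x -> 0 <= y ->
  x `^ r + y `^ r <= (x + y) `^ r.
Proof.
move=> r1 x0 y0; have r0 : 0 < r by rewrite (lt_le_trans _ r1).
have [xy0|xyn0] := eqVneq (x + y) 0.
  have -> : x = 0 by lra.
  by rewrite add0r powR0 ?gt_eqF// add0r.
have xy0 : 0 < x + y by rewrite lt0r xyn0 addr_ge0.
have key z : 0 <= z <= x + y -> z `^ r <= z / (x + y) * (x + y) `^ r.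
  move=> /andP[z0 zxy]; have [->|zn0] := eqVneq z 0.
    by rewrite powR0 ?gt_eqF// !mul0r.
  rewrite -{1}(divfK xyn0 z).
  apply: ge1r_powRZ => //; last exact: ltW.
  have z00 : 0 < z by rewrite lt0r zn0.
  by rewrite divr_gt0//= ler_pdivrMr// mul1r.
have := lerD (key x _) (key y _); rewrite x0 y0 lerDl lerDr x0 y0 => /(_ isT isT).
by rewrite -mulrDl -mulrDl divff ?gt_eqF// mul1r.
Qed.

(** For equal signs this is superadditivity of the power, for opposite signs the
    comparison of (x + y)^r with x^r + y^r. *)
Lemma spow_dist x y r : 1 <= r ->
  `|x - y| `^ r <= 2 `^ r * `|spow x r - spow y r|.
Proof.
move=> r1; have r0 : 0 < r by rewrite (lt_le_trans _ r1).
have t1 : 1 <= 2 `^ r by rewrite -{1}(@powRr0 _ 2) ler_powR ?ler1n// ltW.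
have spN z : spow (- z) r = - spow z r by rewrite /spow sgrN normrN mulNr.
wlog xy : x y / `|y| <= `|x| => [H|].
  have [|/ltW] := leP `|y| `|x|; first exact: H.
  by rewrite distrC [X in _ <= _ * X]distrC; exact: H.
wlog x0 : x y xy / 0 <= x => [H|].
  have [|/ltW x0] := leP 0 x; first exact: H.
  have := H (- x) (- y); rewrite !normrN oppr_ge0 => /(_ xy x0).
  by rewrite !spN -!opprD !normrN.
rewrite (ger0_norm x0) in xy.
have sx : spow x r = x `^ r.
  have [->|xn0] := eqVneq x 0; first by rewrite /spow sgr0 mul0r powR0 ?gt_eqF.
  by rewrite /spow gtr0_sg ?lt0r ?xn0// mul1r ger0_norm.
have [y0|y0] := leP 0 y.
  have sy : spow y r = y `^ r.
    have [->|yn0] := eqVneq y 0; first by rewrite /spow sgr0 mul0r powR0 ?gt_eqF.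
    by rewrite /spow gtr0_sg ?lt0r ?yn0// mul1r ger0_norm.
  rewrite (ger0_norm y0) in xy.
  have xy' : 0 <= x - y by rewrite subr_ge0.
  have H := powR_superadditive r1 y0 xy'; rewrite subrKC in H.
  rewrite sx sy (ger0_norm xy').
  have xyr : y `^ r <= x `^ r by apply: le_powR => //; exact: ltW.
  rewrite ger0_norm ?subr_ge0//.
  apply: (@le_trans _ _ (x `^ r - y `^ r)); first lra.
  by rewrite ler_peMl// subr_ge0.
have sy : spow y r = - `|y| `^ r by rewrite /spow ltr0_sg// mulN1r.
rewrite sx sy opprK (@ger0_norm _ (x `^ r + _)) ?addr_ge0 ?powR_ge0//.
apply: le_trans (powRD_le (ltW r0) x0 (normr_ge0 y)).
apply: le_powR => //; first exact: ltW.
by rewrite -{2}(ger0_norm x0) ler_normB.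
Qed.

End power_inequalities.

(** * The potential well as a function of two real variables *)

Section potential_well_reals.
Context {R : realType}.
Variable p : R.
Hypothesis p1 : 1 < p.
Let m := 2 / (p + 1).
Let th := 2 / (p - 1).

(** The depth d(delta) divided by S^(1+th). *)
Definition well_height (delta : R) : R := (2^-1 - delta / (p + 1)) * delta `^ th.
(** The least energy compatible with B = x and the Sobolev inequality A >= S B^m. *)
Definition well_energy (S x : R) : R := 2^-1 * S * x `^ m - x / (p + 1).

Let pp : 0 < p + 1. Proof. by have := p1; lra. Qed.
Let pm : 0 < p - 1. Proof. by have := p1; lra. Qed.

Lemma well_exponents : [/\ 0 < m, m < 1, 0 < th, m * (1 + th) = th & (1 + th) * (1 - m) = 1].
Proof.
split.
- by rewrite divr_gt0.
- by rewrite ltr_pdivrMr// mul1r; have := p1; lra.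
- by rewrite divr_gt0.
- by rewrite /m /th; field; rewrite !gt_eqF.
- by rewrite /m /th; field; rewrite !gt_eqF.
Qed.

Lemma well_m2 : m / 2 = (p + 1)^-1.
Proof. by rewrite /m; field; rewrite gt_eqF. Qed.

(** Concavity in x; the factor S x^(m-1) - 1 vanishes at the top x = S^(1+th) of the
    well. *)
Lemma well_energy_tangent (S x y : R) : 0 < S -> 0 < x -> 0 <= y ->
  (x - y) * (S * x `^ (m - 1) - 1) / (p + 1) <= well_energy S x - well_energy S y.
Proof.
move=> S0 x0 y0; have [m0 m1 _ _ _] := well_exponents.
have := @powR_tangent _ x y m; rewrite m0 m1 => /(_ isT x0 y0) H.
have := ler_wpM2l (ltW S0) H; rewrite /well_energy -well_m2.
move: (x `^ m) (x `^ (m - 1)) (y `^ m) => X1 X2 Y1; lra.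
Qed.

Let powV (x : R) : 0 < x -> x `^ (m - 1) * x `^ (1 - m) = 1.
Proof.
by move=> x0; rewrite -powRD_gt0// addrA subrK subrr powRr0.
Qed.

Lemma well_energy_incr (S x y : R) : 0 < S -> 0 <= y -> y < x ->
  x `^ (1 - m) < S -> well_energy S y < well_energy S x.
Proof.
move=> S0 y0 yx xS; have x0 : 0 < x by exact: le_lt_trans yx.
rewrite -subr_gt0; apply: lt_le_trans (well_energy_tangent S0 x0 y0).
rewrite divr_gt0// mulr_gt0 ?subr_gt0//.
apply: (@le_lt_trans _ _ (x `^ (m - 1) * x `^ (1 - m))); first by rewrite powV.
by rewrite mulrC ltr_pM2r// powR_gt0.
Qed.

(** At y itself the slope may vanish, so the tangent inequality is applied at the
    midpoint z, where it is strict, and then at y. *)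
Lemma well_energy_decr (S x y : R) : 0 < S -> 0 < y -> y < x ->
  S <= y `^ (1 - m) -> well_energy S x < well_energy S y.
Proof.
move=> S0 y0 yx yS; pose z := (x + y) / 2.
have yz : y < z by rewrite /z; lra.
have zx : z < x by rewrite /z; lra.
have z0 : 0 < z by exact: lt_trans yz.
have [m0 m1 _ _ _] := well_exponents.
have zS : S < z `^ (1 - m).
  apply: le_lt_trans yS _; apply: lt_powR => //; first by rewrite subr_gt0.
  exact: ltW.
have V0 (u : R) : 0 < u -> S * u `^ (m - 1) - 1 = (S - u `^ (1 - m)) * u `^ (m - 1).
  by move=> u0; rewrite mulrBl [X in _ = _ - X]mulrC powV.
apply: (@lt_le_trans _ _ (well_energy S z)).
  rewrite -subr_gt0; apply: lt_le_trans (well_energy_tangent S0 z0 (ltW (lt_trans z0 zx))).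
  rewrite divr_gt0// V0// nmulr_rgt0 ?subr_lt0//.
  by rewrite nmulr_rlt0 ?powR_gt0// subr_lt0.
rewrite -subr_ge0; apply: le_trans (well_energy_tangent S0 y0 (ltW z0)).
apply: divr_ge0; last exact: ltW.
rewrite V0// mulr_le0 ?subr_le0 ?(ltW yz)//.
by rewrite mulr_le0_ge0 ?powR_ge0// subr_le0.
Qed.

Lemma well_energyE (S delta : R) : 0 < S -> 0 < delta ->
  well_energy S ((S * delta) `^ (1 + th)) = S `^ (1 + th) * well_height delta.
Proof.
move=> S0 d0; have [_ _ _ mth _] := well_exponents.
rewrite /well_energy -powRrM [(1 + th) * m]mulrC mth /well_height.
have Sd0 : 0 < S * delta by rewrite mulr_gt0.
have E (u : R) : 0 < u -> u `^ (1 + th) = u * u `^ th.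
  by move=> u0; rewrite powRD_gt0// powRr1 ?(ltW u0).
rewrite !E// powRM ?(ltW S0) ?(ltW d0)//; ring.
Qed.

Lemma well_scaleE (a b : R) : 0 < a -> 0 < b ->
  (a / b) `^ th * a = (a / b `^ m) `^ (1 + th).
Proof.
move=> a0 b0; have [_ _ _ mth _] := well_exponents.
have a0' := ltW a0; have b0' := ltW b0.
rewrite !powRM ?invr_ge0 ?powR_ge0// -(powR_inv1 b0') -(powR_inv1 (powR_ge0 b m)).
rewrite -!powRrM [m * _]mulrCA mth.
by rewrite [in RHS]powRD_gt0// powRr1//; ring.
Qed.

(** S^(1+th) well_height delta is the value of well_energy S at (S delta)^(1+th), and
    well_energy S increases up to S^(1+th) and decreases afterwards.  If delta1 >= 1,
    both values at delta1 < delta2 would lie on the decreasing branch, so they could not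
    both be the level e0.  If b0 > (S delta1)^(1+th), then either b0 is on the
    increasing branch and well_energy S b0 > e0, although e0 >= well_energy S b0, or
    b0 >= S^(1+th) and e0 > (1/2 - 1/(p+1)) b0 exceeds the top of the well. *)
Lemma well_initial (S delta1 delta2 e0 a0 b0 : R) :
  0 < S -> 0 < delta1 -> delta1 < delta2 -> 0 < e0 -> 0 <= b0 -> b0 < a0 ->
  e0 = 2^-1 * a0 - b0 / (p + 1) -> S * b0 `^ m <= a0 ->
  e0 <= S `^ (1 + th) * well_height 1 ->
  e0 <= S `^ (1 + th) * well_height delta1 ->
  e0 <= S `^ (1 + th) * well_height delta2 ->
  (0 <= well_height delta1 -> S `^ (1 + th) * well_height delta1 <= e0) ->
  delta1 < 1 /\ b0 `^ (1 - m) <= S * delta1.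
Proof.
move=> S0 d10 d12 e00 b00 ba e0E Sba H1 Hd1 Hd2 Hl.
have [m0 m1 th0 mth thm] := well_exponents.
have d20 : 0 < delta2 by exact: lt_trans d12.
have m10 : 0 < 1 - m by rewrite subr_gt0.
have th1 : 0 < 1 + th by rewrite ltr_wpDl.
have powK (u : R) : 0 < u -> (u `^ (1 + th)) `^ (1 - m) = u.
  by move=> u0; rewrite -powRrM thm powRr1// ltW.
have powlt (u v : R) : 0 < u -> u < v -> u `^ (1 + th) < v `^ (1 + th).
  by move=> u0 uv; apply: lt_powR => //; exact: ltW.
have d1lt : delta1 < 1.
  rewrite ltNge; apply/negP => d11.
  have Sth : 0 < S `^ (1 + th) by exact: powR_gt0.
  have h1 : 0 <= well_height delta1.
    by rewrite -(pmulr_rge0 _ Sth) ltW// (lt_le_trans e00).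
  have := Hl h1; apply/negP; rewrite -ltNge; apply: le_lt_trans Hd2 _.
  rewrite -!well_energyE//; apply: well_energy_decr => //.
  - by rewrite powR_gt0// mulr_gt0.
  - by apply: powlt; rewrite ?mulr_gt0// ltr_pM2l.
  - by rewrite powK ?mulr_gt0// ler_peMr// ltW.
split => //; rewrite leNgt; apply/negP => bS.
have bS1 : b0 `^ (1 - m) < S.
  rewrite ltNge; apply/negP => Sb.
  have : well_energy S (S `^ (1 + th)) < e0.
    have -> : well_energy S (S `^ (1 + th)) = (2^-1 - (p + 1)^-1) * S `^ (1 + th).
      have := well_energyE S0 ltr01; rewrite mulr1 => ->.
      by rewrite /well_height powR1 mul1r mulr1 mulrC.
    have x1b : S `^ (1 + th) <= b0.
      have := le_powR (ltW th1) (ltW S0) Sb.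
      by rewrite -powRrM [(1 - m) * _]mulrC thm powRr1.
    have i2 : (p + 1)^-1 < 2^-1.
      by rewrite ltf_pV2 ?posrE//; have := p1; lra.
    rewrite e0E; have : (2^-1 - (p + 1)^-1) * S `^ (1 + th) <= (2^-1 - (p + 1)^-1) * b0.
      by rewrite ler_wpM2l// subr_ge0 ltW.
    lra.
  apply/negP; rewrite -leNgt; apply: le_trans H1 _.
  by have := well_energyE S0 ltr01; rewrite mulr1 => ->.
have : well_energy S ((S * delta1) `^ (1 + th)) < well_energy S b0.
  apply: well_energy_incr => //; first exact: powR_ge0.
  have := lt_powR th1 (mulr_ge0 (ltW S0) (ltW d10)) bS.
  by rewrite -[X in _ < X -> _]powRrM [(1 - m) * _]mulrC thm powRr1.
rewrite well_energyE//; apply/negP; rewrite -leNgt.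
apply: le_trans Hd1; rewrite e0E /well_energy lerD2r -mulrA ler_wpM2l//.
Qed.

End potential_well_reals.

(** * The functional B: scaling, finiteness on limits *)

Lemma nneseries_term_le1 {R : realType} (f : (\bar R)^nat) :
  (forall k, 0 <= f k)%E -> (\sum_(0 <= k <oo) f k < +oo)%E ->
  \forall k \near \oo, (f k <= 1)%E.
Proof.
move=> f0 foo.
have T0 : (\sum_(N <= k <oo) f k)%E @[N --> \oo] --> (0 : \bar R).
  exact: (@nneseries_tail_cvg R f xpredT foo (fun k _ => f0 k)).
have : \forall N \near \oo, (\sum_(N <= k <oo) f k < 1)%E.
  have H : (0 < 1 :> \bar R)%E by rewrite lte01.
  exact: (T0 _ (open_ereal_lt' H)).
apply: filterS => N H; apply: ltW; apply: le_lt_trans H.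
have := @nneseries_lim_ge R f xpredT N N.+1 (fun n _ _ => f0 n).
by rewrite big_nat1.
Qed.

Lemma critical_exponent_gt1 {R : realType} N : (3 <= N)%N -> 1 < critical_exponent R N.
Proof.
move=> N3; rewrite /critical_exponent.
have N3' : (3 : R) <= N%:R by rewrite (ler_nat R 3 N).
by rewrite ltr_pdivlMr; lra.
Qed.

Section power_functional.
Context {R : realType} {N : nat}.
Variable Omega : set 'rV[R]_N.
Hypothesis oO : open Omega.
Hypothesis foO : (lebesgue_rV R N Omega < +oo)%E.
Hypothesis N3 : (3 <= N)%N.
Implicit Types (u v w phi : 'rV[R]_N -> R).
Local Notation mu := (lebesgue_rV R N).
Local Notation X := (H10 Omega).
Local Notation test := (test_function Omega).
Local Notation p := (critical_exponent R N).

Let mO : measurable Omega. Proof. exact: open_rV_measurable. Qed.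
Let p1 : 1 < p. Proof. exact: critical_exponent_gt1. Qed.
Let q0 : 0 < p + 1. Proof. by have := p1; lra. Qed.

Lemma measurable_norm_powR u (r : R) : measurable_fun Omega u ->
  measurable_fun Omega (fun x => `|u x| `^ r).
Proof.
move=> mu_; apply: (measurableT_comp (measurable_powR r)).
exact: (measurableT_comp _ mu_).
Qed.

Let mE u : measurable_fun Omega u -> measurable_fun Omega (fun x => (`|u x| `^ (p + 1))%:E).
Proof. by move=> mu_; apply/measurable_EFinP; exact: measurable_norm_powR. Qed.

Lemma funB_ge0 u : (0 <= funB Omega u)%E.
Proof. by apply: integral_ge0 => x _; rewrite lee_fin powR_ge0. Qed.

Lemma funB_scale (a : R) u : measurable_fun Omega u ->
  (funB Omega (fun x => (a * u x)%R) = (`|a| `^ (p + 1))%:E * funB Omega u)%E.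
Proof.
move=> mu_; rewrite /funB -ge0_integralZl//.
- by apply: eq_integral => x _; rewrite normrM powRM// EFinM.
- exact: mE.
Qed.

Lemma funB_add u v : measurable_fun Omega u -> measurable_fun Omega v ->
  (funB Omega (fun x => (u x + v x)%R) <=
   (2 `^ (p + 1))%:E * (funB Omega u + funB Omega v))%E.
Proof.
move=> mu_ mv.
have -> : (funB Omega u + funB Omega v =
    \int[mu]_(x in Omega) ((`|u x| `^ (p + 1))%:E + (`|v x| `^ (p + 1))%:E))%E.
  by rewrite /funB ge0_integralD//; exact: mE.
have mD : measurable_fun Omega
    (fun x => (`|u x| `^ (p + 1))%:E + (`|v x| `^ (p + 1))%:E)%E.
  by apply: emeasurable_funD; exact: mE.
rewrite -ge0_integralZl//; last by move=> x _; rewrite adde_ge0// lee_fin powR_ge0.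
apply: ge0_le_integral => //.
- by apply: mE; exact: measurable_funD.
- exact: emeasurable_funM.
move=> x _; rewrite -EFinD -EFinM lee_fin.
apply: le_trans (powRD_le (ltW q0) (normr_ge0 (u x)) (normr_ge0 (v x))).
by apply: le_powR => //; [exact: ltW|exact: ler_normD].
Qed.

Lemma funB_ae u v : measurable_fun Omega u -> measurable_fun Omega v ->
  {ae mu, forall x, Omega x -> u x = v x} -> funB Omega u = funB Omega v.
Proof.
move=> mu_ mv uv; apply: ae_eq_integral => //; [exact: mE|exact: mE|].
by apply: filterS uv => x H /H ->.
Qed.

Lemma funB_ae_zero u : measurable_fun Omega u -> ae_zero Omega u -> funB Omega u = 0%E.
Proof.
move=> mu_ u0; rewrite (@funB_ae _ (cst 0))//.
by rewrite /funB integral0_eq// => x _; rewrite normr0 powR0// gt_eqF.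
Qed.

Lemma funB_eq0 u : measurable_fun Omega u -> funB Omega u = 0%E -> ae_zero Omega u.
Proof.
move=> mu_ B0; have := @ae_eq_integral_abs _ _ _ mu Omega mO _ (mE mu_).
case=> + _; rewrite (_ : (\int[mu]_(x in Omega) _)%E = funB Omega u); last first.
  by apply: eq_integral => x _; rewrite gee0_abs// lee_fin powR_ge0.
move=> /(_ B0); apply: filterS => x H /H /= [].
by move=> /eqP; rewrite powR_eq0 normr_eq0 => /andP[/eqP].
Qed.

Lemma funB_test phi : test phi -> (funB Omega phi < +oo)%E.
Proof.
move=> tphi; have [M M0 MP] := test_bounded tphi.
apply: (@le_lt_trans _ _ (\int[mu]_(x in Omega) (cst (M `^ (p + 1))%:E x))%E).
  apply: ge0_le_integral => //.
  - by apply: mE; exact: test_measurable.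
  - by move=> x _; rewrite lee_fin; apply: le_powR => //; exact: ltW.
rewrite integral_cst// lte_mul_pinfty//; first by rewrite lee_fin powR_ge0.
Qed.

(** The squared L^2-distances d k are summable, so d k <= 1 for large k at almost
    every point.  There |u| <= |phi k| + 1, which bounds |u|^(p+1) by a lower limit of
    functions g k with bounded integrals, and Fatou's lemma applies. *)
Lemma funB_fin_limit u (phi : nat -> 'rV[R]_N -> R) (c : R) :
  inL2 Omega u -> (forall k, inL2 Omega (phi k)) ->
  (forall k, ip Omega (fun x => -1 * phi k x + u x) (fun x => -1 * phi k x + u x)
     <= 1 / (2 ^ k.+1)%:R) ->
  (forall k, funB Omega (phi k) <= c%:E)%E -> (funB Omega u < +oo)%E.
Proof.
move=> u2 phi2 dphi Bc.
have mu_ := u2.1; have mphi k := (phi2 k).1.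
pose d k x := ((-1 * phi k x + u x) ^+ 2)%:E.
have d0 k x : (0 <= d k x)%E by rewrite lee_fin sqr_ge0.
have d2 k : inL2 Omega (fun x => -1 * phi k x + u x) by exact: L2_lin.
have md k : measurable_fun Omega (d k).
  by apply/measurable_EFinP; apply: measurable_funX; have [] := d2 k.
have mS : measurable_fun Omega (fun x => \sum_(0 <= k <oo) d k x)%E.
  by apply: ge0_emeasurable_sum.
have iS : mu.-integrable Omega (fun x => \sum_(0 <= k <oo) d k x)%E.
  apply/integrableP; split => //.
  under eq_integral do rewrite gee0_abs ?nneseries_ge0//.
  rewrite integral_nneseries//.
  apply: (@le_lt_trans _ _ (\sum_(0 <= k <oo) (1 / (2 ^ k.+1)%:R)%:E)%E).
    by apply: lee_nneseries => // k _; rewrite ?integral_ge0// ip_sqrE// lee_fin.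
  by apply: le_lt_trans (@epsilon_trick0 R 1 xpredT ler01) _; rewrite ltry.
have near1 : {ae mu, forall x, Omega x -> \forall k \near \oo, (d k x <= 1)%E}.
  have := integrable_ae mO iS; apply: filterS => x H /H.
  by rewrite ge0_fin_numE ?nneseries_ge0//; exact: nneseries_term_le1.
pose g k x := ((2 `^ (p + 1) * (`|phi k x| `^ (p + 1) + 1))%:E : \bar R).
have g0 k x : (0 <= g k x)%E.
  by rewrite lee_fin mulr_ge0 ?powR_ge0// addr_ge0// powR_ge0.
have mg k : measurable_fun Omega (g k).
  apply/measurable_EFinP; apply: measurable_funM => //; apply: measurable_funD => //.
  exact: measurable_norm_powR.
pose K : \bar R := ((2 `^ (p + 1))%:E * (c%:E + mu Omega))%E.
have Koo : (K < +oo)%E.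
  by rewrite /K lte_mul_pinfty ?lee_fin ?powR_ge0// lte_add_pinfty// ltry.
apply: le_lt_trans Koo.
have mgi : measurable_fun Omega (fun x => limn_einf (g ^~ x)).
  rewrite /limn_einf; apply: measurableT_comp => //.
  by apply: measurable_fun_limn_esup => k; exact: measurableT_comp.
apply: (@le_trans _ _ (\int[mu]_(x in Omega) limn_einf (g ^~ x))%E).
  apply: ae_ge0_le_integral => //.
  - exact: mE.
  - move=> x _; rewrite limn_einf_lim; apply: lime_ge; first exact: is_cvg_einfs.
    by apply: nearW => n; apply: le_ereal_inf_tmp => _ [k _ <-].
  - apply: filterS near1 => x + Ox => /(_ Ox)[n _ nP].
    rewrite limn_einf_lim; apply: lime_ge; first exact: is_cvg_einfs.
    exists n => // j /= nj; apply: le_ereal_inf_tmp => _ [k /= jk <-].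
    have := nP k (leq_trans nj jk); rewrite /d /g !lee_fin => d1.
    have dk : `|-1 * phi k x + u x| <= 1.
      by rewrite -(@ler_pXn2r _ 2) ?nnegrE// real_normK ?num_real// expr1n.
    apply: (@le_trans _ _ ((`|phi k x| + 1) `^ (p + 1))).
      apply: le_powR => //; first exact: ltW.
      rewrite -[u x](addrNK (phi k x)) addrC (le_trans (ler_normD _ _))// lerD2l.
      by rewrite addrC -mulN1r.
    have := powRD_le (ltW q0) (normr_ge0 (phi k x)) ler01.
    by rewrite powR1.
apply: le_trans (fatou _ mO mg (fun k x _ => g0 k x)) _.
rewrite limn_einf_lim; apply: lime_le; first exact: is_cvg_einfs.
apply: nearW => n; apply: (@le_trans _ _ (\int[mu]_(x in Omega) g n x)%E).
  by apply: ereal_inf_lbound; exists n => /=.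
rewrite /g /K; under eq_integral do rewrite EFinM.
rewrite ge0_integralZl//; last first.
  by apply/measurable_EFinP; apply: measurable_funD => //; exact: measurable_norm_powR.
apply: lee_wpmul2l; first by rewrite lee_fin powR_ge0.
under eq_integral do rewrite EFinD.
rewrite ge0_integralD//; last exact: mE.
by rewrite integral_cst// mul1e leeD2r//; exact: Bc.
Qed.

Lemma normLE u : (normL Omega (p + 1) u `^ (p + 1) = funB Omega u)%E.
Proof.
rewrite /normL poweR_Lnorm ?gt_eqF// /funB [RHS]integral_mkcond.
apply: eq_integral => x _; rewrite /= !patchE; case: ifPn => // _.
by rewrite normr0 powR0// gt_eqF.
Qed.

Lemma fine_normL_sqr u : fine (normL Omega (p + 1) u) ^+ 2 =
  fine (funB Omega u) `^ (2 / (p + 1)).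
Proof.
rewrite -normLE fine_poweR -powRrM mulrCA divff ?gt_eqF// mulr1.
by rewrite powR_mulrn// fine_ge0// Lnorm_ge0.
Qed.

End power_functional.

(** * The Sobolev inequality and the initial datum *)

Lemma le_half_le0 {R : realFieldType} (b : R) : b <= b / 2 -> b <= 0.
Proof. lra. Qed.

Lemma parallelogram_bound {R : realFieldType} (x y z : R) :
  0 <= 1 ^+ 2 * x + 2 * 1 * y + z -> (-1) ^+ 2 * x + 2 * -1 * y + z <= 2 * x + 2 * z.
Proof. lra. Qed.

Lemma half_subr_gt0 {R : realFieldType} (a b i : R) : 0 < b -> b < a -> i < 2^-1 -> 
  0 < 2^-1 * a - i * b.
Proof. nra. Qed.

Section potential_well.
Context {R : realType} {N : nat}.
Variable Omega : set 'rV[R]_N.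
Hypothesis oO : open Omega.
Hypothesis foO : (lebesgue_rV R N Omega < +oo)%E.
Hypothesis N3 : (3 <= N)%N.
Implicit Types (u v w phi : 'rV[R]_N -> R).
Local Notation X := (H10 Omega).
Local Notation test := (test_function Omega).
Local Notation p := (critical_exponent R N).
Local Notation A := (dirichlet Omega).
Local Notation m := (2 / (p + 1)).
Local Notation th := (2 / (p - 1)).

Let p1 : 1 < p. Proof. exact: critical_exponent_gt1. Qed.
Let q0 : 0 < p + 1. Proof. by rewrite addr_gt0// (lt_trans ltr01). Qed.
Let two_lt : 2 < p + 1. Proof. by rewrite -ltrBlDr (_ : 2 - 1 = 1)//; ring. Qed.

Lemma H10_measurable w : X w -> measurable_fun Omega w.
Proof. by move=> /H10_L2[]. Qed.

Lemma funEE w (b : R) : X w -> funB Omega w = b%:E ->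
  funE Omega w = (2^-1 * A w w - (p + 1)^-1 * b)%:E.
Proof. by move=> Xw Bw; rewrite /funE (funAE oO Xw) Bw. Qed.

(** The multiple is t = (delta A(w) / B(w))^(1/(p-1)). *)
Lemma nehari_scaling w (b delta : R) : X w -> funB Omega w = b%:E -> 0 < A w w -> 0 < b ->
  0 < delta -> exists t : R,
  [/\ X (fun x => t * w x), 0 < A (fun x => t * w x) (fun x => t * w x),
     funB Omega (fun x => t * w x) = (delta * A (fun x => t * w x) (fun x => t * w x))%:E &
     funE Omega (fun x => t * w x) =
       (well_height p delta * (A w w / b `^ m) `^ (1 + th))%:E].
Proof.
move=> Xw Bw a0 b0 d0; set a := A w w in a0 *.
have dab : 0 < delta * (a / b) by rewrite mulr_gt0// divr_gt0.
pose t := (delta * (a / b)) `^ (p - 1)^-1; exists t.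
have t0 : 0 < t by exact: powR_gt0.
have pm : 0 < p - 1 by rewrite subr_gt0.
have Xt := H10_scale oO foO t Xw.
have At : A (fun x => t * w x) (fun x => t * w x) = t ^+ 2 * a by rewrite dirichlet_scale.
have t2 : t ^+ 2 = delta `^ th * (a / b) `^ th.
  rewrite -powR_mulrn ?powR_ge0// /t -powRrM -powRM ?(ltW d0) ?divr_ge0 ?(ltW a0) ?(ltW b0)//.
  by rewrite [_^-1 * _]mulrC.
have Bt : funB Omega (fun x => t * w x) = (delta * (t ^+ 2 * a))%:E.
  rewrite (funB_scale oO t (H10_measurable Xw)) Bw -EFinM; congr EFin.
  rewrite gtr0_norm// (_ : p + 1 = 2 + (p - 1)); last by ring.
  rewrite powRD_gt0// powR_mulrn ?(ltW t0)// -powRrM mulVf ?gt_eqF// powRr1 ?(ltW dab)//.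
  by field; rewrite gt_eqF.
split.
- exact: Xt.
- by rewrite At mulr_gt0// exprn_gt0.
- by rewrite Bt At.
- rewrite (funEE Xt Bt) At; congr EFin.
  rewrite -(well_scaleE p1)// /well_height t2.
  move: (delta `^ th) ((a / b) `^ th) => x y; ring.
Qed.

Lemma neharid_funE w delta : 0 < delta -> neharid Omega delta w ->
  exists2 b : R, [/\ X w, funB Omega w = b%:E, 0 < A w w & 0 < b] &
    funE Omega w = (well_height p delta * (A w w / b `^ m) `^ (1 + th))%:E.
Proof.
move=> d0 [Xw + A0]; rewrite /funDd (funAE oO Xw) => D0.
have a0 : 0 < A w w.
  rewrite lt_neqAle dirichlet_ge0 andbT eq_sym.
  by move: A0; rewrite (funAE oO Xw) eqe.
move: D0; rewrite -EFinM; case BE : (funB Omega w) => [b| |]//= [/eqP].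
rewrite subr_eq0 => /eqP bE; exists b; first by rewrite -bE mulr_gt0.
have b0 : 0 < b by rewrite -bE mulr_gt0.
rewrite (funEE Xw BE) -(well_scaleE p1)// -bE /well_height; congr EFin.
rewrite (_ : A w w / (delta * A w w) = delta^-1); last first.
  by field; rewrite !gt_eqF.
rewrite -[delta^-1]powR_inv1 ?(ltW d0)// -powRrM mulN1r powRN.
have dth : delta `^ th != 0 by rewrite gt_eqF// powR_gt0.
move: (delta `^ th) dth (A w w) => dt dt0 a.
by field; rewrite dt0/= gt_eqF.
Qed.

Variable u0 : 'rV[R]_N -> R.
Hypothesis Xu0 : X u0.
Hypothesis Eu0 : (funE Omega u0 < depth Omega)%E.
Hypothesis Du0 : (0 < funD Omega u0)%E.

Lemma initial_finite : exists b0 : R, [/\ funB Omega u0 = b0%:E, 0 < b0, b0 < A u0 u0 &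
  0 < 2^-1 * A u0 u0 - (p + 1)^-1 * b0].
Proof.
have := Du0; rewrite /funD (funAE oO Xu0).
have := funB_ge0 Omega u0; case BE : (funB Omega u0) => [b| |]//=.
rewrite lee_fin -EFinB lte_fin subr_gt0 => b0 ba; have bpos : 0 < b.
  rewrite lt_neqAle b0 andbT; apply/eqP => bE.
  have B0 : funB Omega u0 = 0%E by rewrite BE -bE.
  have := H10_ae0_dirichlet oO foO Xu0 (funB_eq0 oO (H10_measurable Xu0) B0).
  by move: ba; rewrite -bE => /[swap] ->; rewrite ltxx.
exists b; split => //; apply: half_subr_gt0 => //.
by rewrite ltf_pV2 ?posrE.
Qed.

Let e0 := fine (funE Omega u0).

Lemma initial_energy : funE Omega u0 = e0%:E /\ 0 < e0.
Proof.
have [b0 [B0 b00 ba E0]] := initial_finite.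
by rewrite /e0 (funEE Xu0 B0).
Qed.

(** The multiple of w on the Nehari set has energy at least the depth. *)
Lemma energy_gap w (b : R) : X w -> funB Omega w = b%:E -> 0 < A w w -> 0 < b ->
  e0 < well_height p 1 * (A w w / b `^ m) `^ (1 + th).
Proof.
move=> Xw Bw a0 b0; have [t [Xt At Bt Et]] := nehari_scaling Xw Bw a0 b0 ltr01.
have [E0 _] := initial_energy.
rewrite -lte_fin -E0 -Et; apply: (lt_le_trans Eu0); apply: ereal_inf_lbound.
exists (fun x => t * w x) => //; split => //.
- by rewrite /funD (funAE oO Xt) Bt mul1r subee.
- move=> z; have := funB_ae_zero oO N3 (H10_measurable Xt) z.
  by rewrite Bt mul1r => -[] /eqP; rewrite gt_eqF.
Qed.

Let kappa := (e0 / well_height p 1) `^ (1 - m).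

Lemma well_height1_gt0 : 0 < well_height p 1.
Proof.
by rewrite /well_height powR1 mulr1 mul1r subr_gt0 ltf_pV2 ?posrE.
Qed.

Lemma kappa_gt0 : 0 < kappa.
Proof.
have [_ e00] := initial_energy.
by rewrite powR_gt0// divr_gt0// well_height1_gt0.
Qed.

Lemma gap_sobolev_pos w (b : R) : X w -> funB Omega w = b%:E -> 0 < A w w -> 0 <= b ->
  kappa * b `^ m <= A w w.
Proof.
move=> Xw Bw a0; rewrite le_eqVlt => /predU1P[<-|b0].
  have [m0 _ _ _ _] := well_exponents p1.
  by rewrite powR0 ?gt_eqF// mulr0 ltW.
have [m0 m1 th0 _ thm] := well_exponents p1.
have [_ e00] := initial_energy.
have := energy_gap Xw Bw a0 b0; rewrite -ltr_pdivrMl ?well_height1_gt0// => H.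
have c0 : 0 <= (well_height p 1)^-1 * e0.
  by rewrite ltW// mulr_gt0// invr_gt0 well_height1_gt0.
have m1' : 0 < 1 - m by rewrite subr_gt0.
have := lt_powR m1' c0 H; rewrite -powRrM thm powRr1; last first.
  by rewrite divr_ge0 ?powR_ge0 ?(ltW a0).
rewrite mulrC -/kappa => H'; apply: ltW.
by rewrite -ltr_pdivlMr ?powR_gt0.
Qed.

(** Only A(w) = 0 is new, and then B(w) must vanish.  The inequality applies to
    s u0 + w, whose Dirichlet integral is s^2 A(u0): the cross term A(u0, w) is 0.
    Hence B(s u0 + w) = O(s^(p+1)), so B(w) = O(s^(p+1)) for every s > 0. *)
Lemma gap_sobolev_fin w (b : R) : X w -> funB Omega w = b%:E ->
  kappa * b `^ m <= A w w.
Proof.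
move=> Xw Bw; have b0 : 0 <= b by have := funB_ge0 Omega w; rewrite Bw lee_fin.
have [a0|] := ltP 0 (A w w); first exact: gap_sobolev_pos.
move=> aL; have aE : A w w = 0 by apply/eqP; rewrite eq_le aL dirichlet_ge0.
have [m0 m1 th0 _ thm] := well_exponents p1.
suff -> : b = 0 by rewrite powR0 ?gt_eqF// mulr0 dirichlet_ge0.
have [c [Bu0 c0 ca _]] := initial_finite.
set a := A u0 u0 in ca; have a0 : 0 < a by exact: lt_trans ca.
have G0 : A u0 w = 0.
  apply/eqP/negP => /negP G0; have G0' : 0 < `|A u0 w| by rewrite normr_gt0.
  have e0' : 0 < `|A u0 w| / a by rewrite divr_gt0.
  have := dirichlet_young oO e0' Xu0 Xw; rewrite aE mulr0 addr0 -/a divfK ?gt_eqF//.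
  by rewrite mulrC => /le_half_le0; rewrite leNgt G0'.
pose C := 2 `^ (p + 1) * (c + (a / kappa) `^ ((p + 1) / 2)).
have C0 : 0 < C by rewrite mulr_gt0 ?powR_gt0// ltr_wpDr ?powR_ge0.
have bC (s : R) : 0 < s -> b <= C * s `^ (p + 1).
  move=> s0; have Xs := H10_lin oO foO s Xu0 Xw.
  have As : A (fun x => s * u0 x + w x) (fun x => s * u0 x + w x) = s ^+ 2 * a.
    by rewrite (dirichlet_lin2 oO foO s Xu0 Xw) G0 aE mulr0 !addr0.
  have mu0 := H10_measurable Xu0; have mw := H10_measurable Xw.
  have Xsu := H10_scale oO foO s Xu0.
  have Bs := funB_add oO N3 (H10_measurable Xsu) mw.
  rewrite (funB_scale oO s mu0) Bu0 Bw -EFinM in Bs.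
  have [bs BsE] : exists bs, funB Omega (fun x => s * u0 x + w x) = bs%:E.
    move: Bs (funB_ge0 Omega (fun x => s * u0 x + w x)).
    by case: (funB _ _) => [bs _ _| |]//; exists bs.
  have bs0 : 0 <= bs by have := funB_ge0 Omega (fun x => s * u0 x + w x); rewrite BsE lee_fin.
  have As0 : 0 < A (fun x => s * u0 x + w x) (fun x => s * u0 x + w x).
    by rewrite As mulr_gt0// exprn_gt0.
  have := gap_sobolev_pos Xs BsE As0 bs0; rewrite As mulrC -ler_pdivlMr ?kappa_gt0// => H.
  have q2 : 0 <= (p + 1) / 2 by rewrite divr_ge0// ltW.
  have := le_powR q2 (powR_ge0 _ _) H.
  rewrite -powRrM (_ : m * ((p + 1) / 2) = 1); last by field; rewrite gt_eqF.
  rewrite powRr1// -mulrA powRM ?sqr_ge0 ?divr_ge0 ?(ltW a0) ?(ltW kappa_gt0)//.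
  rewrite -[s ^+ 2]powR_mulrn ?(ltW s0)// -powRrM.
  rewrite (_ : 2 * ((p + 1) / 2) = p + 1); last by field.
  move=> bsC.
  have Xms := H10_scale oO foO (- s) Xu0.
  have := funB_add oO N3 (H10_measurable Xms) (H10_measurable Xs).
  rewrite (_ : (fun x => _) = w); last by apply/funext => x; ring.
  rewrite (funB_scale oO (- s) mu0) Bu0 Bw BsE -EFinM lee_fin normrN.
  rewrite (gtr0_norm s0) => /le_trans; apply.
  rewrite /C -mulrA ler_wpM2l ?powR_ge0// mulrDl [_ * c]mulrC lerD2l.
  by rewrite mulrC.
apply/eqP; rewrite eq_le b0 andbT leNgt; apply/negP => b00.
have s0 : 0 < b / (2 * C) by rewrite divr_gt0// mulr_gt0.
have := bC _ (powR_gt0 (p + 1)^-1 s0).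
rewrite -powRrM mulVf ?gt_eqF// powRr1 ?(ltW s0)//.
rewrite (_ : C * (b / (2 * C)) = b / 2); last by field; rewrite gt_eqF.
by move=> /le_half_le0; rewrite leNgt b00.
Qed.

Lemma dirichlet_approx_bound w phi : X w -> test phi ->
  gdist Omega w (grad Omega w) phi < 1 -> A phi phi <= 2 * A w w + 2.
Proof.
move=> Xw tphi g1; have Xp := H10_test oO foO tphi.
have Xd := H10_lin oO foO (-1) Xp Xw.
have := le_lt_trans (gdist_dirichlet oO foO Xw tphi) g1.
set d := (fun x => _) => Ad.
have -> : phi = (fun x => -1 * d x + w x) by apply/funext => x; rewrite /d; ring.
rewrite (dirichlet_lin2 oO foO (-1) Xd Xw).
have := dirichlet_ge0 Omega (fun x => 1 * d x + w x).
rewrite (dirichlet_lin2 oO foO 1 Xd Xw) => /parallelogram_bound /le_trans; apply.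
by move: (A d d) (A w w) Ad => x y; lra.
Qed.

Lemma H10_funB_fin w : X w -> exists b, funB Omega w = b%:E.
Proof.
move=> Xw; suff : (funB Omega w < +oo)%E.
  by have := funB_ge0 Omega w; case: (funB _ _) => [b _ _| |]//; exists b.
have ek k : (0 : R) < 1 / (2 ^ k.+1)%:R by rewrite divr_gt0// ltr0n expn_gt0.
have /choice[phi phiP] : forall k : nat, exists phi, test phi /\
    gdist Omega w (grad Omega w) phi < 1 / (2 ^ k.+1)%:R.
  by move=> k; have [phi] := H10_approx oO foO Xw (ek k); exists phi.
apply: (@funB_fin_limit _ _ _ oO foO N3 _ phi (((2 * A w w + 2) / kappa) `^ ((p + 1) / 2))).
- exact: H10_L2.
- by move=> k; apply: L2_test => //; have [] := phiP k.
- move=> k; have [tphi /ltW] := phiP k; apply: le_trans.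
  by rewrite /gdist lerDl sumr_ge0// => i _; exact: ip_ge0.
- move=> k; have [tphi gk] := phiP k; have Xp := H10_test oO foO tphi.
  have := funB_test oO foO N3 tphi; have := funB_ge0 Omega (phi k).
  case BE : (funB _ _) => [b| |]//; rewrite !lee_fin => b0 _.
  have := gap_sobolev_fin Xp BE; rewrite mulrC -ler_pdivlMr ?kappa_gt0// => H.
  have q2 : 0 <= (p + 1) / 2 by rewrite divr_ge0// ltW.
  have := le_powR q2 (powR_ge0 _ _) H.
  rewrite -powRrM (_ : m * ((p + 1) / 2) = 1); last by field; rewrite gt_eqF.
  rewrite powRr1// => /le_trans; apply; apply: le_powR => //.
    by rewrite divr_ge0 ?dirichlet_ge0// ltW// kappa_gt0.
  rewrite ler_pM2r ?invr_gt0 ?kappa_gt0//; apply: dirichlet_approx_bound => //.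
  apply: lt_le_trans gk _; rewrite ler_pdivrMr ?ltr0n ?expn_gt0// mul1r.
  by rewrite ler1n expn_gt0.
Qed.

Lemma sobolev_ratioE w : X w ->
  fine (funA Omega w) / fine (normL Omega (p + 1) w) ^+ 2 =
  A w w / fine (funB Omega w) `^ m.
Proof. by move=> Xw; rewrite (funAE oO Xw)/= fine_normL_sqr. Qed.

Lemma sobolev_pos_b w (b : R) : X w -> ~ ae_zero Omega w -> funB Omega w = b%:E -> 0 < b.
Proof.
move=> Xw w0 Bw; have := funB_ge0 Omega w; rewrite Bw lee_fin lt_neqAle => ->.
rewrite andbT; apply/eqP => bE; apply: w0; apply: funB_eq0 => //.
  exact: H10_measurable.
by rewrite Bw -bE.
Qed.

Let u0n0 : ~ ae_zero Omega u0.
Proof.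
move=> z; have [b0 [Bu0 b00 _ _]] := initial_finite.
have := funB_ae_zero oO N3 (H10_measurable Xu0) z; rewrite Bu0 => -[] /eqP.
by rewrite gt_eqF.
Qed.

Lemma sobolev_lb (x : R) :
  (forall w b, X w -> funB Omega w = b%:E -> 0 < b -> x <= A w w / b `^ m) ->
  x <= sobolev Omega.
Proof.
move=> H; apply: lb_le_inf.
  by exists (fine (funA Omega u0) / fine (normL Omega (p + 1) u0) ^+ 2); exists u0.
move=> _ [w [Xw w0] <-]; rewrite sobolev_ratioE//.
have [b Bw] := H10_funB_fin Xw; rewrite Bw.
exact/(H w)/(sobolev_pos_b Xw w0 Bw).
Qed.

Lemma sobolev_ineq w b : X w -> funB Omega w = b%:E -> sobolev Omega * b `^ m <= A w w.
Proof.
move=> Xw Bw; have [m0 _ _ _ _] := well_exponents p1.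
have [z|w0] := pselect (ae_zero Omega w).
  have := funB_ae_zero oO N3 (H10_measurable Xw) z; rewrite Bw => -[->].
  by rewrite powR0 ?gt_eqF// mulr0 dirichlet_ge0.
have b0 := sobolev_pos_b Xw w0 Bw.
rewrite -ler_pdivlMr ?powR_gt0//; apply: ge_inf.
  exists 0 => _ [v [Xv _] <-]; rewrite sobolev_ratioE//.
  by rewrite divr_ge0 ?dirichlet_ge0 ?powR_ge0.
by exists w => //; rewrite sobolev_ratioE// Bw.
Qed.

Lemma sobolev_gt0 : 0 < sobolev Omega.
Proof.
apply: (lt_le_trans kappa_gt0); apply: sobolev_lb => w b Xw Bw b0.
by rewrite ler_pdivlMr ?powR_gt0//; exact: gap_sobolev_fin.
Qed.

(** A bound that holds for all quotients A(w) / B(w)^m holds for their infimum S. *)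
Lemma well_upper (h : R) :
  (forall w b, X w -> funB Omega w = b%:E -> 0 < A w w -> 0 < b ->
     e0 <= h * (A w w / b `^ m) `^ (1 + th)) ->
  e0 <= sobolev Omega `^ (1 + th) * h.
Proof.
move=> H; have [_ e00] := initial_energy.
have [m0 m1 th0 _ thm] := well_exponents p1.
have [b0 [Bu0 b00 ba _]] := initial_finite.
have h0 : 0 < h.
  have a0 : 0 < A u0 u0 by exact: lt_trans ba.
  have := lt_le_trans e00 (H u0 b0 Xu0 Bu0 a0 b00).
  by rewrite pmulr_lgt0// powR_gt0// divr_gt0// powR_gt0.
have m1' : 0 <= 1 - m by rewrite subr_ge0 ltW.
have eh0 : 0 <= e0 / h by rewrite divr_ge0// ltW.
have key : (e0 / h) `^ (1 - m) <= sobolev Omega.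
  apply: sobolev_lb => w b Xw Bw bp.
  have a0 : 0 < A w w.
    by apply: lt_le_trans (gap_sobolev_fin Xw Bw); rewrite mulr_gt0 ?kappa_gt0 ?powR_gt0.
  have H1 : e0 / h <= (A w w / b `^ m) `^ (1 + th).
    by rewrite ler_pdivrMr// [leRHS]mulrC; exact: H.
  have := le_powR m1' eh0 H1; rewrite -powRrM thm powRr1; last first.
    by rewrite divr_ge0 ?powR_ge0 ?(ltW a0).
  by [].
have th1 : 0 <= 1 + th by rewrite addr_ge0// ltW.
have := le_powR th1 (powR_ge0 _ _) key.
by rewrite -powRrM [(1 - m) * _]mulrC thm powRr1// ler_pdivrMr.
Qed.

Lemma initial_well delta1 delta2 : 0 < delta1 -> delta1 < delta2 ->
  depthd Omega delta1 = funE Omega u0 -> depthd Omega delta2 = funE Omega u0 ->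
  delta1 < 1 /\ fine (funB Omega u0) `^ (1 - m) <= sobolev Omega * delta1.
Proof.
move=> d10 d12 Ed1 Ed2; have d20 : 0 < delta2 by exact: lt_trans d12.
have [Ee0 e00] := initial_energy.
have [b0 [Bu0 b00 ba _]] := initial_finite.
rewrite Bu0 /=.
have up delta : 0 < delta -> depthd Omega delta = funE Omega u0 ->
    e0 <= sobolev Omega `^ (1 + th) * well_height p delta.
  move=> d0 Ed; apply: well_upper => w b Xw Bw a0 bp.
  have [t [Xt At Bt Et]] := nehari_scaling Xw Bw a0 bp d0.
  rewrite -lee_fin -Et -Ee0 -Ed; apply: ereal_inf_lbound.
  exists (fun x => t * w x); last by [].
  split; first exact: Xt.
    by rewrite /funDd (funAE oO Xt) Bt -EFinM subee.
  by rewrite (funAE oO Xt) eqe gt_eqF.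
apply: (@well_initial _ p p1 (sobolev Omega) delta1 delta2 e0 (A u0 u0) b0) => //.
- exact: sobolev_gt0.
- exact: ltW.
- have := Ee0; rewrite (funEE Xu0 Bu0) => -[<-].
  by rewrite [b0 / _]mulrC.
- exact: sobolev_ineq.
- apply: well_upper => w b Xw Bw a0 bp; apply: ltW; exact: energy_gap.
- exact: up.
- exact: up.
- move=> h0; rewrite -lee_fin -Ee0 -Ed1; apply: le_ereal_inf_tmp => _ [w Nw <-].
  have [b [Xw Bw a0 bp] ->] := neharid_funE d10 Nw.
  rewrite lee_fin mulrC ler_wpM2l//; apply: le_powR.
  + by have [_ _ th0 _ _] := well_exponents p1; rewrite addr_ge0// ltW.
  + exact/ltW/sobolev_gt0.
  + by rewrite (ler_pdivlMr _ _ (powR_gt0 _ bp)); exact: (sobolev_ineq Xw Bw).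
Qed.

End potential_well.

(** * Time integrals: comparison and cut-offs *)

Section integral_comparison.
Context {d} {U : measurableType d} {R : realType}.
Variable mu : {measure set U -> \bar R}.
Variable D : set U.
Hypothesis mD : measurable D.

Lemma le_integral_any (f g : U -> \bar R) : (forall x, D x -> (f x <= g x)%E) ->
  (\int[mu]_(x in D) f x <= \int[mu]_(x in D) g x)%E.
Proof.
move=> fg; rewrite /integral; apply: leeB; apply: ereal_sup_le => _ [h hf <-];
  exists h => // x; apply: le_trans (hf x) _.
- by rewrite funepos.unlock /patch; case: ifP => // /set_mem/fg fgx; by rewrite ge_max !le_max fgx lexx orbT.
- rewrite funeneg.unlock /patch; case: ifP => // /set_mem/fg fgx.
  by rewrite ge_max !le_max leeN2 fgx lexx orbT.
Qed.

(** The integral of an arbitrary function is the difference of the suprema over the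
    simple functions below its positive and negative parts, so it is monotone for
    everywhere valid inequalities.  An inequality valid almost everywhere becomes valid
    everywhere once the bound is set to an infinite value on a null set, which does
    not change the integral of the measurable bound.  The function f will be a spatial
    pairing of u(t) with a fixed function, times a cut-off in time. *)
Lemma Rintegral_ae_between (f g h : U -> R) :
  mu.-integrable D (EFin \o g) -> mu.-integrable D (EFin \o h) ->
  {ae mu, forall x, D x -> h x <= f x <= g x} ->
  \int[mu]_(x in D) h x <= \int[mu]_(x in D) f x <= \int[mu]_(x in D) g x.
Proof.
move=> ig ih [N0 [mN N00 hN]].
have out x : ~ N0 x -> D x -> h x <= f x <= g x.
  by move=> Nx; apply: contrapT => H; apply/Nx/hN.
have fixed (k : U -> R) (c : \bar R) : mu.-integrable D (EFin \o k) ->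
    (\int[mu]_(x in D) (if x \in N0 then c else (k x)%:E) = \int[mu]_(x in D) (k x)%:E)%E.
  move=> ik; have mk := measurable_int _ ik.
  apply: ae_eq_integral => //.
  - apply: (@measurable_fun_if _ _ U (\bar R) (fun=> c) (EFin \o k) D mD (fun x => x \in N0)) => //.
    + by apply: (@measurable_fun_bool _ _ _ _ true); rewrite preimage_mem_true; exact: measurableI.
    + apply: measurable_funS mk => //; exact: subIsetl.
  - exists N0; split => // x /= H; apply: contrapT => Nx; apply: H => _.
    by rewrite memNset.
have fing k : mu.-integrable D (EFin \o k) -> ((\int[mu]_(x in D) (k x)%:E)%E \is a fin_num).
  by move=> ik; exact: integrable_fin_num ik.
have up : (\int[mu]_(x in D) (f x)%:E <= \int[mu]_(x in D) (g x)%:E)%E.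
  rewrite -(fixed g +oo%E ig); apply: le_integral_any => x Dx; case: ifPn => [_|].
    by rewrite leey.
  by move/negP; rewrite inE => Nx; rewrite lee_fin; have /andP[] := out x Nx Dx.
have lo : (\int[mu]_(x in D) (h x)%:E <= \int[mu]_(x in D) (f x)%:E)%E.
  rewrite -(fixed h -oo%E ih); apply: le_integral_any => x Dx; case: ifPn => [_|].
    by rewrite leNye.
  by move/negP; rewrite inE => Nx; rewrite lee_fin; have /andP[] := out x Nx Dx.
have ff : (\int[mu]_(x in D) (f x)%:E)%E \is a fin_num.
  have := fing _ ig; have := fing _ ih; move: lo up.
  rewrite !fin_numE; case: (\int[mu]_(x in D) (f x)%:E)%E => [r| |] //=.
    by rewrite leye_eq => _ /eqP -> //.
  by rewrite leeNy_eq => /eqP -> //.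
by apply/andP; split; rewrite fine_le// fing.
Qed.

End integral_comparison.

Section time_cutoff.
Context {R : realType}.
Local Notation leb := (@lebesgue_measure R).
Implicit Types (f : R -> R) (a b s t k x : R).

Lemma smooth1_cont_derive1 f : smooth1 f -> continuous (derive1 f).
Proof. by move=> /smooth1_derive1/smooth1_continuous. Qed.

Definition rise (k s x : R) : R := smooth_step (k * x - k * s).

Lemma rise_smooth k s : smooth1 (rise k s).
Proof.
exact: (@smooth1_affine _ _ k (- (k * s)) smooth1_step).
Qed.

Lemma rise_le0 k s x : 0 < k -> x <= s -> rise k s x = 0.
Proof. by move=> k0 xs; rewrite /rise smooth_step_le0// subr_le0 ler_pM2l. Qed.

Lemma rise_ge1 k s x : 0 < k -> s + k^-1 <= x -> rise k s x = 1.
Proof.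
move=> k0 sx; rewrite /rise smooth_step_ge1// -mulrBr mulrC -ler_pdivrMr//.
by rewrite mul1r lerBrDl.
Qed.

Lemma rise_derive1_ge0 k s x : 0 < k -> 0 <= derive1 (rise k s) x.
Proof.
move=> k0; apply: nondecreasing_derive1_ge0; last exact/smooth1_derivable/rise_smooth.
by move=> y z yz; apply: smooth_step_homo; rewrite lerD2r ler_pM2l.
Qed.

Lemma derive1_local_cst f (c : R) x : (\forall y \near x, f y = c) -> derive1 f x = 0.
Proof.
move=> fc; by rewrite derive1E (@near_eq_derive _ _ _ _ (cst c)) ?derive_cst//.
Qed.

Lemma rise_derive1_out k s x : 0 < k -> ~ (s <= x <= s + k^-1) -> derive1 (rise k s) x = 0.
Proof.
move=> k0 /negP; rewrite negb_and -!ltNge => /orP[xs|sx].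
  apply: (@derive1_local_cst _ 0).
  by apply: filterS (lt_nbhsl xs) => y ys; exact/rise_le0/ltW.
apply: (@derive1_local_cst _ 1).
by apply: filterS (lt_nbhsr sx) => y sy; exact/rise_ge1/ltW.
Qed.

Lemma integral_rise (D : set R) k s : 0 < k -> measurable D ->
  `[s, s + k^-1] `<=` D ->
  (\int[leb]_(x in D) (derive1 (rise k s) x)%:E = 1)%E.
Proof.
move=> k0 mD sD.
have cr := smooth1_continuous (@rise_smooth k s).
transitivity (\int[leb]_(x in `[s, (s + k^-1)%R]) (derive1 (rise k s) x)%:E)%E.
  rewrite [LHS]integral_mkcond [RHS]integral_mkcond; apply: eq_integral => x _.
  rewrite !patchE; case: ifPn => xD; case: ifPn => // xs.
    move: xs; rewrite notin_setE /= in_itv/= => xs.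
    by rewrite rise_derive1_out.
  by move: xD; rewrite notin_setE => -[]; apply: sD; exact: set_mem.
rewrite (@continuous_FTC2 R (derive1 (rise k s)) (rise k s) s (s + k^-1)).
- by rewrite (rise_le0 k0 (lexx _)) (rise_ge1 k0 (lexx _)) sube0.
- by rewrite ltrDl invr_gt0.
- exact/continuous_subspaceT/smooth1_cont_derive1/rise_smooth.
- split; first by move=> x _; exact/smooth1_derivable/rise_smooth.
    by apply: cvg_at_right_filter; exact: cr.
  by apply: cvg_at_left_filter; exact: cr.
- by [].
Qed.

(** A smooth version of the indicator of [s, t]: it rises on [s, s + 1/k] and falls
    on [t, t + 1/k], with derivative an approximate Dirac mass at s minus one at t. *)
Definition trapezoid k s t x : R := rise k s x - rise k t x.

Lemma trapezoid_smooth k s t : smooth1 (trapezoid k s t).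
Proof.
rewrite /trapezoid (_ : (fun x => _) = rise k s \+ (cst (-1) \* rise k t)).
  apply: smooth1D; first exact: rise_smooth.
  by apply: smooth1M; [exact: smooth1_cst|exact: rise_smooth].
by apply/funext => x /=; rewrite mulN1r.
Qed.

Lemma trapezoid_derive1 k s t x :
  derive1 (trapezoid k s t) x = derive1 (rise k s) x - derive1 (rise k t) x.
Proof.
rewrite !derive1E; apply: deriveB; exact/smooth1_derivable/rise_smooth.
Qed.

Lemma trapezoid_bounds k s t x : 0 < k -> s <= t ->
  (s + k^-1 <= x <= t)%R%:R <= trapezoid k s t x <= (s <= x <= t + k^-1)%R%:R.
Proof.
move=> k0 st; have le01 a : 0 <= rise k a x <= 1.
  by rewrite smooth_step_ge0 smooth_step_le1.
have /andP[s0 s1] := le01 s; have /andP[t0 t1] := le01 t.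
have ts : rise k t x <= rise k s x.
  by apply: smooth_step_homo; rewrite lerD2l lerN2 ler_pM2l.
rewrite /trapezoid; apply/andP; split.
  case: (boolP (s + k^-1 <= x <= t)) => [/andP[sx xt]|_]; last by rewrite subr_ge0.
  by rewrite (rise_ge1 k0 sx) (rise_le0 k0 xt) subr0.
case: (boolP (s <= x <= t + k^-1)) => [_|].
  by rewrite lerBlDr ler_wpDr.
rewrite negb_and -!ltNge => /orP[xs|tx].
  by rewrite (rise_le0 k0 (ltW xs)) (rise_le0 k0 (le_trans (ltW xs) st)) subrr.
have sx : s + k^-1 <= x by rewrite (le_trans _ (ltW tx))// lerD2r.
by rewrite (rise_ge1 k0 (ltW tx)) (rise_ge1 k0 sx) subrr.
Qed.

End time_cutoff.

(** * Increments from a weak equation in time *)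

Lemma increment_bound {R : realFieldType} (Y Z1 Z2 l1 l2 ys yt e1 e2 : R) :
  Y <= ys - yt -> l1 <= Z1 -> Z2 <= l2 -> - Y + Z1 = Z2 -> e2 <= e1 ->
  yt - ys <= l2 - l1 - e2 + e1.
Proof. lra. Qed.

Lemma time_margin {R : realFieldType} (T : \bar R) (t : R) : (t%:E < T)%E ->
  exists2 h, 0 < h & ((t + h)%:E < T)%E.
Proof.
case: T => [T'| |]//; last by exists 1; rewrite ?ltr01 ?ltry.
by rewrite lte_fin => tT; exists ((T' - t) / 2); rewrite ?lte_fin; lra.
Qed.

Section weak_increment.
Context {R : realType}.
Local Notation leb := (@lebesgue_measure R).
Implicit Types (f : R -> R) (a b s t k x : R).

Lemma interval_indicator (D : set (measurableTypeR R)) a b : measurable D -> a <= b -> `[a, b] `<=` D ->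
  leb.-integrable D (fun x => ((a <= x <= b)%R%:R : R)%:E) /\
  \int[leb]_(x in D) ((a <= x <= b)%R%:R : R) = b - a.
Proof.
move=> mD ab abD.
have E x : ((a <= x <= b)%R%:R : R)%:E = ((\1_(`[a, b]%classic : set R) x : R)%:E).
  by rewrite indicE mem_setE in_itv.
have H : (\int[leb]_(x in D) ((a <= x <= b)%R%:R : R)%:E = (b - a)%:E)%E.
  under eq_integral do rewrite E.
  rewrite integral_indic//= (_ : _ `&` _ = `[a, b]%classic); last first.
    by apply/setIidl.
  by rewrite lebesgue_measure_itv/= lte_fin; move: ab; rewrite le_eqVlt => /predU1P[->|->]; rewrite ?ltxx ?subrr// EFinB.
split; last by rewrite /Rintegral H.
apply/integrableP; split.
  by under eq_fun do rewrite E; apply/measurable_EFinP; exact: measurable_indic.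
by under eq_integral do rewrite abse_EFin normr_nat; rewrite H ltry.
Qed.

Lemma continuous_measurable (D : set (measurableTypeR R)) f : continuous f -> measurable D ->
  measurable_fun D (EFin \o f).
Proof.
by move=> cf mD; apply/measurable_EFinP/measurable_funTS; exact: continuous_measurable_fun.
Qed.

Lemma rise_integrable (D : set (measurableTypeR R)) k s : 0 < k -> measurable D -> `[s, s + k^-1] `<=` D ->
  leb.-integrable D (EFin \o derive1 (rise k s)) /\
  \int[leb]_(x in D) derive1 (rise k s) x = 1.
Proof.
move=> k0 mD sD; have H := integral_rise k0 mD sD; split; last by rewrite /Rintegral H.
apply/integrableP; split.
  by apply: continuous_measurable => //; apply: smooth1_cont_derive1; exact: rise_smooth.
under eq_integral do rewrite /= ger0_norm ?rise_derive1_ge0//.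
by rewrite H ltry.
Qed.

Variable T : \bar R.
Let I : set R := [set t | 0 < t /\ (t%:E < T)%E].

Lemma measurable_time : measurable (I : set (measurableTypeR R)).
Proof.
rewrite (_ : I = `]0, +oo[%classic `&` [set x : R | (x%:E < T)%E]).
  by apply: measurableI => //; rewrite -[X in measurable X]setTI;
    apply: emeasurable_fun_infty_o.
by apply/seteqP; split => x /=; rewrite in_itv/= andbT.
Qed.

Lemma time_segment a b : 0 < a -> (b%:E < T)%E -> `[a, b] `<=` I.
Proof.
move=> a0 bT x /=; rewrite in_itv/= => /andP[ax xb]; split.
  exact: lt_le_trans ax.
by apply: le_lt_trans bT; rewrite lee_fin.
Qed.

Lemma trapezoid_test k s t : 0 < k -> 0 < s -> s <= t -> ((t + k^-1)%:E < T)%E ->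
  time_test_function T (trapezoid k s t).
Proof.
move=> k0 s0 st tT; split; first exact: trapezoid_smooth.
exists s, (t + k^-1); split => // x /negP/negbTE xst.
have /andP[lo up] := trapezoid_bounds x k0 st.
by apply/eqP; rewrite eq_le (le_trans _ lo)// (le_trans up)// xst.
Qed.

Lemma trapezoid_integral k s t : 0 < k -> 0 < s -> s + k^-1 <= t -> ((t + k^-1)%:E < T)%E ->
  leb.-integrable I (EFin \o trapezoid k s t) /\
  `|\int[leb]_(x in I) trapezoid k s t x - (t - s)| <= k^-1.
Proof.
move=> k0 s0 st tT; have mI := measurable_time.
have kv : 0 < k^-1 by rewrite invr_gt0.
have st' : s <= t by rewrite (le_trans _ st)// lerDl ltW.
have tT' : (t%:E < T)%E by apply: le_lt_trans tT; rewrite lee_fin lerDl ltW.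
have [i1 I1] := @interval_indicator I s (t + k^-1) mI (le_trans st' (ltW (ltr_pwDr kv (lexx t)))) (time_segment s0 tT).
have [i2 I2] := @interval_indicator I (s + k^-1) t mI st (time_segment (addr_gt0 s0 kv) tT').
have it : leb.-integrable I (EFin \o trapezoid k s t).
  apply: le_integrable i1 => //.
    by apply: continuous_measurable => //; apply: smooth1_continuous; exact: trapezoid_smooth.
  move=> x _ /=; have /andP[lo up] := trapezoid_bounds x k0 st'.
  by rewrite lee_fin ger0_norm ?(le_trans _ lo)// ger0_norm.
split => //.
have /andP[] : \int[leb]_(x in I) ((s + k^-1 <= x <= t)%R%:R : R) <=
    \int[leb]_(x in I) trapezoid k s t x <=
    \int[leb]_(x in I) ((s <= x <= t + k^-1)%R%:R : R).
  by apply/andP; split; apply: le_Rintegral => // x _;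
    have /andP[] := trapezoid_bounds x k0 st'.
rewrite I1 I2 => lo up; rewrite ler_distl; apply/andP; split; [move: lo|move: up];
  move: (Rintegral _ _ _) => z; lra.
Qed.

(** With eta a trapezoid of ramp length r, the first integral is at most ys - yt, as
    each ramp has a derivative of integral 1 and sees y only on [s, s + r], where
    y <= ys, or on [t, t + r], where y >= yt.  The other two integrals are bounded
    by c1 and c2 times the integral of eta, which differs from t - s by at most r. *)
Lemma weak_increment (y z1 z2 : R -> R) (K ys yt c1 c2 s t h : R) :
  (forall eta, time_test_function T eta ->
    - (\int[leb]_(x in I) (derive1 eta x * y x)) + \int[leb]_(x in I) (eta x * z1 x) =
    \int[leb]_(x in I) (eta x * z2 x)) ->
  {ae leb, forall x, I x -> [/\ `|y x| <= K, `|z1 x| <= K & `|z2 x| <= K]} ->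
  0 < s -> s < t -> (t%:E < T)%E -> 0 < h ->
  {ae leb, forall x, I x -> [/\ s <= x <= s + h -> y x <= ys,
     t <= x <= t + h -> yt <= y x & s <= x <= t + h -> c1 <= z1 x /\ z2 x <= c2]} ->
  yt - ys <= (c2 - c1) * (t - s).
Proof.
move=> Heq HK s0 st tT h0 Hb; have mI := measurable_time.
have HKb := @filterI _ _ (ae_filter_ringOfSetsType leb) _ _ HK Hb.
have [h' h'0 h'T] := time_margin tT.
pose r0 := Num.min (Num.min h h') (t - s).
have r00 : 0 < r0 by rewrite !lt_min h0 h'0 subr_gt0.
suff key r : 0 < r -> r <= r0 -> yt - ys <= (c2 - c1) * (t - s) + `|c2 - c1| * r.
  apply/ler_addgt0Pr => e e0.
  pose r := Num.min r0 (e / (`|c2 - c1| + 1)).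
  have c0 : 0 < `|c2 - c1| + 1 by rewrite ltr_wpDl.
  have r_0 : 0 < r by rewrite lt_min r00 divr_gt0.
  apply: le_trans (key r r_0 _) _; first by rewrite ge_min lexx.
  rewrite lerD2l; apply: (@le_trans _ _ ((`|c2 - c1| + 1) * r)).
    by rewrite ler_pM2r// lerDl.
  by rewrite mulrC -ler_pdivlMr// ge_min lexx orbT.
move=> r_0; rewrite !le_min => /andP[/andP[rh rh'] rts].
have k0 : 0 < r^-1 by rewrite invr_gt0.
have kV : r^-1^-1 = r by rewrite invrK.
have tr : ((t + r^-1^-1)%:E < T)%E by apply: le_lt_trans h'T; rewrite kV lee_fin lerD2l.
have st' : s <= t by exact: ltW.
have sr : s + r^-1^-1 <= t by rewrite kV -lerBrDl.
have Hint := Heq _ (trapezoid_test k0 s0 st' tr).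
have [iL LB] := trapezoid_integral k0 s0 sr tr.
have [is_ Is] : leb.-integrable I (EFin \o derive1 (rise r^-1 s)) /\
    \int[leb]_(x in I) derive1 (rise r^-1 s) x = 1.
  apply: rise_integrable => //; apply: time_segment => //.
  by apply: le_lt_trans tT; rewrite lee_fin.
have [it It] : leb.-integrable I (EFin \o derive1 (rise r^-1 t)) /\
    \int[leb]_(x in I) derive1 (rise r^-1 t) x = 1.
  by apply: rise_integrable => //; apply: time_segment => //; exact: lt_trans st.
have iZ (f : R -> R) (a : R) : leb.-integrable I (EFin \o f) ->
    leb.-integrable I (EFin \o (fun x => f x * a)).
  move=> i_f; rewrite (_ : _ \o _ = fun x => ((f x)%:E * a%:E)%E).
    exact: integrableZr.
  by apply/funext => x /=; rewrite EFinM.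
have vZ (f : R -> R) (a : R) : leb.-integrable I (EFin \o f) ->
   \int[leb]_(x in I) (f x * a) = (\int[leb]_(x in I) f x) * a.
  by move=> i_f; exact: RintegralZr.
have rge a x : 0 <= derive1 (rise r^-1 a) x by exact: rise_derive1_ge0.
have /andP[_ Y] : \int[leb]_(x in I)
      (derive1 (rise r^-1 s) x * (- K) - derive1 (rise r^-1 t) x * K) <=
    \int[leb]_(x in I) (derive1 (trapezoid r^-1 s t) x * y x) <=
    \int[leb]_(x in I) (derive1 (rise r^-1 s) x * ys - derive1 (rise r^-1 t) x * yt).
  apply: Rintegral_ae_between => //.
  - exact: (integrableB mI (iZ _ ys is_) (iZ _ yt it)).
  - exact: (integrableB mI (iZ _ (- K) is_) (iZ _ K it)).
  apply: (@filterS _ _ (ae_filter_ringOfSetsType leb) _ _ _ HKb) => x [H1 H2] Ix.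
  have [yK _ _] := H1 Ix; have [Hs Ht _] := H2 Ix.
  move: yK; rewrite ler_norml => /andP[yK1 yK2].
  rewrite trapezoid_derive1 mulrBl; apply/andP; split; apply: lerB.
  - exact: ler_wpM2l.
  - exact: ler_wpM2l.
  - have [sx|nx] := boolP (s <= x <= s + r).
      apply: ler_wpM2l => //; apply: Hs.
      by case/andP: sx => -> /le_trans->//; rewrite lerD2l.
    by rewrite rise_derive1_out ?mul0r// kV; exact/negP.
  - have [sx|nx] := boolP (t <= x <= t + r).
      apply: ler_wpM2l => //; apply: Ht.
      by case/andP: sx => -> /le_trans->//; rewrite lerD2l.
    by rewrite rise_derive1_out ?mul0r// kV; exact/negP.
have /andP[Z1 _] : \int[leb]_(x in I) (trapezoid r^-1 s t x * c1) <=
    \int[leb]_(x in I) (trapezoid r^-1 s t x * z1 x) <=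
    \int[leb]_(x in I) (trapezoid r^-1 s t x * K).
  apply: Rintegral_ae_between; [by []|exact: iZ|exact: iZ|].
  apply: (@filterS _ _ (ae_filter_ringOfSetsType leb) _ _ _ HKb) => x [H1 H2] Ix.
  have [_ zK _] := H1 Ix; have [_ _ Hc] := H2 Ix.
  have /andP[lo up] := trapezoid_bounds x k0 st'.
  have t0 : 0 <= trapezoid r^-1 s t x by exact: le_trans lo.
  apply/andP; split; last by apply: ler_wpM2l => //; exact: le_trans (ler_norm _) zK.
  have [sx|nx] := boolP (s <= x <= t + r).
    apply: ler_wpM2l => //; have [] // := Hc _.
    by case/andP: sx => -> /le_trans->//; rewrite lerD2l.
  move: up; rewrite kV (negbTE nx) => up.
  by rewrite (_ : trapezoid _ _ _ _ = 0) ?mul0r//; apply/eqP; rewrite eq_le up.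
have /andP[_ Z2] : \int[leb]_(x in I) (trapezoid r^-1 s t x * - K) <=
    \int[leb]_(x in I) (trapezoid r^-1 s t x * z2 x) <=
    \int[leb]_(x in I) (trapezoid r^-1 s t x * c2).
  apply: Rintegral_ae_between; [by []|exact: iZ|exact: iZ|].
  apply: (@filterS _ _ (ae_filter_ringOfSetsType leb) _ _ _ HKb) => x [H1 H2] Ix.
  have [_ _ zK] := H1 Ix; have [_ _ Hc] := H2 Ix.
  have /andP[lo up] := trapezoid_bounds x k0 st'.
  have t0 : 0 <= trapezoid r^-1 s t x by exact: le_trans lo.
  apply/andP; split.
    by apply: ler_wpM2l => //; move: zK; rewrite ler_norml => /andP[].
  have [sx|nx] := boolP (s <= x <= t + r).
    apply: ler_wpM2l => //; have [] // := Hc _.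
    by case/andP: sx => -> /le_trans->//; rewrite lerD2l.
  move: up; rewrite kV (negbTE nx) => up.
  by rewrite (_ : trapezoid _ _ _ _ = 0) ?mul0r//; apply/eqP; rewrite eq_le up.
move: Y Z1 Z2 Hint LB; rewrite (RintegralB mI (iZ _ _ is_) (iZ _ _ it)).
rewrite (vZ _ _ is_) (vZ _ _ it) !(vZ _ _ iL) Is It !mul1r kV.
move: (\int[leb]_(x in I) (derive1 (trapezoid r^-1 s t) x * y x)) => Y.
move: (\int[leb]_(x in I) (trapezoid r^-1 s t x * z1 x)) => Z1.
move: (\int[leb]_(x in I) (trapezoid r^-1 s t x * z2 x)) => Z2.
move: (\int[leb]_(x in I) trapezoid r^-1 s t x) => L.
move=> HY HZ1 HZ2 Hint LB.
have HL : (c2 - c1) * (L - (t - s)) <= `|c2 - c1| * r.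
  apply: le_trans (ler_norm _) _; rewrite normrM; exact: ler_wpM2l.
have -> : (c2 - c1) * (t - s) = (c2 - c1) * L - (c2 - c1) * (L - (t - s)) by ring.
rewrite (_ : (c2 - c1) * L = L * c2 - L * c1); last by ring.
exact: increment_bound HY HZ1 HZ2 Hint HL.
Qed.

End weak_increment.

(** * Pairings of powers *)

Lemma sqr_young {R : realFieldType} (a b e : R) : 0 < e ->
  a ^+ 2 <= (1 + e) * b ^+ 2 + (1 + e^-1) * (a - b) ^+ 2.
Proof.
move=> e0; have ei : e * e^-1 = 1 by rewrite divff// gt_eqF.
have i0 : 0 < e^-1 by rewrite invr_gt0.
have := mulr_ge0 (ltW i0) (sqr_ge0 (e * b - (a - b))).
rewrite (_ : e^-1 * _ = (e * e^-1) * e * b ^+ 2 - 2 * (e * e^-1) * b * (a - b)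
  + e^-1 * (a - b) ^+ 2); last by ring.
rewrite ei; move: (e^-1) => i; nra.
Qed.

Section power_pairing.
Context {R : realType} {N : nat}.
Variable Omega : set 'rV[R]_N.
Hypothesis oO : open Omega.
Hypothesis foO : (lebesgue_rV R N Omega < +oo)%E.
Hypothesis N3 : (3 <= N)%N.
Implicit Types (f g k w phi : 'rV[R]_N -> R).
Local Notation mu := (lebesgue_rV R N).
Local Notation p := (critical_exponent R N).
Local Notation test := (test_function Omega).

Let mO : measurable Omega. Proof. exact: open_rV_measurable. Qed.
Let p1 : 1 < p. Proof. exact: critical_exponent_gt1. Qed.
Let p0 : 0 < p. Proof. exact: lt_trans p1. Qed.
Let q0 : 0 < p + 1. Proof. by rewrite addr_gt0// (lt_trans ltr01). Qed.

Lemma measurable_spow f (r : R) : measurable_fun Omega f ->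
  measurable_fun Omega (fun x => spow (f x) r).
Proof.
move=> mf; apply: measurable_funM; last exact: (measurable_norm_powR r mf).
have sgE (x : R) : Num.sg x = \1_(`]0, +oo[%classic : set R) x - \1_(`]-oo, 0[%classic : set R) x.
  rewrite !indicE !mem_setE !in_itv/= andbT.
  by case: sgrP; rewrite ?ltxx ?subr0 ?sub0r.
apply: (@measurableT_comp _ _ _ _ _ _ (fun x : measurableTypeR R => Num.sg x)) => //.
under eq_fun do rewrite sgE.
by apply: measurable_funB; exact: measurable_indic.
Qed.

Lemma funB_integral f (a : R) : measurable_fun Omega f -> funB Omega f = a%:E ->
  mu.-integrable Omega (EFin \o (fun x => `|f x| `^ (p + 1))) /\
  \int[mu]_(x in Omega) (`|f x| `^ (p + 1)) = a.
Proof.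
move=> mf fa; split; last by rewrite /Rintegral -/(funB _ _) fa.
apply/integrableP; split; first by apply/measurable_EFinP; exact: measurable_norm_powR.
under eq_integral do rewrite /= ger0_norm ?powR_ge0//.
by rewrite -/(funB Omega f) fa ltry.
Qed.

Let affine_integrable f g (a b : R) :
  mu.-integrable Omega (EFin \o f) -> mu.-integrable Omega (EFin \o g) ->
  mu.-integrable Omega (EFin \o (fun x => a * f x + b * g x)) /\
  \int[mu]_(x in Omega) (a * f x + b * g x) =
  a * \int[mu]_(x in Omega) f x + b * \int[mu]_(x in Omega) g x.
Proof.
move=> i_f ig.
have iaf : mu.-integrable Omega (EFin \o (fun x => a * f x)).
  by have := integrableZl mO a i_f; apply: eq_integrable.
have ibg : mu.-integrable Omega (EFin \o (fun x => b * g x)).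
  by have := integrableZl mO b ig; apply: eq_integrable.
split; first by have := integrableD mO iaf ibg; apply: eq_integrable.
by rewrite RintegralD// !RintegralZl.
Qed.

Lemma young_pairing f g k (a c : R) : measurable_fun Omega f -> measurable_fun Omega g ->
  measurable_fun Omega k -> (forall x, `|k x| <= `|f x| `^ p) ->
  funB Omega f = a%:E -> funB Omega g = c%:E ->
  mu.-integrable Omega (EFin \o (fun x => k x * g x)) /\
  `|\int[mu]_(x in Omega) (k x * g x)| <= p / (p + 1) * a + (p + 1)^-1 * c.
Proof.
move=> mf mg mk kf fa gc.
have [i_f If] := funB_integral mf fa; have [ig Ig] := funB_integral mg gc.
have [iS IS] := affine_integrable (p / (p + 1)) (p + 1)^-1 i_f ig.
have le x : `|k x * g x| <= p / (p + 1) * `|f x| `^ (p + 1) + (p + 1)^-1 * `|g x| `^ (p + 1).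
  rewrite normrM; apply: le_trans (young_powR p0 (normr_ge0 _) (normr_ge0 _)).
  by apply: ler_wpM2r.
have ik : mu.-integrable Omega (EFin \o (fun x => k x * g x)).
  apply: le_integrable iS => //.
    by apply/measurable_EFinP; exact: measurable_funM.
  by move=> x _; rewrite /= lee_fin; apply: le_trans (le x) (ler_norm _).
split => //; apply: le_trans (le_normr_Rintegral _ ik) _ => //.
rewrite -If -Ig -IS; apply: le_Rintegral; [by []| |exact: iS|by move=> x _; exact: le].
by have := integrable_abse ik; apply: eq_integrable.
Qed.

(** Write g = f - (f - g): the first term gives B(f) exactly, and the second one is
    absorbed by Young's inequality. *)
Lemma spow_pairing_ge f g (a c d e : R) : measurable_fun Omega f -> measurable_fun Omega g ->
  funB Omega f = a%:E -> funB Omega g = c%:E ->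
  funB Omega (fun x => -1 * g x + f x) = d%:E -> 0 < e ->
  (1 - e) * a - e `^ (- p) * d <= \int[mu]_(x in Omega) (spow (f x) p * g x).
Proof.
move=> mf mg fa gc hd e0; set h := (fun x => -1 * g x + f x) in hd.
have mh : measurable_fun Omega h by apply: measurable_funD => //; exact: measurable_funM.
have [i_f If] := funB_integral mf fa; have [ih Ih] := funB_integral mh hd.
have sf x : `|spow (f x) p| <= `|f x| `^ p by rewrite norm_spow.
have [ik _] := young_pairing mf mg (measurable_spow p mf) sf fa gc.
have [iS IS] := affine_integrable (1 - e) (- (e `^ (- p))) i_f ih.
rewrite -mulNr -If -Ih -IS; apply: le_Rintegral => // x _.
have -> : g x = f x - h x by rewrite /h; ring.
rewrite mulrBr spow_mul//.
have : `|spow (f x) p * h x| <= e * `|f x| `^ (p + 1) + e `^ (- p) * `|h x| `^ (p + 1).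
  by rewrite normrM norm_spow//; exact: young_powR_eps.
rewrite ler_norml mulNr => /andP[_].
move: (spow (f x) p * h x) (`|f x| `^ (p + 1)) (e `^ (- p) * _) => y z t; lra.
Qed.

(** Young's inequality for 1^p |f|. *)
Lemma ip_bounded f (psi : 'rV[R]_N -> R) (M a e : R) : measurable_fun Omega f -> measurable_fun Omega psi ->
  (forall x, `|psi x| <= M) -> funB Omega f = a%:E -> 0 < e ->
  `|ip Omega f psi| <= M * (e * fine (mu Omega) + e `^ (- p) * a).
Proof.
move=> mf mpsi pM fa e0.
have M0 : 0 <= M by exact: le_trans (pM 0).
have [i_f If] := funB_integral mf fa.
have ic : mu.-integrable Omega (EFin \o (fun _ => 1 : R)).
  exact: (L2_integrable oO foO (L2_cst oO foO 1)).
have [iS IS] := affine_integrable (M * e) (M * e `^ (- p)) ic i_f.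
have le x : `|f x * psi x| <= M * e * 1 + M * e `^ (- p) * `|f x| `^ (p + 1).
  rewrite normrM mulrC -!mulrA -mulrDr; apply: ler_pM => //.
  have := young_powR_eps p0 e0 ler01 (normr_ge0 (f x)).
  by rewrite !powR1 mul1r.
have ik : mu.-integrable Omega (EFin \o (fun x => f x * psi x)).
  apply: le_integrable iS => //.
    by apply/measurable_EFinP; exact: measurable_funM.
  by move=> x _; rewrite /= lee_fin; apply: le_trans (le x) (ler_norm _).
have -> : M * (e * fine (mu Omega) + e `^ (- p) * a) =
    \int[mu]_(x in Omega) (M * e * 1 + M * e `^ (- p) * `|f x| `^ (p + 1)).
  by rewrite IS If Rintegral_cst// mul1r; ring.
apply: le_trans (le_normr_Rintegral _ ik) _ => //.
apply: le_Rintegral; [by []| |exact: iS|by move=> x _; exact: le].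
by have := integrable_abse ik; apply: eq_integrable.
Qed.

Let r := (p + 1) / 2.

Let r1 : 1 <= r.
Proof. by rewrite /r ler_pdivlMr// mul1r -lerBlDr ltW// (_ : 2 - 1 = 1)//; ring. Qed.

Let r0 : 0 < r. Proof. exact: lt_le_trans r1. Qed.

Lemma powR_half_sqr (x : R) : 0 <= x -> (x `^ r) ^+ 2 = x `^ (p + 1).
Proof.
move=> x0; rewrite -powR_mulrn ?powR_ge0// -powRrM; congr (_ `^ _).
by rewrite /r; field.
Qed.

(** The squared L^2-distance in which weak solutions are continuous. *)
Definition spow_dist2 f g : \bar R :=
  (\int[mu]_(x in Omega) ((spow (f x) r - spow (g x) r) ^+ 2)%:E)%E.

Let msd f g : measurable_fun Omega f -> measurable_fun Omega g ->
  measurable_fun Omega (fun x => (spow (f x) r - spow (g x) r) ^+ 2).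
Proof.
by move=> mf mg; apply/measurable_funX/measurable_funB; exact: measurable_spow.
Qed.

Lemma funB_spow_dist2 f g (e : R) : measurable_fun Omega f -> measurable_fun Omega g ->
  0 < e ->
  (funB Omega f <= (1 + e)%:E * funB Omega g + (1 + e^-1)%:E * spow_dist2 f g)%E.
Proof.
move=> mf mg e0; have e1 : 0 <= 1 + e by rewrite addr_ge0// ltW.
have e2 : 0 <= 1 + e^-1 by rewrite addr_ge0// invr_ge0 ltW.
have mB (h : 'rV[R]_N -> R) : measurable_fun Omega h -> measurable_fun Omega (fun x => (`|h x| `^ (p + 1))%:E).
  by move=> mh; apply/measurable_EFinP; exact: measurable_norm_powR.
have mS : measurable_fun Omega (fun x => ((spow (f x) r - spow (g x) r) ^+ 2)%:E).
  by apply/measurable_EFinP; exact: msd.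
have E1 : ((1 + e)%:E * funB Omega g =
    \int[mu]_(x in Omega) ((1 + e)%:E * (`|g x| `^ (p + 1))%:E))%E.
  by rewrite ge0_integralZl_EFin//; exact: mB.
have E2 : ((1 + e^-1)%:E * spow_dist2 f g =
    \int[mu]_(x in Omega) ((1 + e^-1)%:E * ((spow (f x) r - spow (g x) r) ^+ 2)%:E))%E.
  by rewrite ge0_integralZl_EFin// => x _; rewrite lee_fin sqr_ge0.
rewrite E1 E2 -ge0_integralD//; last 4 first.
- by move=> x _; rewrite mule_ge0// lee_fin// powR_ge0.
- by apply: measurable_funeM; exact: mB.
- by move=> x _; rewrite mule_ge0// lee_fin// sqr_ge0.
- exact: measurable_funeM.
apply: ge0_le_integral => //.
- exact: mB.
- by apply: emeasurable_funD; apply: measurable_funeM => //; exact: mB.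
move=> x _; rewrite -!EFinM -EFinD lee_fin.
have := sqr_young (spow (f x) r) (spow (g x) r) e0.
by rewrite -(@real_normK _ (spow (f x) r)) ?num_real// -(@real_normK _ (spow (g x) r)) ?num_real// !norm_spow// !powR_half_sqr.
Qed.

Lemma funB_dist_le f g : measurable_fun Omega f -> measurable_fun Omega g ->
  (funB Omega (fun x => (-1 * g x + f x)%R) <= (2 `^ (p + 1))%:E * spow_dist2 f g)%E.
Proof.
move=> mf mg; have mS : measurable_fun Omega (fun x => ((spow (f x) r - spow (g x) r) ^+ 2)%:E).
  by apply/measurable_EFinP; exact: msd.
rewrite /funB /spow_dist2 -ge0_integralZl_EFin ?powR_ge0//; last first.
  by move=> x _; rewrite lee_fin sqr_ge0.
apply: ge0_le_integral => //.
- apply/measurable_EFinP; apply: measurable_norm_powR.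
  by apply: measurable_funD => //; exact: measurable_funM.
- exact: measurable_funeM.
move=> x _; rewrite -EFinM lee_fin (_ : -1 * g x + f x = f x - g x); last by ring.
have H := spow_dist (f x) (g x) r1.
have : (`|f x - g x| `^ r) ^+ 2 <= (2 `^ r * `|spow (f x) r - spow (g x) r|) ^+ 2.
  by rewrite ler_pXn2r ?nnegrE ?mulr_ge0 ?powR_ge0.
by rewrite exprMn !powR_half_sqr// real_normK// num_real.
Qed.

End power_pairing.

(** * The evolution of B along a weak solution *)

Lemma le_add_halves {R : realFieldType} (e x y : R) : x <= e / 2 -> y <= e / 2 -> x + y <= e.
Proof. lra. Qed.

Lemma le_mean_halves {R : realFieldType} (e x y : R) : x <= e / 2 -> y <= e / 2 -> 2^-1 * (x + y) <= e / 2.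
Proof. lra. Qed.

Lemma unit_young {R : realFieldType} (z x y e : R) : z <= 2^-1 * (1 * x + 1^-1 * y) ->
  x <= e -> y <= e -> z <= e.
Proof. rewrite invr1; lra. Qed.

Lemma time_gap {R : realFieldType} (t t' s d h : R) : 0 < d -> t' < t + h ->
  t' - (s + d) <= t - s + h.
Proof. lra. Qed.

Lemma le_add_quarters {R : realFieldType} (e x y : R) : x <= e / 4 -> y <= e / 4 -> x + y <= e / 2.
Proof. lra. Qed.

Lemma sqr_young_close {R : realType} (x y c k d e : R) : 0 < c -> 0 <= x ->
  (y%:E <= (1 + c)%:E * x%:E + k%:E * d%:E)%E ->
  (x%:E <= (1 + c)%:E * y%:E + k%:E * d%:E)%E ->
  k * d <= e / 2 -> c * x <= e / 2 -> `|y - x| <= e.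
Proof.
move=> c0 x0; rewrite -!EFinM -!EFinD !lee_fin !mulrDl !mul1r.
move: (k * d) => kd H1 H2 Hk Hc; rewrite ler_distl; apply/andP; split; last by lra.
have [xy|/ltW yx] := leP x y; first by lra.
have := ler_wpM2l (ltW c0) yx; lra.
Qed.

Lemma pairing_close {R : realFieldType} (x y c k d e B : R) : 0 < c ->
  `|y - x| <= e / 3 -> y <= B -> c * B <= e / 3 -> k * d <= e / 3 ->
  x - e <= (1 - c) * y - k * d.
Proof.
move=> c0; rewrite ler_distl => /andP[H1 _] yB Hc Hk.
have := ler_wpM2l (ltW c0) yB; rewrite mulrBl mul1r; move: Hk.
move: (k * d) => kd; lra.
Qed.

Lemma increment_close {R : realFieldType} (P i xt xs e z : R) : P <= 1 -> P + i = 1 ->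
  0 <= e -> xt - e / 2 - (P * (xs + e / 2) + i * xt) <= z -> P * (xt - xs) <= z + e.
Proof.
move=> P1 Pi e0; have -> : i = 1 - P by lra.
have := ler_wpM2r e0 P1; nra.
Qed.

Lemma three_thirds {R : realFieldType} (x x' y y' e k k' : R) :
  `|x' - x| <= e / 3 -> `|y' - y| <= e / 3 -> x' - y' <= k -> k <= k' + e / 3 ->
  x - y <= k' + e.
Proof. by rewrite !ler_distl => /andP[? ?] /andP[? ?]; lra. Qed.

Lemma convex_bound {R : realFieldType} (P i x y e : R) : P + i = 1 -> 0 <= e -> 0 <= P ->
  P <= 1 -> y <= x + e -> P * y + i * x <= x + e.
Proof. move=> Pi e0 P0 P1 yx; have -> : i = 1 - P by lra. nra. Qed.

Lemma dini_bound {R : realFieldType} (x a y z : R) : y <= a ->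
  x + z / 2 - (a - z / 2) <= x - y + z.
Proof. lra. Qed.

Section weak_flow.
Context {R : realType} {N : nat}.
Variable Omega : set 'rV[R]_N.
Hypothesis oO : open Omega.
Hypothesis foO : (lebesgue_rV R N Omega < +oo)%E.
Hypothesis N3 : (3 <= N)%N.
Local Notation mu := (lebesgue_rV R N).
Local Notation leb := (@lebesgue_measure R).
Local Notation X := (H10 Omega).
Local Notation p := (critical_exponent R N).
Local Notation A := (dirichlet Omega).
Local Notation m := (2 / (p + 1)).

Variables (T : \bar R) (u : R -> 'rV[R]_N -> R) (M S : R).
Let I : set R := [set t | 0 < t /\ (t%:E < T)%E].
Let I0 : set R := [set t | 0 <= t /\ (t%:E < T)%E].
Hypothesis M0 : 0 < M.
Hypothesis S0 : 0 < S.
Hypothesis uM : {ae leb, forall t, I t -> X (u t) /\ (funA Omega (u t) <= M%:E)%E}.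
Hypothesis ueq : weak_equation Omega T u.
Hypothesis mu_ : forall t, I0 t -> measurable_fun Omega (u t).
Hypothesis ucont : forall t0, I0 t0 ->
  spow_dist2 Omega (u t) (u t0) @[t --> within I0 (nbhs t0)] --> 0%E.
Hypothesis XB : forall w, X w -> exists b, funB Omega w = b%:E.
Hypothesis sob : forall w b, X w -> funB Omega w = b%:E -> S * b `^ m <= A w w.

Let p1 : 1 < p. Proof. exact: critical_exponent_gt1. Qed.
Let p0 : 0 < p. Proof. exact: lt_trans p1. Qed.
Let q0 : 0 < p + 1. Proof. by rewrite addr_gt0// (lt_trans ltr01). Qed.

Let II0 t : I t -> I0 t. Proof. by move=> [/ltW]. Qed.

(** The exceptional null set of times is where u(t) leaves X or exceeds the energy
    bound; only the remaining times can be used in the test function w = u(t). *)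
Definition good_time t := I t /\ X (u t) /\ A (u t) (u t) <= M.

Lemma good_time_ae : {ae leb, forall t, I t -> good_time t}.
Proof.
apply: (@filterS _ _ (ae_filter_ringOfSetsType leb) _ _ _ uM) => t H It.
by have [Xt AM] := H It; split => //; split => //; move: AM; rewrite (funAE oO Xt).
Qed.

Lemma good_time_dense a b : 0 <= a -> a < b -> (b%:E < T)%E ->
  exists2 t, a < t < b & good_time t.
Proof.
move=> a0 ab bT; apply: contrapT => none.
have [Z [mZ Z0 hZ]] := good_time_ae.
have sub : `]a, b[%classic `<=` Z.
  move=> t /=; rewrite in_itv/= => tab; apply: hZ => /= H; apply: none.
  exists t => //; apply: H; have /andP[at_ tb] := tab; split.
    exact: le_lt_trans at_.
  by apply: lt_trans bT; rewrite lte_fin.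
have := @le_measure _ _ _ leb `]a, b[%classic Z.
rewrite !inE => /(_ _ mZ sub) /=; rewrite Z0 => /(_ (measurable_itv _)).
rewrite lebesgue_measure_itv/= lte_fin ab -EFinB lee_fin leNgt subr_gt0 ab.
by [].
Qed.

Lemma spow_dist2_small t0 e : I0 t0 -> 0 < e -> exists2 h, 0 < h &
  forall t, I0 t -> `|t - t0| < h -> (spow_dist2 Omega (u t) (u t0) < e%:E)%E.
Proof.
move=> It0 e0; have := ucont It0.
have nb : nbhs (0%E : \bar R) [set x | (x < e%:E)%E].
  by apply: open_nbhs_nbhs; split; [exact: open_ereal_lt_ereal|rewrite /= lte_fin].
move=> /(_ _ nb) /= [h h0 H]; exists h => // t It th.
by apply: H => //=; rewrite distrC.
Qed.

(** B is finite at good times, which are dense, and finiteness is transported by the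
    L^2-continuity of u^((p+1)/2). *)
Lemma funB_fin t : I0 t -> exists b, funB Omega (u t) = b%:E.
Proof.
move=> It; have [h h0 H] := spow_dist2_small It ltr01.
have [t0 tT] := It.
have [h' h'0 h'T] := time_margin tT.
pose h1 := Num.min (h / 2) h'.
have h10 : 0 < h1 by rewrite lt_min h'0 divr_gt0.
have [||s /andP[ts sth] [Is [Xs _]]] := @good_time_dense t (t + h1) t0.
- by rewrite ltrDl.
- by apply: le_lt_trans h'T; rewrite lee_fin lerD2l ge_min lexx orbT.
have [b Bs] := XB Xs.
have := H s (II0 Is); rewrite ger0_norm ?subr_ge0 ?(ltW ts)//.
have hh : s - t < h.
  rewrite ltrBlDl (lt_le_trans sth)// lerD2l ge_min; apply/orP; left.
  by rewrite ler_pdivrMr// mulr2n mulrDr mulr1 lerDl ltW.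
move=> /(_ hh) D1.
have := funB_spow_dist2 oO N3 (mu_ It) (mu_ (II0 Is)) ltr01.
rewrite (_ : spow_dist2 Omega (u t) (u s) = spow_dist2 Omega (u s) (u t)); last first.
  by apply: eq_integral => x _; rewrite -sqrrN opprB.
rewrite Bs => H1; have := funB_ge0 Omega (u t); move: H1 D1.
have : (0 <= spow_dist2 Omega (u s) (u t))%E.
  by apply: integral_ge0 => x _; rewrite lee_fin sqr_ge0.
case: (spow_dist2 _ _ _) => [d| |]// _.
by case: (funB _ _) => [b' _ _ _| |]//; exists b'.
Qed.

Definition mass t : R := fine (funB Omega (u t)).

Lemma massE t : I0 t -> funB Omega (u t) = (mass t)%:E.
Proof. by move=> It; rewrite /mass; have [b ->] := funB_fin It. Qed.

Lemma mass_ge0 t : 0 <= mass t.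
Proof. by apply: fine_ge0; exact: funB_ge0. Qed.

Lemma mass_near t0 (e : R) : I0 t0 -> 0 < e -> exists2 h, 0 < h &
  forall t, I0 t -> `|t - t0| < h -> `|mass t - mass t0| <= e.
Proof.
move=> It0 e0; have b0 := mass_ge0 t0.
pose c := e / (2 * (mass t0 + 1)).
have c0 : 0 < c by rewrite divr_gt0// mulr_gt0// ltr_wpDl.
have cb : c * mass t0 <= e / 2.
  rewrite /c (_ : e / (2 * (mass t0 + 1)) * mass t0 = e / 2 * (mass t0 / (mass t0 + 1))).
    rewrite ler_piMr ?divr_ge0 ?(ltW e0)// ler_pdivrMr ?ltr_wpDl// mul1r.
    by rewrite lerDl.
  by field; rewrite gt_eqF// ltr_wpDl.
pose k := 1 + c^-1; have k0 : 0 < k by rewrite addr_gt0// invr_gt0.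
have ek0 : 0 < e / (2 * k) by rewrite divr_gt0// mulr_gt0.
have [h h0 H] := spow_dist2_small It0 ek0.
exists h => // t It th; have := H t It th.
have := funB_spow_dist2 oO N3 (mu_ It) (mu_ It0) c0.
have := funB_spow_dist2 oO N3 (mu_ It0) (mu_ It) c0.
rewrite (_ : spow_dist2 Omega (u t0) (u t) = spow_dist2 Omega (u t) (u t0)); last first.
  by apply: eq_integral => x _; rewrite -sqrrN opprB.
have : (0 <= spow_dist2 Omega (u t) (u t0))%E.
  by apply: integral_ge0 => x _; rewrite lee_fin sqr_ge0.
rewrite !massE//; case: (spow_dist2 _ _ _) => [d| |]// _ H1 H2.
rewrite lte_fin => dk; apply: (sqr_young_close c0 b0 H2 H1) cb.
have -> : e / 2 = k * (e / (2 * k)) by field; rewrite gt_eqF.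
by rewrite -/k ler_pM2l// ltW.
Qed.

Lemma mass_good t : good_time t -> mass t <= (M / S) `^ m^-1.
Proof.
move=> [It [Xt AM]]; have [m0 _ _ _ _] := well_exponents p1.
have := le_trans (sob Xt (massE (II0 It))) AM.
rewrite mulrC -ler_pdivlMr// => H.
have mi0 : 0 <= m^-1 by rewrite invr_ge0 ltW.
have := le_powR mi0 (powR_ge0 _ _) H.
by rewrite -powRrM divff ?gt_eqF// powRr1// mass_ge0.
Qed.

Let dif s t : 'rV[R]_N -> R := fun x => -1 * u t x + u s x.

Lemma funB_dif_small t (e : R) : I0 t -> 0 < e -> exists2 h, 0 < h &
  forall s, I0 s -> `|s - t| < h ->
  exists2 d, funB Omega (dif s t) = d%:E & 0 <= d <= e.
Proof.
move=> It e0; have t0 : 0 < 2 `^ (p + 1) :> R by exact: powR_gt0.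
have [|h h0 H] := @spow_dist2_small t (e / 2 `^ (p + 1)) It; first exact: divr_gt0.
exists h => // s Is st; have := H s Is st.
have := funB_dist_le oO N3 (mu_ Is) (mu_ It); rewrite -/(dif s t).
have := funB_ge0 Omega (dif s t).
have : (0 <= spow_dist2 Omega (u s) (u t))%E.
  by apply: integral_ge0 => x _; rewrite lee_fin sqr_ge0.
case: (spow_dist2 _ _ _) => [d| |]// _.
case: (funB _ _) => [b| |]//; rewrite -EFinM !lee_fin lte_fin => b0 bd de.
exists b => //; rewrite b0 (le_trans bd)// mulrC -ler_pdivlMr//; exact: ltW.
Qed.

(** Approximate u(t) by a test function phi.  The remainder is small because the
    Dirichlet integrals at good times are bounded, and against phi the form only
    involves u(s) - u(t) itself, which tends to 0 in L^(p+1). *)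
Lemma dirichlet_near t (e : R) : good_time t -> 0 < e -> exists2 h, 0 < h &
  forall s, good_time s -> `|s - t| < h -> `|A (u s) (u t) - A (u t) (u t)| <= e.
Proof.
move=> [It [Xt AtM]] e0.
pose c := e / (8 * M); have c0 : 0 < c by rewrite divr_gt0// mulr_gt0.
have ec0 : 0 < e * c / 2 by rewrite divr_gt0// mulr_gt0.
have [phi tphi gphi] := H10_approx oO foO Xt ec0.
have Xphi := H10_test oO foO tphi.
have Ad := le_trans (gdist_dirichlet oO foO Xt tphi) (ltW gphi).
have Xd := H10_lin oO foO (-1) Xphi Xt.
set d := (fun x => _) in Ad Xd.
pose D2 i := partial i (partial i phi).
have tD2 i : test_function Omega (D2 i) by do 2! apply: test_function_partial.
have /choice[K KP] : forall i, exists K, 0 < K /\ forall x, `|D2 i x| <= K.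
  by move=> i; have [K K0 HK] := test_bounded (tD2 i); exists K.
pose KS := 1 + \sum_i K i.
have KS0 : 0 < KS by rewrite ltr_pwDl// sumr_ge0// => i _; have [/ltW] := KP i.
pose w0 := fine (mu Omega); have w00 : 0 <= w0 by exact: fine_ge0.
pose e1 := e / (4 * KS * (w0 + 1)).
have e10 : 0 < e1 by rewrite divr_gt0// !mulr_gt0// ltr_wpDl.
pose E := e1 `^ (- p); have E0 : 0 < E by exact: powR_gt0.
have [|h h0 H] := @funB_dif_small t (e / (4 * KS * E)) (II0 It).
  by rewrite divr_gt0// !mulr_gt0.
exists h => // s [Is [Xs AsM]] st.
have [b Bb /andP[b0 bE]] := H s (II0 Is) st.
have Xf : X (dif s t) := H10_lin oO foO (-1) Xt Xs.
have Af : A (dif s t) (dif s t) <= 4 * M.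
  have := dirichlet_ge0 Omega (fun x => 1 * u t x + u s x).
  rewrite (dirichlet_lin2 oO foO 1 Xt Xs) => /parallelogram_bound.
  rewrite /dif (dirichlet_lin2 oO foO (-1) Xt Xs) => /le_trans; apply.
  move: AtM AsM; move: (A (u t) (u t)) (A (u s) (u s)) => x y; lra.
have -> : A (u s) (u t) - A (u t) (u t) = A (dif s t) (u t).
  rewrite /dif (dirichlet_lin oO foO (-1) Xt Xs Xt) mulN1r addrC.
  by [].
have -> : A (dif s t) (u t) = A (dif s t) d + A (dif s t) phi.
  rewrite (dirichletC Omega _ d) /d (dirichlet_lin oO foO (-1) Xphi Xt Xf).
  rewrite (dirichletC Omega phi) (dirichletC Omega (u t)) mulN1r addrAC addNr add0r.
  by [].
apply: le_trans (ler_normD _ _) _.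
have P1 : `|A (dif s t) d| <= e / 2.
  apply: le_trans (dirichlet_young oO c0 Xf Xd) _.
  have H1 : c * A (dif s t) (dif s t) <= e / 2.
    rewrite (_ : e / 2 = c * (4 * M)) ?ler_pM2l//.
    by rewrite /c; field; rewrite gt_eqF.
  have H2 : c^-1 * A d d <= e / 2.
    rewrite (_ : e / 2 = c^-1 * (e * c / 2)) ?ler_pM2l ?invr_gt0//.
    by field; rewrite gt_eqF.
  exact: le_mean_halves H1 H2.
have P2 : `|A (dif s t) phi| <= e / 2.
  rewrite (dirichlet_test oO foO Xf tphi) normrN.
  apply: le_trans (ler_norm_sum _ _ _) _.
  have mf : measurable_fun Omega (dif s t) by exact: H10_measurable Xf.
  pose Q := e1 * w0 + E * b.
  have Q0 : 0 <= Q by rewrite addr_ge0// mulr_ge0// ltW.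
  apply: (@le_trans _ _ (\sum_i K i * Q)).
    apply: ler_sum => i _; have [_ Ki] := KP i.
    exact: (ip_bounded oO foO N3 mf (test_measurable (tD2 i)) Ki Bb e10).
  rewrite -mulr_suml; apply: (@le_trans _ _ (KS * Q)).
    by apply: ler_wpM2r => //; rewrite lerDr.
  have H1 : KS * (e1 * w0) <= e / 4.
    rewrite (_ : e / 4 = KS * (e1 * (w0 + 1))); last first.
      by rewrite /e1; field; rewrite !gt_eqF// ltr_wpDl.
    by rewrite ler_pM2l// ler_pM2l// lerDl.
  have H2 : KS * (E * b) <= e / 4.
    rewrite (_ : e / 4 = KS * (E * (e / (4 * KS * E)))); last first.
      by field; rewrite !gt_eqF.
    by rewrite ler_pM2l// ler_pM2l.
  by rewrite mulrDr; exact: le_add_quarters H1 H2.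
exact: le_add_halves P1 P2.
Qed.

Let Mb := (M / S) `^ m^-1.
Let Mb0 : 0 < Mb. Proof. by rewrite powR_gt0// divr_gt0. Qed.
Let P := p / (p + 1).
Let P0 : 0 < P. Proof. exact: divr_gt0. Qed.
Let P1 : P <= 1. Proof. by rewrite ler_pdivrMr// mul1r lerDl. Qed.
Let Pi : P + (p + 1)^-1 = 1. Proof. by rewrite /P; field; rewrite gt_eqF. Qed.

Let spow_le (s : R) x : `|spow (u s x) p| <= `|u s x| `^ p.
Proof. by rewrite norm_spow. Qed.

Let good_measurable s : good_time s -> measurable_fun Omega (u s).
Proof. by move=> [/II0/mu_]. Qed.

Let good_massE s : good_time s -> funB Omega (u s) = (mass s)%:E.
Proof. by move=> [/II0/massE]. Qed.

(** The pairing differs from B(u(s)) by a quantity controlled by the L^(p+1)-distance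
    from u(s) to u(t). *)
Lemma pairing_near t (e : R) : good_time t -> 0 < e -> exists2 h, 0 < h &
  forall s, good_time s -> `|s - t| < h ->
  mass t - e <= \int[mu]_(x in Omega) (spow (u s x) p * u t x).
Proof.
move=> gt e0; have It0 := II0 gt.1.
pose c := e / (3 * Mb); have c0 : 0 < c by rewrite divr_gt0// mulr_gt0.
pose E := c `^ (- p); have E0 : 0 < E by exact: powR_gt0.
have [|h1 h10 H1] := @mass_near t (e / 3) It0; first exact: divr_gt0.
have [|h2 h20 H2] := @funB_dif_small t (e / (3 * E)) It0.
  by rewrite divr_gt0// mulr_gt0.
exists (Num.min h1 h2); first by rewrite lt_min h10.
move=> s gs; rewrite lt_min => /andP[sh1 sh2].
have Is0 := II0 gs.1; have [d Bd /andP[d0 de]] := H2 s Is0 sh2.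
have mf := good_measurable gs; have mg := good_measurable gt.
apply: le_trans (spow_pairing_ge oO N3 mf mg (good_massE gs) (good_massE gt) Bd c0).
apply: (pairing_close c0 (H1 s Is0 sh1) (mass_good gs)).
  by rewrite -/Mb (_ : c * Mb = e / 3)// /c; field; rewrite gt_eqF.
rewrite -/E (_ : e / 3 = E * (e / (3 * E))) ?ler_pM2l//.
by field; rewrite gt_eqF.
Qed.

(** The equation is tested with w = u(t).  The mass B(t) enters both bounds on the
    pairing, with weight 1/(p+1) near s by Young's inequality and weight 1 near t, which
    leaves the factor p/(p+1). *)
Lemma mass_increment t s h (c1 c2 : R) : good_time t -> 0 < s -> s < t -> 0 < h ->
  (forall r, good_time r -> s <= r <= t + h ->
     c1 <= A (u r) (u t) /\ P * mass r + (p + 1)^-1 * mass t <= c2) ->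
  P * (mass t - mass s) <= (c2 - c1) * (t - s).
Proof.
move=> gt s0 st h0 Hc; have [[t0 tT] [Xt AtM]] := gt.
have It0 := II0 gt.1.
have Is0 : I0 s by split; [exact: ltW|apply: lt_trans tT; rewrite lte_fin].
apply/ler_addgt0Pr => e e0; have e20 : 0 < e / 2 by rewrite divr_gt0.
have [h1 h10 H1] := mass_near Is0 e20.
have [h2 h20 H2] := pairing_near gt e20.
apply: (increment_close P1 Pi (ltW e0)).
pose h' := Num.min h (Num.min h1 h2) / 2.
have hm : 0 < Num.min h (Num.min h1 h2) by rewrite !lt_min h0 h10.
have h'0 : 0 < h' by rewrite divr_gt0.
have : h' < Num.min h (Num.min h1 h2) by rewrite /h' ltr_pdivrMr// mulr2n mulrDr mulr1 ltrDl.
rewrite !lt_min => /andP[h'h /andP[h'1 h'2]].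
have ipos : 0 < (p + 1)^-1 by rewrite invr_gt0.
have bound r : good_time r -> P * mass r + (p + 1)^-1 * mass t <= Mb.
  move=> gr; have -> : Mb = P * Mb + (p + 1)^-1 * Mb by rewrite -mulrDl Pi mul1r.
  apply: lerD.
    by rewrite ler_pM2l//; exact: mass_good.
  by rewrite ler_pM2l//; exact: mass_good.
apply: (@weak_increment _ T
  (fun r => \int[mu]_(x in Omega) (spow (u r x) p * u t x))
  (fun r => \int[mu]_(x in Omega)
           (\sum_(i < N) grad Omega (u r) i x * grad Omega (u t) i x))
  (fun r => \int[mu]_(x in Omega) (`|u r x| `^ p * u t x))
  (Mb + M) _ _ c1 c2 s t h') => //.
- by move=> eta teta; exact: (ueq Xt teta).
- apply: (@filterS _ _ (ae_filter_ringOfSetsType leb) _ _ _ good_time_ae) => r gr Ir.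
  have {}gr := gr Ir; have [_ [Xr ArM]] := gr.
  have mf := good_measurable gr; have mg := good_measurable gt.
  split.
  + have [_] := young_pairing oO N3 mf mg (measurable_spow p mf) (spow_le r)
      (good_massE gr) (good_massE gt).
    by move=> /le_trans; apply; rewrite (le_trans (bound r gr))// lerDl ltW.
  + rewrite (dirichlet_integral oO Xr Xt).
    have := unit_young (dirichlet_young oO ltr01 Xr Xt) ArM AtM.
    by move=> /le_trans; apply; rewrite lerDr ltW.
  + have [|_] := young_pairing oO N3 mf mg (measurable_norm_powR p mf) _
      (good_massE gr) (good_massE gt).
      by move=> x; rewrite ger0_norm// powR_ge0.
    by move=> /le_trans; apply; rewrite (le_trans (bound r gr))// lerDl ltW.
- apply: (@filterS _ _ (ae_filter_ringOfSetsType leb) _ _ _ good_time_ae) => r gr Ir.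
  have {}gr := gr Ir; have [_ [Xr ArM]] := gr.
  have mf := good_measurable gr; have mg := good_measurable gt.
  split.
  + move=> /andP[sr rs].
    have [_] := young_pairing oO N3 mf mg (measurable_spow p mf) (spow_le r)
      (good_massE gr) (good_massE gt).
    move=> /(le_trans (ler_norm _))/le_trans; apply; rewrite lerD2r ler_pM2l//.
    have := H1 r (II0 gr.1); rewrite ger0_norm ?subr_ge0// ltrBlDl.
    move=> /(_ (le_lt_trans rs _)); rewrite ltrD2l => /(_ h'1).
    by rewrite ler_distl => /andP[].
  + move=> /andP[tr rt]; apply: H2 => //.
    by rewrite ger0_norm ?subr_ge0// ltrBlDl (le_lt_trans rt)// ltrD2l.
  + move=> /andP[sr rt].
    have [|Hc1 Hc2] := Hc r gr.
      by rewrite sr (le_trans rt)// lerD2l ltW.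
    rewrite (dirichlet_integral oO Xr Xt); split => //.
    have [|_] := young_pairing oO N3 mf mg (measurable_norm_powR p mf) _
      (good_massE gr) (good_massE gt).
      by move=> x; rewrite ger0_norm// powR_ge0.
    by move=> /(le_trans (ler_norm _))/le_trans; apply.
Qed.

(** Crude constant bounds for the two pairings suffice at good times t; the other
    times follow by density and continuity. *)
Lemma mass_lipschitz : exists2 K : R, 0 < K & forall s t : R, 0 <= s -> s < t ->
  (t%:E < T)%E -> mass t - mass s <= K * (t - s).
Proof.
pose K := (Mb + M) / P; have K0 : 0 < K by rewrite divr_gt0// addr_gt0.
have KG s t : good_time t -> 0 < s -> s < t -> mass t - mass s <= K * (t - s).
  move=> gt s0 st; have [_ [Xt AtM]] := gt.
  rewrite /K mulrAC ler_pdivlMr// mulrC.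
  have -> : Mb + M = Mb - (- M) by rewrite opprK.
  apply: (mass_increment gt s0 st ltr01) => r gr _; have [_ [Xr ArM]] := gr; split.
    have := unit_young (dirichlet_young oO ltr01 Xr Xt) ArM AtM.
    by rewrite ler_norml => /andP[].
  have -> : Mb = P * Mb + (p + 1)^-1 * Mb by rewrite -mulrDl Pi mul1r.
  by apply: lerD; rewrite ler_pM2l ?invr_gt0//; exact: mass_good.
exists K => // s t s0 st tT.
have It0 : I0 t by split => //; exact: le_trans (ltW st).
have Is0 : I0 s by split=> //; apply: lt_trans tT; rewrite lte_fin.
apply/ler_addgt0Pr => e e0; have e30 : 0 < e / 3 by rewrite divr_gt0.
have [h1 h10 H1] := mass_near It0 e30.
have [h2 h20 H2] := mass_near Is0 e30.
have [h' h'0 h'T] := time_margin tT.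
pose h := Num.min (Num.min h1 h') (e / (3 * K)).
have h0 : 0 < h by rewrite !lt_min h10 h'0 divr_gt0// mulr_gt0.
have /and3P[hh1 hh' he] : [&& h <= h1, h <= h' & h <= e / (3 * K)].
  by rewrite /h !ge_min !lexx !orbT.
have [||t' /andP[tt' t'h] gt'] := @good_time_dense t (t + h) It0.1.
- by rewrite ltrDl.
- by apply: le_lt_trans h'T; rewrite lee_fin lerD2l.
pose d := Num.min (h2 / 2) ((t - s) / 2).
have d0 : 0 < d by rewrite lt_min !divr_gt0// subr_gt0.
have dh2 : d < h2 by rewrite gt_min ltr_pdivrMr// mulr2n mulrDr mulr1 ltrDl h20.
have dts : d < t - s.
  by rewrite gt_min [X in _ || X]ltr_pdivrMr// mulr2n mulrDr mulr1 ltrDl subr_gt0 st orbT.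
have sdE : s + d - s = d by rewrite addrAC subrr add0r.
have Hs := H2 (s + d); rewrite sdE gtr0_norm// in Hs.
have Isd : I0 (s + d).
  split; first by rewrite addr_ge0// ltW.
  by apply: lt_trans tT; rewrite lte_fin -ltrBrDl.
have Ht := H1 t' (II0 gt'.1); rewrite gtr0_norm ?subr_gt0// ltrBlDl in Ht.
have {}Ht := Ht (lt_le_trans t'h (_ : t + h <= t + h1)); rewrite lerD2l in Ht.
have := KG (s + d) t' gt'; rewrite ltr_wpDl// => /(_ isT).
have sdt : s + d < t' by apply: lt_trans tt'; rewrite -ltrBrDl.
move=> /(_ sdt) HK.
have HK2 : K * (t' - (s + d)) <= K * (t - s) + e / 3.
  have -> : e / 3 = K * (e / (3 * K)) by field; rewrite gt_eqF.
  rewrite -mulrDr ler_pM2l//; apply: (@le_trans _ _ (t - s + h)); last by rewrite lerD2l.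
  exact: time_gap.
have {}Hs := Hs Isd dh2.
exact: three_thirds (Ht hh1) Hs HK HK2.
Qed.

(** Close to t the gradient pairing is almost A(u(t)), which is at least S B^m, and the
    reaction term is almost at most B(t). *)
Lemma mass_dini t (e : R) : good_time t -> 0 < e -> exists2 h, 0 < h &
  forall s, 0 < s -> s < t -> t - h < s ->
  mass t - mass s <= ((p + 1) / p * (mass t - S * mass t `^ m) + e) * (t - s).
Proof.
move=> gt e0; have [_ [Xt AtM]] := gt; have It0 := II0 gt.1.
pose e1 := e * P / 2; have e10 : 0 < e1 by rewrite divr_gt0// mulr_gt0.
have [h1 h10 H1] := dirichlet_near gt e10.
have [h2 h20 H2] := mass_near It0 e10.
pose h := Num.min h1 h2 / 2.
have hm : 0 < Num.min h1 h2 by rewrite !lt_min h10.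
have h0 : 0 < h by rewrite divr_gt0.
have : h < Num.min h1 h2 by rewrite /h ltr_pdivrMr// mulr2n mulrDr mulr1 ltrDl.
rewrite !lt_min => /andP[hh1 hh2].
exists h => // s s0 st ths.
have near_ r : s <= r <= t + h -> `|r - t| <= h.
  by move=> /andP[sr rt]; rewrite ler_distl rt andbT (le_trans (ltW ths)).
have ts0 : 0 < t - s by rewrite subr_gt0.
rewrite -(ler_pM2l P0); apply: (@le_trans _ _ ((mass t + e1 - (A (u t) (u t) - e1)) * (t - s))).
  apply: (mass_increment gt s0 st h0) => r gr /near_ rt; split.
    have := H1 r gr (le_lt_trans rt hh1).
    by rewrite ler_distl => /andP[].
  have := H2 r (II0 gr.1) (le_lt_trans rt hh2).
  rewrite ler_distl => /andP[_ rt'].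
  exact: convex_bound Pi (ltW e10) (ltW P0) P1 rt'.
rewrite mulrA ler_pM2r//.
have := sob Xt (massE It0).
rewrite mulrDr mulrA (_ : P * ((p + 1) / p) = 1); last first.
  by rewrite /P; field; rewrite !gt_eqF.
rewrite mul1r /e1 [P * e]mulrC.
move: (A (u t) (u t)) (S * mass t `^ m) (e * P) => x y z; exact: dini_bound.
Qed.

End weak_flow.

(** * Dini derivatives *)

Lemma sub_le_add {R : realFieldType} (x k k' y y' z : R) :
  x <= k -> 0 <= z -> k <= k' -> - y <= y' -> x - y - z <= k' + y'.
Proof. lra. Qed.

Lemma sub_le0 {R : realFieldType} (x k k' y y' z : R) :
  x <= k -> k <= k' -> - y <= y' -> k' + y' <= z -> x - y - z <= 0.
Proof. lra. Qed.

Section dini_comparison.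
Context {R : realType}.
Local Notation leb := (@lebesgue_measure R).
Implicit Types (f : R -> R) (Z : set R) (a b c e s t h : R).

(** Cover Z by an open set W of measure at most e; phi t is the measure of the part
    of W to the left of t, which has slope 1 on W. *)
Lemma null_set_staircase Z e : leb.-negligible Z -> 0 < e -> exists phi : R -> R,
  [/\ {homo phi : s t / s <= t}, forall t, 0 <= phi t <= e &
    forall t, Z t -> exists2 h, 0 < h & forall s, t - h < s -> s < t ->
      t - s <= phi t - phi s].
Proof.
move=> [Y [mY Y0 ZY]] e0.
have Yoo : (leb Y < +oo)%E by apply: (@eq_ind_r _ 0%E (fun x => x < +oo)%E _ _ Y0).
have [W [oO YO OY]] := @lebesgue_regularity_outer R Y e mY Yoo e0.
have mO : measurable W by exact: open_measurable.
have Oe : (leb W <= e%:E)%E.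
  rewrite -(setDUK YO) setUC; apply: le_trans (measureU2 _ _ _) _ => //.
    exact: measurableD.
  rewrite -[leRHS]adde0; apply: leeD; first exact: ltW.
  exact: (@eq_ind_r _ 0%E (fun x => x <= 0)%E _ _ Y0).
pose L t : set (measurableTypeR R) := W `&` `]-oo, t].
have mL t : measurable (L t) by exact: measurableI.
have LO t : (leb (L t) <= e%:E)%E.
  apply: le_trans Oe; apply: le_measure; rewrite ?inE//; exact: subIsetl.
have Lfin t : leb (L t) \is a fin_num.
  by rewrite ge0_fin_numE// (le_lt_trans (LO t))// ltry.
exists (fun t => fine (leb (L t))); split.
- move=> s t st; apply: fine_le => //; apply: le_measure; rewrite ?inE//.
  by apply: setIS => x /=; rewrite !in_itv/= => /le_trans; apply.
- move=> t; rewrite fine_ge0//= -lee_fin fineK//.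
- move=> t /ZY/YO Ot.
  have /nbhs_ballP[h /= h0 hO] : nbhs t W by exact: open_nbhs_nbhs.
  exists h => // s hs st.
  have E : (leb (L s) + leb (`]s, t]%classic : set (measurableTypeR R)) <= leb (L t))%E.
    rewrite -measureU//.
    - apply: le_measure; rewrite ?inE//; first exact: measurableU.
      move=> x [[Ox]|] /=; rewrite !in_itv/=.
        by move=> xs; split => //=; rewrite in_itv/= (le_trans xs)// ltW.
      move=> /andP[sx xt]; split; last by rewrite /= in_itv.
      apply: hO; rewrite /ball/= ltr_distlC; apply/andP; split.
        by rewrite (lt_trans hs).
      by rewrite (le_lt_trans xt)// ltrDl.
    - apply/seteqP; split => // x [[_]] /=; rewrite !in_itv/= => xs /andP[sx _].
      by move: (lt_le_trans sx xs); rewrite ltxx.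
  move: E; rewrite lebesgue_measure_itv/= lte_fin st -EFinB.
  rewrite -(fineK (Lfin s)) -(fineK (Lfin t)) -EFinD lee_fin.
  by rewrite lerBrDl.
Qed.

(** Subtract from f the line of slope c + e and a multiple of a staircase phi of
    small height that grows with slope 1 at the bad points.  The result g satisfies
    g b <= g a: the infimum t0 of the t with g b <= g t is attained, because g is
    one-sided Lipschitz, and if t0 > a some s < t0 has g t0 <= g s, by the Dini bound
    if t0 is a good point and by the growth of phi if it is a bad one. *)
Lemma dini_comparison f a b c (K : R) : a <= b ->
  (forall s t, a <= s -> s < t -> t <= b -> f t - f s <= K * (t - s)) ->
  {ae leb, forall t, a < t <= b -> forall e, 0 < e -> exists2 h, 0 < h &
     forall s, a < s -> s < t -> t - h < s -> f t - f s <= (c + e) * (t - s)} ->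
  f b - f a <= c * (b - a).
Proof.
move=> ab Lip [Z [mZ Z0 hZ]].
suff key e : 0 < e -> f b - f a <= (c + e) * (b - a) + e.
  apply/ler_addgt0Pr => e e0.
  pose d := e / (b - a + 1); have ba1 : 0 < b - a + 1 by rewrite ltr_wpDl// subr_ge0.
  have d0 : 0 < d by rewrite divr_gt0.
  apply: le_trans (key d d0) _.
  rewrite mulrDl -addrA lerD2l -[X in _ + X]mulr1 -mulrDr /d.
  by rewrite divfK// gt_eqF.
move=> e0; pose K' := `|K| + `|c + e|.
have K'0 : 0 < K' + 1 by rewrite ltr_wpDl// addr_ge0.
have [||phi [phi_homo phi_e phi_Z]] := @null_set_staircase Z (e / (K' + 1)).
- by exists Z; split.
- exact: divr_gt0.
pose g t := f t - (c + e) * t - K' * phi t.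
have gE s t : g t - g s = (f t - f s) - (c + e) * (t - s) - K' * (phi t - phi s).
  by rewrite /g; ring.
have K'0' : 0 <= K' by rewrite addr_ge0.
have gLip s t : a <= s -> s < t -> t <= b -> g t - g s <= K' * (t - s).
  move=> as_ st tb; rewrite gE; have ts : 0 <= t - s by rewrite subr_ge0 ltW.
  have H1 := Lip s t as_ st tb.
  have H2 : 0 <= K' * (phi t - phi s) by rewrite mulr_ge0// subr_ge0 phi_homo// ltW.
  have H3 : K * (t - s) <= `|K| * (t - s) by rewrite ler_wpM2r// ler_norm.
  have H4 : - ((c + e) * (t - s)) <= `|c + e| * (t - s).
    by rewrite -mulNr ler_wpM2r// -normrN ler_norm.
  rewrite [leRHS]mulrDl; exact: sub_le_add H1 H2 H3 H4.
suff gab : g b <= g a.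
  have := gab; rewrite -subr_le0 gE => H.
  have : K' * (phi b - phi a) <= e.
    have /andP[a0 ae] := phi_e a; have /andP[b0 be] := phi_e b.
    apply: (@le_trans _ _ (K' * (e / (K' + 1)))).
      by rewrite ler_wpM2l// lerBlDr (le_trans be)// lerDl.
    rewrite mulrCA ler_piMr ?(ltW e0)// ler_pdivrMr// mul1r lerDl//.
  move: H; move: (K' * _) ((c + e) * _) (f b - f a) => x y z; lra.
pose Q := [set t | a <= t <= b /\ g b <= g t].
have Qb : Q b by split; rewrite ?ab ?lexx.
have Qlb : has_lbound Q by exists a => t [/andP[]].
have Qinf : has_inf Q by split => //; exists b.
set t0 := inf Q.
have at0 : a <= t0 by apply: lb_le_inf; [exists b|move=> t [/andP[]]].
have t0b : t0 <= b by apply: ge_inf.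
have Qt0 : g b <= g t0.
  apply/ler_addgt0Pr => d d0.
  have d'0 : 0 < d / (K' + 1) by exact: divr_gt0.
  have [t [/andP[at_ tb] gt] td] := inf_adherent d'0 Qinf.
  have t0t : t0 <= t by apply: ge_inf => //; split => //; rewrite at_.
  move: t0t; rewrite le_eqVlt => /predU1P[->|t0t].
    by rewrite (le_trans gt)// lerDl ltW.
  have := gLip t0 t at0 t0t tb; rewrite lerBlDl => H.
  apply: le_trans gt _; apply: le_trans H _; rewrite lerD2l.
  apply: (@le_trans _ _ (K' * (d / (K' + 1)))).
    by rewrite ler_wpM2l// lerBlDl ltW.
  by rewrite mulrCA ler_piMr ?(ltW d0)// ler_pdivrMr// mul1r lerDl.
move: at0; rewrite le_eqVlt => /predU1P[->//|at0]; exfalso.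
suff [s [as_ st gs]] : exists s, [/\ a < s, s < t0 & g t0 <= g s].
  have : t0 <= s.
    apply: ge_inf => //; split; last exact: le_trans gs.
    by rewrite (ltW as_) (le_trans (ltW st)).
  by rewrite leNgt st.
have pick h : 0 < h -> exists s, [/\ a < s, s < t0 & t0 - h < s].
  move=> h0; pose d := Num.min h (t0 - a) / 2.
  have m0 : 0 < Num.min h (t0 - a) by rewrite lt_min h0 subr_gt0.
  have d0 : 0 < d by rewrite divr_gt0.
  have : d < Num.min h (t0 - a) by rewrite /d ltr_pdivrMr// mulr2n mulrDr mulr1 ltrDl.
  rewrite lt_min => /andP[dh da]; exists (t0 - d); split.
  - by rewrite ltrBrDr -ltrBrDl.
  - by rewrite ltrBlDr ltrDl.
  - by rewrite ltrD2l ltrN2.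
have [Zt|nZ] := pselect (Z t0).
  have [h h0 H] := phi_Z _ Zt; have [s [as_ st hs]] := pick h h0.
  exists s; split => //; rewrite -subr_le0 gE.
  have ts : 0 <= t0 - s by rewrite subr_ge0 ltW.
  have H1 := Lip s t0 (ltW as_) st t0b.
  have H2 := ler_wpM2l K'0' (H s hs st).
  have H3 : K * (t0 - s) <= `|K| * (t0 - s) by rewrite ler_wpM2r// ler_norm.
  have H4 : - ((c + e) * (t0 - s)) <= `|c + e| * (t0 - s).
    by rewrite -mulNr ler_wpM2r// -normrN ler_norm.
  move: H2; rewrite [X in X <= _ -> _]mulrDl; exact: sub_le0 H1 H3 H4.
have Dt : forall e, 0 < e -> exists2 h, 0 < h &
     forall s, a < s -> s < t0 -> t0 - h < s -> f t0 - f s <= (c + e) * (t0 - s).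
  apply: contrapT => H; apply: nZ; apply: hZ => /= H'; apply: H; apply: H'.
  by rewrite at0 t0b.
have [h h0 H] := Dt e e0; have [s [as_ st hs]] := pick h h0.
exists s; split => //; rewrite -subr_le0 gE subr_le0.
apply: (@le_trans _ _ 0); first by rewrite subr_le0; exact: H.
by rewrite mulr_ge0// subr_ge0 phi_homo// ltW.
Qed.

End dini_comparison.

(** * The extinction inequality *)

Section extinction_inequality.
Context {R : realType}.
Local Notation leb := (@lebesgue_measure R).
Variables (b : R -> R) (T : \bar R) (K S delta q m : R).
Hypothesis m0 : 0 < m.
Hypothesis m1 : m < 1.
Hypothesis S0 : 0 < S.
Hypothesis delta1 : delta < 1.
Hypothesis q0 : 0 < q.
Hypothesis b_ge0 : forall t, 0 <= b t.
Hypothesis K0 : 0 < K.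
Hypothesis b_lip : forall s t : R, 0 <= s -> s < t -> (t%:E < T)%E ->
  b t - b s <= K * (t - s).
Hypothesis b_near : forall t e : R, 0 <= t -> (t%:E < T)%E -> 0 < e ->
  exists2 h, 0 < h & forall s, 0 <= s -> s < t -> t - h < s -> b s <= b t + e.
Hypothesis b_dini : {ae leb, forall t, 0 < t /\ (t%:E < T)%E -> forall e : R, 0 < e ->
  exists2 h, 0 < h & forall s, 0 < s -> s < t -> t - h < s ->
  b t - b s <= (q * (b t - S * b t `^ m) + e) * (t - s)}.
Hypothesis b_init : b 0 `^ (1 - m) <= S * delta.

Let m1' : 0 < 1 - m. Proof. by rewrite subr_gt0. Qed.

Let bE t : b t - S * b t `^ m = - (b t `^ m * (S - b t `^ (1 - m))).
Proof.
rewrite mulrBr opprB; congr (_ - _); last by rewrite mulrC.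
have [b0|] := ltP 0 (b t).
  by rewrite -powRD_gt0// addrC subrK powRr1.
rewrite le_eqVlt ltNge b_ge0 orbF => /eqP ->.
by rewrite powR0 ?gt_eqF// mul0r.
Qed.

(** The positive equilibrium of b' = q (b - S b^m), an unstable one. *)
Let mass_barrier := S `^ (1 - m)^-1.

Let barrier_sign t : b t <= mass_barrier -> b t - S * b t `^ m <= 0.
Proof.
move=> bB; rewrite bE oppr_le0 mulr_ge0 ?powR_ge0// subr_ge0.
have := le_powR (ltW m1') (b_ge0 t) bB; rewrite /mass_barrier -powRrM mulVf ?gt_eqF//.
by rewrite powRr1// ltW.
Qed.

Let barrier_start : b 0 < mass_barrier.
Proof.
have SS : b 0 `^ (1 - m) < S by rewrite (le_lt_trans b_init)// gtr_pMr.
have i0 : 0 < (1 - m)^-1 by rewrite invr_gt0.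
have := lt_powR i0 (powR_ge0 _ _) SS.
by rewrite -powRrM mulfV ?gt_eqF// powRr1.
Qed.

Lemma decrease_below_barrier s t : 0 <= s -> s <= t -> (t%:E < T)%E ->
  (forall r, s <= r <= t -> b r <= mass_barrier) -> b t <= b s.
Proof.
move=> s0 st tT H; rewrite -subr_le0 -(mul0r (t - s)).
apply: (dini_comparison st (K := K)).
  move=> r r' sr rr' r't; apply: b_lip => //; first exact: le_trans sr.
  by apply: le_lt_trans tT; rewrite lee_fin.
apply: (@filterS _ _ (ae_filter_ringOfSetsType leb) _ _ _ b_dini) => r Hr /andP[sr rt] e e0.
have [|h h0 Hh] := Hr _ e e0.
  split; first exact: le_lt_trans sr.
  by apply: le_lt_trans tT; rewrite lee_fin.
exists h => // r' sr' r'r hr'.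
apply: le_trans (Hh r' _ r'r hr') _; first exact: le_lt_trans sr'.
rewrite ler_pM2r ?subr_gt0// lerD2r mulr_ge0_le0 ?(ltW q0)// barrier_sign// H//.
by rewrite (ltW sr).
Qed.

(** Let r be the supremum of the times up to which b <= b 0.  The Lipschitz bound keeps
    b below the barrier on a further interval, and there b decreases, so r cannot be
    smaller than t. *)
Lemma mass_le_init t : 0 <= t -> (t%:E < T)%E -> b t <= b 0.
Proof.
move=> t0 tT; pose Q := [set r | 0 <= r <= t /\ forall s, 0 <= s <= r -> b s <= b 0].
have Q0 : Q 0 by split=> [|s]; rewrite ?lexx// -eq_le => /eqP <-.
have Qsup : has_sup Q by split; [exists 0|exists t => r [/andP[]]].
set r := sup Q.
have r0 : 0 <= r by apply: ub_le_sup => //; have [] := Qsup.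
have rt : r <= t by apply: ge_sup; [exists 0|move=> s [/andP[]]].
have rT : (r%:E < T)%E by apply: le_lt_trans tT; rewrite lee_fin.
have before s : 0 <= s -> s < r -> b s <= b 0.
  move=> s0 sr; have := sup_adherent (_ : 0 < r - s) Qsup.
  rewrite subr_gt0 => /(_ sr)[r' [/andP[r'0 r't] Qr']]; rewrite -/r subKr => sr'.
  by apply: Qr'; rewrite s0 ltW.
have br : b r <= b 0.
  move: r0; rewrite le_eqVlt => /predU1P[<-//|r0].
  apply/ler_addgt0Pr => e e0.
  pose d := Num.min (r / 2) (e / K).
  have d0 : 0 < d by rewrite lt_min !divr_gt0.
  have dr : d < r by rewrite gt_min ltr_pdivrMr// mulr2n mulrDr mulr1 ltrDl r0.
  have s0 : 0 <= r - d by rewrite subr_ge0 ltW.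
  have sr : r - d < r by rewrite ltrBlDr ltrDl.
  have := b_lip s0 sr rT; rewrite subKr lerBlDl => /le_trans; apply.
  apply: lerD; first exact: before.
  by rewrite mulrC -ler_pdivlMr// ge_min lexx orbT.
pose h := (mass_barrier - b 0) / K.
have h0 : 0 < h by rewrite divr_gt0// subr_gt0.
pose r1 := Num.min t (r + h).
have r1t : r1 <= t by rewrite ge_min lexx.
have rr1 : r <= r1 by rewrite le_min rt lerDl ltW.
have below s : 0 <= s <= r1 -> b s <= mass_barrier.
  move=> /andP[s0 sr1]; have [sr|rs] := leP s r.
    move: sr; rewrite le_eqVlt => /predU1P[->|sr]; apply: le_trans (ltW barrier_start) => //.
    exact: before.
  have sT : (s%:E < T)%E by apply: le_lt_trans tT; rewrite lee_fin (le_trans sr1).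
  have := b_lip r0 rs sT; rewrite lerBlDl => /le_trans; apply.
  have sh : s - r <= h by rewrite lerBlDl (le_trans sr1)// ge_min lexx orbT.
  have Kh : K * h = mass_barrier - b 0 by rewrite /h mulrC divfK ?gt_eqF.
  have := ler_wpM2l (ltW K0) sh; rewrite Kh => H.
  by apply: le_trans (lerD br H) _; rewrite addrC subrK.
have Qr1 : Q r1.
  split; first by rewrite r1t (le_trans r0).
  move=> s /andP[s0 sr1]; apply: decrease_below_barrier => //.
    by apply: le_lt_trans tT; rewrite lee_fin (le_trans sr1).
  by move=> r' /andP[r'0 r's]; apply: below; rewrite r'0 (le_trans r's).
have : r1 <= r by apply: ub_le_sup => //; have [] := Qsup.
rewrite ge_min => /orP[tr|]; last by rewrite -[X in _ <= X]addr0 lerD2l leNgt h0.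
by have -> : t = r by apply/eqP; rewrite eq_le tr.
Qed.

Lemma mass_nonincreasing s t : 0 <= s -> s <= t -> (t%:E < T)%E -> b t <= b s.
Proof.
move=> s0 st tT; apply: decrease_below_barrier => // r /andP[sr rt].
apply: le_trans (ltW barrier_start); apply: mass_le_init; first exact: le_trans sr.
by apply: le_lt_trans tT; rewrite lee_fin.
Qed.

Let C := S * (1 - delta) * q.

Lemma extinction_rate_gt0 : 0 < C. Proof. by rewrite !mulr_gt0// subr_gt0. Qed.

Let rate_bound t : 0 <= t -> (t%:E < T)%E -> q * (b t - S * b t `^ m) <= - (C * b t `^ m).
Proof.
move=> t0 tT; rewrite bE /C.
have H : b t `^ (1 - m) <= S * delta.
  exact: le_trans (le_powR (ltW m1') (b_ge0 t) (mass_le_init t0 tT)) b_init.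
rewrite mulrN lerN2; have -> : S * (1 - delta) * q * b t `^ m =
  q * (b t `^ m * (S - S * delta)) by ring.
by rewrite ler_pM2l// ler_wpM2l ?powR_ge0//; exact: lerB.
Qed.

(** By the tangent inequality at b s, the increment of b^(1-m) over [s, r] is at most
    (1-m) (b s)^(-m) (b r - b s), while b r - b s is at most about - C (b r)^m (r - s).  The two
    powers cancel as s tends to r, since b s tends to b r. *)
Lemma power_mass_decay t : 0 <= t -> (t%:E < T)%E -> 0 < b t ->
  b t `^ (1 - m) <= b 0 `^ (1 - m) - C * (1 - m) * t.
Proof.
move=> t0 tT bt0.
have -> : b 0 `^ (1 - m) - C * (1 - m) * t =
  b 0 `^ (1 - m) + - (C * (1 - m)) * (t - 0) by ring.
rewrite -lerBlDl.
have C0 := extinction_rate_gt0.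
have pos r : 0 <= r -> r <= t -> 0 < b r.
  by move=> r0 rt; apply: lt_le_trans bt0 _; exact: mass_nonincreasing.
have conc r s : 0 <= s -> s < r -> r <= t ->
    b r `^ (1 - m) - b s `^ (1 - m) <= (1 - m) * b s `^ (- m) * (b r - b s).
  move=> s0 sr rt; have bs := pos s s0 (ltW (lt_le_trans sr rt)).
  have := @powR_tangent _ (b s) (b r) (1 - m).
  rewrite m1' ltrBlDr ltrDl m0 => /(_ isT bs (b_ge0 r)).
  by rewrite lerBlDl (_ : 1 - m - 1 = - m)//; ring.
have dec r s : 0 <= s -> s < r -> r <= t -> b r <= b s.
  move=> s0 sr rt; apply: mass_nonincreasing => //; first exact: ltW.
  by apply: le_lt_trans tT; rewrite lee_fin.
apply: (dini_comparison (f := fun t => b t `^ (1 - m)) t0 (K := 0)).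
  move=> s r s0 sr rt; rewrite mul0r; apply: le_trans (conc r s s0 sr rt) _.
  apply: mulr_ge0_le0; first by rewrite mulr_ge0 ?powR_ge0// ltW.
  by rewrite subr_le0; exact: dec.
apply: (@filterS _ _ (ae_filter_ringOfSetsType leb) _ _ _ b_dini) => r Hr /andP[r0 rt] e e0.
have rT : (r%:E < T)%E by apply: le_lt_trans tT; rewrite lee_fin.
have br := pos r (ltW r0) rt.
pose y := b r `^ m; have y0 : 0 < y by exact: powR_gt0.
pose k := m * b r `^ (m - 1); have k0 : 0 < k by rewrite mulr_gt0// powR_gt0.
pose e1 := e * y / 2; have e10 : 0 < e1 by rewrite divr_gt0// mulr_gt0.
pose e2 := e * y / (2 * (C * k)); have e20 : 0 < e2.
  by rewrite divr_gt0//; [exact: mulr_gt0|rewrite mulr_gt0// mulr_gt0].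
have [|h1 h10 H1] := Hr _ e1 e10; first by split.
have [h2 h20 H2] := b_near (ltW r0) rT e20.
exists (Num.min h1 h2); first by rewrite lt_min h10.
move=> s s0 sr; rewrite ltrBlDr -ltrBlDl lt_min => /andP[sh1 sh2].
have sh1' : r - h1 < s by rewrite ltrBlDr -ltrBlDl.
have sh2' : r - h2 < s by rewrite ltrBlDr -ltrBlDl.
have rs0 : 0 < r - s by rewrite subr_gt0.
apply: le_trans (conc r s (ltW s0) sr rt) _.
have bs := pos s (ltW s0) (ltW (lt_le_trans sr rt)).
have D1 := H1 s s0 sr sh1'; have D2 := H2 s (ltW s0) sr sh2'.
have {}D1 : b r - b s <= (- (C * y) + e1) * (r - s).
  apply: le_trans D1 _; rewrite ler_pM2r// lerD2r; apply: rate_bound => //; exact: ltW.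
have x0 : 0 < b s `^ m by exact: powR_gt0.
have xy : b s `^ m <= y + k * e2.
  have m01 : 0 < m < 1 by rewrite m0.
  apply: le_trans (powR_tangent m01 br (ltW bs)) _.
  by rewrite lerD2l ler_pM2l// lerBlDl.
have yx : y <= b s `^ m.
  by apply: le_powR; [exact: ltW|exact: ltW|exact: dec (ltW s0) sr rt].
have key : (b s `^ m)^-1 * (- (C * y) + e1) <= - C + e.
  rewrite ler_pdivrMl//; have -> : - (C * y) + e1 = - (C * (y + k * e2)) + e * y.
    by rewrite /e1 /e2; field; rewrite !gt_eqF.
  have -> : b s `^ m * (- C + e) = - (C * b s `^ m) + e * b s `^ m by ring.
  by apply: lerD; rewrite ?lerN2 ler_pM2l.
have H3 : b s `^ (- m) * (b r - b s) <= (- C + e) * (r - s).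
  rewrite powRN; apply: (@le_trans _ _ ((b s `^ m)^-1 * ((- (C * y) + e1) * (r - s)))).
    by rewrite ler_pM2l ?invr_gt0.
  by rewrite mulrA ler_pM2r.
rewrite -mulrA; apply: le_trans (ler_wpM2l (ltW m1') H3) _.
rewrite mulrA ler_pM2r// mulrDr mulrN [_ * C]mulrC lerD2l.
by rewrite ler_piMl ?(ltW e0)// lerBlDr lerDl ltW.
Qed.

Lemma extinction_bound t : 0 <= t -> (t%:E < T)%E ->
  b t <= if t < b 0 `^ (1 - m) / (C * (1 - m)) then
    (b 0 `^ (1 - m) - C * (1 - m) * t) `^ (1 - m)^-1 else 0.
Proof.
move=> t0 tT; have [bt0|bt0] := ltP 0 (b t); last first.
  by apply: le_trans bt0 _; case: ifP => // _; exact: powR_ge0.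
have H := power_mass_decay t0 tT bt0.
have Cm : 0 < C * (1 - m) by rewrite mulr_gt0// extinction_rate_gt0.
have H0 : 0 < b 0 `^ (1 - m) - C * (1 - m) * t by apply: lt_le_trans H; exact: powR_gt0.
rewrite ltr_pdivlMr// mulrC -subr_gt0 H0.
have i0 : 0 <= (1 - m)^-1 by rewrite invr_ge0 ltW.
have := le_powR i0 (powR_ge0 _ _) H.
by rewrite -powRrM mulfV ?gt_eqF// powRr1.
Qed.

End extinction_inequality.

Lemma lebesgue_rV_bounded_fin {R : realType} n (A : set 'rV[R]_n) : open A ->
  bounded_set A -> (lebesgue_rV R n A < +oo)%E.
Proof.
move=> oA /bounded_rV_sub_cbox[r Ar].
apply: le_lt_trans (lebesgue_rV_cbox_fin (fun=> - r) (fun=> r)).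
apply: le_measure => //; rewrite inE; first exact: open_rV_measurable.
exact: measurable_rV_cbox.
Qed.

Theorem theorem4p4 (R : realType) (N : nat) (Omega : set 'rV[R]_N)
    (T : \bar R) (u0 : 'rV[R]_N -> R) (delta1 delta2 : R)
    (u : R -> 'rV[R]_N -> R) :
  (3 <= N)%N ->
  smooth_bounded_domain Omega ->
  (0 < T)%E ->
  H10 Omega u0 ->
  (funE Omega u0 < depth Omega)%E ->
  (0 < funD Omega u0)%E ->
  0 < delta1 -> delta1 < delta2 ->
  depthd Omega delta1 = funE Omega u0 ->
  depthd Omega delta2 = funE Omega u0 ->
  weak_solution Omega T u0 u ->
  let p := critical_exponent R N in
  let gamma := 2 / (p + 1) in
  let B (t : R) := (normL Omega (p + 1) (u t) `^ (p + 1))%E in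
  let B0 := fine (B 0) in
  let C := sobolev Omega * (1 - delta1) * ((p + 1) / p) in
  let tstar := B0 `^ (1 - gamma) / (C * (1 - gamma)) in
  forall t : R, 0 <= t -> (t%:E < T)%E ->
    (B t <= (if t < tstar
             then (B0 `^ (1 - gamma) - C * (1 - gamma) * t) `^ ((1 - gamma)^-1)
             else 0)%:E)%E.
Proof.
move=> N3 [oO _ _ bO _] T0 Xu0 Eu0 Du0 d10 d12 Ed1 Ed2.
move=> [[_ [M uM]] _ ueq [mu_ ucont] u00] p gamma B B0 C tstar t t0 tT.
have foO := lebesgue_rV_bounded_fin oO bO.
have p1 : 1 < p := critical_exponent_gt1 N3.
have [m0 m1 _ _ _] := well_exponents p1.
have S0 := sobolev_gt0 oO foO N3 Xu0 Eu0 Du0.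
have sob := sobolev_ineq oO N3.
have XB := H10_funB_fin oO foO N3 Xu0 Eu0 Du0.
have [d1 init] := initial_well oO foO N3 Xu0 Eu0 Du0 d10 d12 Ed1 Ed2.
pose M' := Num.max M 1.
have M'0 : 0 < M' by rewrite lt_max ltr01 orbT.
have uM' : {ae @lebesgue_measure R, forall t, [set t0 | 0 < t0 /\ (t0%:E < T)%E] t ->
    H10 Omega (u t) /\ (funA Omega (u t) <= M'%:E)%E}.
  apply: (@filterS _ _ (ae_filter_ringOfSetsType (@lebesgue_measure R)) _ _ _ uM) => s H Is.
  have [Xs AsM] := H Is; split => //; apply: le_trans AsM _.
  by rewrite lee_fin le_max lexx.
have I00 : [set t0 | 0 <= t0 /\ (t0%:E < T)%E] (0 : R) by split.
have E0 : funB Omega (u 0) = funB Omega u0.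
  exact: funB_ae (mu_ 0 I00) (H10_measurable Xu0) u00.
have BE s : B s = funB Omega (u s) by rewrite /B normLE.
have massE_ := massE oO N3 uM' mu_ ucont XB.
have [K K0 lip] := mass_lipschitz oO N3 M'0 S0 uM' ueq mu_ ucont XB sob.
have q0 : 0 < (p + 1) / p.
  have p0 : 0 < p by exact: lt_trans p1.
  by rewrite divr_gt0// addr_gt0.
have near_ (r e : R) : 0 <= r -> (r%:E < T)%E -> 0 < e -> exists2 h : R, 0 < h &
    forall s : R, 0 <= s -> s < r -> r - h < s -> mass Omega u s <= mass Omega u r + e.
  move=> r0 rT e0.
  have [h h0 H] := mass_near oO N3 uM' mu_ ucont XB (conj r0 rT) e0.
  exists h => // s s0 sr hs.
  have sT : (s%:E < T)%E by apply: lt_trans rT; rewrite lte_fin.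
  have := H s (conj s0 sT); rewrite distrC ger0_norm ?subr_ge0 ?(ltW sr)//.
  by rewrite ltrBlDl -ltrBlDr => /(_ hs); rewrite ler_distl => /andP[].
have dini : {ae @lebesgue_measure R, forall r : R, 0 < r /\ (r%:E < T)%E ->
    forall e : R, 0 < e -> exists2 h : R, 0 < h & forall s : R, 0 < s -> s < r ->
    r - h < s -> mass Omega u r - mass Omega u s <=
      ((p + 1) / p * (mass Omega u r - sobolev Omega * mass Omega u r `^ gamma) + e) *
      (r - s)}.
  apply: (@filterS _ _ (ae_filter_ringOfSetsType (@lebesgue_measure R)) _ _ _
    (good_time_ae oO uM')) => r gr Ir e e0.
  exact: (mass_dini oO foO N3 M'0 S0 uM' ueq mu_ ucont XB sob (gr Ir) e0).
have init' : mass Omega u 0 `^ (1 - gamma) <= sobolev Omega * delta1 by rewrite /mass E0.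
have EB := extinction_bound m0 m1 S0 d1 q0 (mass_ge0 Omega u) K0 lip near_ dini init' t0 tT.
rewrite BE (massE_ _ (conj t0 tT)) lee_fin.
have B0E : B0 = mass Omega u 0 by rewrite /B0 BE.
by rewrite /tstar B0E; exact: EB.
Qed.
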